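(* Let $m,n\ge0$ and $d\ge1$ be integers, let $V$ be an orthosymplectic superspace with $\mathrm{sdim}(V_{\mathbb C})=(m|2n)$, and let $G=\mathrm{OSp}(V)$. Then the kernel of the surjective homomorphism $\eta:B_d(m-2n):=B_d^d\to\mathrm{End}_G(T^d(V))$ is $\mathbb U^d(D_0I(m,n))$.
   Context: Grassmann algebra: $\Lambda=\varinjlim\Lambda(N)$, the direct limit of the exterior algebras of $\mathbb C^N$, $\mathbb Z/2\mathbb Z$-graded by parity of degree. $[x]$ denotes parity. Orthosymplectic superspace: $V_{\mathbb C}=(V_{\mathbb C})_{\bar0}\oplus(V_{\mathbb C})_{\bar1}$, $\dim (V_{\mathbb C})_{\bar 0}=m$, $\dim (V_{\mathbb C})_{\bar 1}=2n$, with a non-degenerate even supersymmetric bilinear form ($(u,v)=(-1)^{[u][v]}(v,u)$). $V=V_{\mathbb C}\otimes_{\mathbb C}\Lambda$ (with $\lambda v=(-1)^{[\lambda][v]}v\lambda$), with the form extended to $(-,-):V\times V\to\Lambda$, $(\lambda v,v'\lambda')=\lambda(v,v')\lambda'$. $\mathrm{GL}(V)$ is the group of invertible elements of $\mathrm{End}_\Lambda(V)_{\bar0}$, $\mathrm{OSp}(V)=\{g\in\mathrm{GL}(V):(gv,gw)=(v,w)\ \forall v,w\}$. $T^d(V)=V^{\otimes_\Lambda d}$, with diagonal action of $G$; $\mathrm{End}_G(T^d(V))$ is the algebra of $\Lambda$-endomorphisms commuting with $G$. Brauer diagrams: $B_p^q$ is the free $\Lambda$-module with basis the Brauer diagrams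 $p\to q$, i.e. perfect matchings of $p$ bottom points and $q$ top points (each row ordered left to right). $B_d(m-2n)=B_d^d$ is the Brauer algebra over $\Lambda$ with parameter $m-2n$ (each closed loop in a composite is replaced by the factor $m-2n$), with standard generators $s_i$ (crossing of strands $i,i+1$) and $e_i$ (cup-cap at positions $i,i+1$), $1\le i\le d-1$. The map $\eta$: the algebra homomorphism with $\eta(s_i)$ = the operator applying $\tau(v\otimes w)=(-1)^{[v][w]}w\otimes v$ to the factors $i,i+1$, and $\eta(e_i)$ = the operator applying $\gamma(v\otimes w)=(v,w)c_0$ to the factors $i,i+1$, where $c_0=\sum_a e_a\otimes e_a^*$ for bases $(e_a)$, $(e_a^* )$ of $V_{\mathbb C}$ with $(e_a^*,e_b)=\delta_{ab}$. It is known that $\eta$ is well defined and surjective. The map $\mathbb U$: for $p>0$, $\mathbb U:B_p^q\to B_{p-1}^{q+1}$ is the $\Lambda$-module isomorphism which bends the leftmost bottom point of a diagram up so that it becomes the leftmost top point. $\mathbb U^d:B_{2d}^0\to B_d^d$ is its $d$-fold iterate; it sends bottom point $i\le d$ of a diagram $2d\to0$ to top point $d+1-i$ and bottom point $d+j$ to bottom point $j$ ($1\le j\le d$). $D_0\in B_{2d}^0$ is the diagram pairing $2i-1$ with $2i$ for $i=1,\dots,d$. $\Lambda\mathrm{Sym}_{2d}$ acts on the right on $B_{2d}^0$: $D\pi$ has pairs $\{\pi^{-1}(a),\pi^{-1}(b)\}$ for $\{a,b\}$ a pair of $D$. $I(m,n)\subseteq\Lambda\mathrm{Sym}_{2d}$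 is the sum of the ideals $I(\mu)$, over partitions $\mu$ of $2d$ whose Young diagram contains a rectangle with $m+1$ rows and $2n+1$ columns, where $I(\mu)=\Lambda\otimes_{\mathbb C}$(the simple two-sided ideal of $\mathbb C\mathrm{Sym}_{2d}$ corresponding to $\mu$, the one-row partition corresponding to the trivial representation). *)

(* Defs.v *)
From HB Require Import structures.
From mathcomp Require Import all_boot all_order all_algebra all_fingroup.
From mathcomp Require Import finmap monalg.
From mathcomp Require Import reals complex.
From mathcomp Require Import ring.

Set Implicit Arguments.
Unset Strict Implicit.
Unset Printing Implicit Defensive.

Import GRing.Theory.
Local Open Scope ring_scope.

(* The exterior algebra of C^N has a basis of monomials indexed by the subsets
   of {0, .., N-1}; in the direct limit over N the index set becomes the set of
   all finite subsets of nat.  The finite set {s_1 < .. < s_k} stands for the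
   monomial theta_(s_1) ... theta_(s_k). *)
Definition grassmann (C : fieldType) : Type := {malg C[{fset nat}]}.

HB.instance Definition _ (C : fieldType) :=
  GRing.Lmodule.copy (grassmann C) {malg C[{fset nat}]}.

Definition ginv (S T : {fset nat}) : nat :=
  (\sum_(s <- S) \sum_(t <- T) (t < s))%N.

(* theta_S theta_T = gsign S T * theta_(S u T) *)
Definition gsign (C : fieldType) (S T : {fset nat}) : C :=
  if [disjoint S & T]%fset then (-1) ^+ ginv S T else 0.

Definition gone (C : fieldType) : grassmann C := << 1 *g fset0 >>.

Definition gmul_def (C : fieldType) (x y : grassmann C) : grassmann C :=
  \sum_(S <- msupp x) \sum_(T <- msupp y)
    << x@_S * y@_T * gsign C S T *g (S `|` T)%fset >>.

Fact gmul_key : unit. Proof. by []. Qed.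
Definition gmul (C : fieldType) := locked_with gmul_key (@gmul_def C).
Canonical gmul_unlockable C := [unlockable fun @gmul C].

Section GrassmannRing.
Context (C : fieldType).
Implicit Types (x y z : grassmann C) (S T U : {fset nat}).

Lemma ginvUl S T U : [disjoint S & T]%fset ->
  ginv (S `|` T)%fset U = (ginv S U + ginv T U)%N.
Proof.
move=> dST; rewrite /ginv; rewrite (perm_big (enum_fset S ++ enum_fset T)).
  by rewrite big_cat.
apply: uniq_perm; rewrite ?fset_uniq ?cat_uniq ?fset_uniq ?andbT //=.
  by apply/hasPn => t tT; apply/negP => tS; have /fdisjointP/(_ t tS)/negP := dST.
by move=> t; rewrite mem_cat in_fsetU.
Qed.

Lemma ginvUr S T U : [disjoint T & U]%fset ->
  ginv S (T `|` U)%fset = (ginv S T + ginv S U)%N.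
Proof.
move=> dTU; rewrite /ginv -big_split; apply: eq_bigr => s _.
rewrite (perm_big (enum_fset T ++ enum_fset U)); first by rewrite big_cat.
apply: uniq_perm; rewrite ?fset_uniq ?cat_uniq ?fset_uniq ?andbT //=.
  by apply/hasPn => t tU; apply/negP => tT; have /fdisjointP/(_ t tT)/negP := dTU.
by move=> t; rewrite mem_cat in_fsetU.
Qed.

Lemma gsignA S T U :
  gsign C S T * gsign C (S `|` T)%fset U = gsign C T U * gsign C S (T `|` U)%fset.
Proof.
rewrite /gsign fdisjointUX fdisjointXU.
case: (boolP [disjoint S & T]%fset) => dST /=; last first.
  by rewrite mul0r mulr0.
case: (boolP [disjoint T & U]%fset) => dTU /=; last first.
  by rewrite andbF mul0r mulr0.
rewrite andbT; case: ifP => _; last by rewrite !mulr0.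
by rewrite ginvUl // ginvUr // -!exprD; congr (_ ^+ _); ring.
Qed.

Lemma gsign0S S : gsign C fset0 S = 1.
Proof. by rewrite /gsign fdisjoint0X /ginv big_nil. Qed.

Lemma gsignS0 S : gsign C S fset0 = 1.
Proof.
by rewrite /gsign fdisjointX0 /ginv big1 // => s _; rewrite big_nil.
Qed.

Lemma gmulw (d1 d2 : {fset {fset nat}}) x y :
  (msupp x `<=` d1)%fset -> (msupp y `<=` d2)%fset ->
  gmul x y = \sum_(S <- d1) \sum_(T <- d2)
    << x@_S * y@_T * gsign C S T *g (S `|` T)%fset >>.
Proof.
move=> le1 le2; rewrite unlock /gmul_def (big_fset_incl _ le1) /=; last first.
  move=> S _ /mcoeff_outdom ->; rewrite big1 // => T _.
  by rewrite !mul0r monalgU0.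
apply: eq_bigr => S _; rewrite (big_fset_incl _ le2) //=.
by move=> T _ /mcoeff_outdom ->; rewrite mulr0 mul0r monalgU0.
Qed.

Lemma gmulDl : left_distributive (@gmul C) +%R.
Proof.
move=> x y z; pose D := (msupp x `|` msupp y `|` msupp (x + y))%fset.
have le1 : (msupp x `<=` D)%fset by rewrite /D -fsetUA fsubsetUl.
have le2 : (msupp y `<=` D)%fset.
  by rewrite /D (fsetUC (msupp x)) -fsetUA fsubsetUl.
have le3 : (msupp (x + y : grassmann C) `<=` D)%fset by rewrite fsubsetUr.
have le0 := fsubset_refl (msupp z).
rewrite (gmulw le1 le0) (gmulw le2 le0) (gmulw le3 le0).
rewrite -big_split; apply: eq_bigr => S _; rewrite -big_split.
by apply: eq_bigr => T _; rewrite /= -monalgUD mcoeffD !mulrDl.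
Qed.

Lemma gmulDr : right_distributive (@gmul C) +%R.
Proof.
move=> x y z; pose D := (msupp y `|` msupp z `|` msupp (y + z))%fset.
have le1 : (msupp y `<=` D)%fset by rewrite /D -fsetUA fsubsetUl.
have le2 : (msupp z `<=` D)%fset.
  by rewrite /D (fsetUC (msupp y)) -fsetUA fsubsetUl.
have le3 : (msupp (y + z : grassmann C) `<=` D)%fset by rewrite fsubsetUr.
have le0 := fsubset_refl (msupp x).
rewrite (gmulw le0 le1) (gmulw le0 le2) (gmulw le0 le3).
rewrite -big_split; apply: eq_bigr => S _; rewrite -big_split.
by apply: eq_bigr => T _; rewrite /= -monalgUD mcoeffD mulrDr !mulrDl.
Qed.

Lemma gmul0x : left_zero 0 (@gmul C).
Proof. by move=> x; rewrite unlock /gmul_def msupp0 big_nil. Qed.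

Lemma gmulx0 : right_zero 0 (@gmul C).
Proof. by move=> x; rewrite unlock /gmul_def big1 // => S _; rewrite msupp0 big_nil. Qed.

Lemma gmul_suml (I : Type) (r : seq I) (F : I -> grassmann C) y :
  gmul (\sum_(i <- r) F i) y = \sum_(i <- r) gmul (F i) y.
Proof.
elim: r => [|i r IH]; first by rewrite !big_nil gmul0x.
by rewrite !big_cons gmulDl IH.
Qed.

Lemma gmul_sumr (I : Type) (r : seq I) (F : I -> grassmann C) x :
  gmul x (\sum_(i <- r) F i) = \sum_(i <- r) gmul x (F i).
Proof.
elim: r => [|i r IH]; first by rewrite !big_nil gmulx0.
by rewrite !big_cons gmulDr IH.
Qed.

Lemma gmulUU (a b : C) S T :
  gmul << a *g S >> << b *g T >> = << a * b * gsign C S T *g (S `|` T)%fset >>.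
Proof.
rewrite (gmulw (d1 := [fset S]%fset) (d2 := [fset T]%fset)) ?msuppU_le //.
by rewrite !big_seq_fset1 !mcoeffUU.
Qed.

Lemma grassmann_ind (P : grassmann C -> Prop) :
  P 0 -> (forall c S x, P x -> P (<< c *g S >> + x)) -> forall x, P x.
Proof.
move=> P0 PD x; rewrite [x]monalgE.
by elim: (enum_fset _) => [|S r IH]; rewrite ?big_nil // big_cons; apply: PD.
Qed.

Lemma gmulAUU (a b : C) S T z :
  gmul << a *g S >> (gmul << b *g T >> z) = gmul (gmul << a *g S >> << b *g T >>) z.
Proof.
elim/grassmann_ind: z => [|c U z IHz]; first by rewrite !gmulx0.
rewrite (gmulDr << b *g T >> _ z) (gmulDr << a *g S >> _ (gmul _ z)) IHz.
rewrite (gmulDr (gmul _ _) _ z) !gmulUU fsetUA.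
suff -> : a * (b * c * gsign C T U) * gsign C S (T `|` U)%fset =
  a * b * gsign C S T * c * gsign C (S `|` T)%fset U by [].
have -> : a * (b * c * gsign C T U) * gsign C S (T `|` U)%fset =
  a * b * c * (gsign C T U * gsign C S (T `|` U)%fset) by ring.
by rewrite -gsignA; ring.
Qed.

Lemma gmulAU (a : C) S y z :
  gmul << a *g S >> (gmul y z) = gmul (gmul << a *g S >> y) z.
Proof.
elim/grassmann_ind: y => [|b T y IHy]; first by rewrite gmul0x gmulx0 gmul0x.
rewrite (gmulDl _ y z) (gmulDr _ _ (gmul y z)) (gmulDr _ _ y).
by rewrite (gmulDl _ (gmul _ y) z) IHy gmulAUU.
Qed.

Lemma gmulA : associative (@gmul C).
Proof.
move=> x y z; elim/grassmann_ind: x => [|a S x IHx]; first by rewrite !gmul0x.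
rewrite (gmulDl _ x (gmul y z)) (gmulDl _ x y) (gmulDl _ (gmul x y) z) IHx.
by rewrite gmulAU.
Qed.

Lemma gmul1x : left_id (gone C) (@gmul C).
Proof.
move=> x; rewrite {1}[x]monalgE gmul_sumr [RHS]monalgE.
apply: eq_bigr => S _.
by rewrite gmulUU gsign0S mul1r mulr1 fset0U.
Qed.

Lemma gmulx1 : right_id (gone C) (@gmul C).
Proof.
move=> x; rewrite {1}[x]monalgE gmul_suml [RHS]monalgE.
apply: eq_bigr => S _.
by rewrite gmulUU gsignS0 !mulr1 fsetU0.
Qed.

Lemma gone_neq0 : gone C != 0.
Proof. by rewrite monalgU_eq0 oner_eq0. Qed.

HB.instance Definition _ := GRing.Zmodule_isNzRing.Build (grassmann C)
  gmulA gmul1x gmulx1 gmulDl gmulDr gone_neq0.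

Lemma grassmannUU (a b : C) S T :
  (<< a *g S >> : grassmann C) * (<< b *g T >> : grassmann C) =
  << a * b * gsign C S T *g (S `|` T)%fset >>.
Proof. exact: gmulUU. Qed.

Lemma gscaleUE (c a : C) S : c *: (<< a *g S >> : grassmann C) = << c * a *g S >>.
Proof. by apply/malgP => T; rewrite mcoeffZ !mcoeffU mulrnAr. Qed.

Lemma gscaleAl (c : C) x y : c *: (x * y) = (c *: x) * y.
Proof.
elim/grassmann_ind: x => [|a S x IHx]; first by rewrite mul0r scaler0 mul0r.
rewrite mulrDl !scalerDr mulrDl IHx; congr (_ + _).
elim/grassmann_ind: y {IHx} => [|b T y IHy]; first by rewrite !mulr0 scaler0.
rewrite !mulrDr scalerDr IHy; congr (_ + _).
by rewrite gscaleUE !grassmannUU gscaleUE !mulrA.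
Qed.

Lemma gscaleAr (c : C) x y : c *: (x * y) = x * (c *: y).
Proof.
elim/grassmann_ind: x => [|a S x IHx]; first by rewrite !mul0r scaler0.
rewrite !mulrDl scalerDr IHx; congr (_ + _).
elim/grassmann_ind: y {IHx} => [|b T y IHy]; first by rewrite mulr0 scaler0 mulr0.
rewrite mulrDr !scalerDr mulrDr IHy; congr (_ + _).
by rewrite gscaleUE !grassmannUU gscaleUE !mulrA (mulrC c).
Qed.

HB.instance Definition _ := GRing.Lmodule_isLalgebra.Build C (grassmann C) gscaleAl.
HB.instance Definition _ := GRing.Lalgebra_isAlgebra.Build C (grassmann C) gscaleAr.

End GrassmannRing.

(* gtwist b x = (-1)^([x] b) x, extended additively to non-homogeneous x *)
Definition gtwist (C : fieldType) (b : bool) (x : grassmann C) : grassmann C :=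
  if b then \sum_(S <- msupp x) << (-1) ^+ #|` S| * x@_S *g S >> else x.

Definition ghomog (C : fieldType) (p : bool) (x : grassmann C) : Prop :=
  forall S, S \in msupp x -> odd #|` S| = p.

(* A right Lambda-module with a finite homogeneous basis (e_i)_(i : X), where
   e_i has parity par i; x : fsm C X stands for \sum_i e_i x_i. *)
Definition fsm (C : fieldType) (X : finType) : Type := {ffun X -> grassmann C}.

HB.instance Definition _ (C : fieldType) (X : finType) :=
  GRing.Zmodule.copy (fsm C X) {ffun X -> grassmann C}.

Section FreeSuperModule.
Context (C : fieldType) (X : finType) (par : X -> bool).

Definition ebasis (i : X) : fsm C X := [ffun j => (j == i)%:R].

Definition ract (x : fsm C X) (l : grassmann C) : fsm C X := [ffun i => x i * l].

(* l e_i = (-1)^([l][e_i]) e_i l *)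
Definition lact (l : grassmann C) (x : fsm C X) : fsm C X :=
  [ffun i => gtwist (par i) l * x i].

Definition homog (p : bool) (x : fsm C X) : Prop :=
  forall i, ghomog (p (+) par i) (x i).

(* Endomorphisms act on the left, so Lambda-linearity is on the right; for even
   endomorphisms it is equivalent to linearity for lact. *)
Definition Lambda_linear (phi : fsm C X -> fsm C X) : Prop :=
  (forall x y, phi (x + y) = phi x + phi y) /\
  (forall x l, phi (ract x l) = ract (phi x) l).

Definition even_endo (phi : fsm C X -> fsm C X) : Prop :=
  Lambda_linear phi /\ (forall p x, homog p x -> homog p (phi x)).

Definition in_GL (g : fsm C X -> fsm C X) : Prop :=
  even_endo g /\ exists2 h, even_endo h & cancel g h /\ cancel h g.

End FreeSuperModule.

Record osp_space (C : fieldType) := OspSpace {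
  osp_sort :> vectType C;
  osp_grade : bool -> {vspace osp_sort};
  osp_form : osp_sort -> osp_sort -> C;
  osp_capv : (osp_grade false :&: osp_grade true = 0)%VS;
  osp_fullv : (osp_grade false + osp_grade true)%VS = fullv;
  osp_linearr : forall u a v w,
    osp_form u (a *: v + w) = a * osp_form u v + osp_form u w;
  osp_linearl : forall u a v w,
    osp_form (a *: v + w) u = a * osp_form v u + osp_form w u;
  osp_even : forall p q u v, p != q ->
    u \in osp_grade p -> v \in osp_grade q -> osp_form u v = 0;
  osp_supersym : forall p q u v,
    u \in osp_grade p -> v \in osp_grade q ->
    osp_form u v = (-1) ^+ (p && q) * osp_form v u;
  osp_nondeg : forall u, (forall v, osp_form u v = 0) -> u = 0
}.

Section OSp.
Context (C : fieldType) (W : osp_space C).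

(* V = W (x)_C Lambda and its tensor powers are written in coordinates with
   respect to the homogeneous basis hbasis of W. *)
Definition hdim : nat := (\dim (osp_grade W false) + \dim (osp_grade W true))%N.

Definition hbasis : hdim.-tuple W :=
  [tuple of vbasis (osp_grade W false) ++ vbasis (osp_grade W true)].

Definition hpar (i : 'I_hdim) : bool := (\dim (osp_grade W false) <= i)%N.

Definition superV : Type := fsm C 'I_hdim.

HB.instance Definition _ := GRing.Zmodule.on superV.

(* w |-> w (x) 1 *)
Definition incl (w : W) : superV := [ffun i => (coord hbasis i w)%:A].

(* the form on V with (l v, v' l') = l (v, v') l' *)
Definition vform (v w : superV) : grassmann C :=
  \sum_i \sum_j osp_form (tnth hbasis i) (tnth hbasis j) *:
                (gtwist (hpar i) (v i) * w j).

Definition in_OSp (g : superV -> superV) : Prop :=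
  in_GL hpar g /\ forall v w, vform (g v) (g w) = vform v w.

Context (d : nat).

(* basis e_f = e_(f 0) (x) ... (x) e_(f (d-1)) *)
Definition tidx : finType := {ffun 'I_d -> 'I_hdim}.

Definition tpar (f : tidx) : bool := odd (\sum_k hpar (f k)).

Definition tpow : Type := fsm C tidx.

HB.instance Definition _ := GRing.Zmodule.on tpow.

(* v_0 (x) ... (x) v_(d-1): the coefficient of v_k on e_(f k) is moved to the
   right past e_(f (k+1)), ..., e_(f (d-1)). *)
Definition tens (v : 'I_d -> superV) : tpow :=
  [ffun f : tidx =>
     \prod_(k < d) gtwist (odd (\sum_(l < d | (k < l)%N) hpar (f l))) (v k (f k))].

Definition tens_map (g : superV -> superV) (x : tpow) : tpow :=
  \sum_(f : tidx) ract (tens (fun k => g (ebasis C (f k)))) (x f).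

Record EndG := MkEndG {
  endG_fun :> tpow -> tpow;
  endG_linear : Lambda_linear endG_fun;
  endG_commute : forall g, in_OSp g ->
    forall x, endG_fun (tens_map g x) = tens_map g (endG_fun x)
}.

Definition tupd2 (v : 'I_d -> superV) (i j : 'I_d) (a b : superV) : 'I_d -> superV :=
  fun k => if k == i then a else if k == j then b else v k.

(* phi applies tau(v (x) w) = (-1)^([v][w]) w (x) v to the factors i, j *)
Definition acts_as_tau (i j : 'I_d) (phi : tpow -> tpow) : Prop :=
  forall (v : 'I_d -> superV) (p : 'I_d -> bool),
    (forall k, homog hpar (p k) (v k)) ->
    phi (tens v) = ract (tens (tupd2 v i j (v j) (v i))) ((-1) ^+ (p i && p j)).

(* phi applies gamma(v (x) w) = (v, w) c_0, c_0 = \sum_a b_a (x) b'_a, to the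
   factors i, j *)
Definition acts_as_gamma (N : nat) (b b' : N.-tuple W) (i j : 'I_d)
    (phi : tpow -> tpow) : Prop :=
  forall v : 'I_d -> superV,
    phi (tens v) =
    \sum_(a < N) tens (tupd2 v i j (lact hpar (vform (v i) (v j)) (incl (tnth b a)))
                                   (incl (tnth b' a))).

Definition dual_bases (N : nat) (b b' : N.-tuple W) : Prop :=
  [/\ basis_of fullv b, basis_of fullv b' &
      forall a c, osp_form (tnth b' a) (tnth b c) = (a == c)%:R].

End OSp.

(* inl i is the i-th bottom point, inr j the j-th top point *)
Notation bpts p q := ('I_p + 'I_q)%type.

(* A perfect matching is encoded by the fixed-point-free involution sending a
   point to its partner. *)
Definition is_matching (P : finType) (f : {ffun P -> P}) : bool :=
  [forall x, (f (f x) == x) && (f x != x)].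

Record diagram (p q : nat) := Diagram {
  mate :> {ffun bpts p q -> bpts p q};
  _ : is_matching mate
}.

HB.instance Definition _ p q := [isSub for @mate p q].
HB.instance Definition _ p q := [Finite of diagram p q by <:].

Lemma matching_ffun (P : finType) (f : P -> P) :
  involutive f -> (forall x, f x != x) -> is_matching [ffun x => f x].
Proof. by move=> fK fx; apply/forallP => x; rewrite !ffunE fK eqxx fx. Qed.

Definition mk_diagram p q (f : bpts p q -> bpts p q)
    (fK : involutive f) (fx : forall x, f x != x) : diagram p q :=
  Diagram (matching_ffun fK fx).

Lemma mate_involutive p q (D : diagram p q) : involutive D.
Proof. by case: D => f /= /forallP fP x; have /andP[/eqP] := fP x. Qed.

Lemma mate_neq p q (D : diagram p q) x : D x != x.
Proof. by case: D => f /= /forallP fP; have /andP[] := fP x. Qed.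

Lemma relabel_involutive (P Q : Type) (h : P -> Q) (k : Q -> P) (f : P -> P) :
  cancel h k -> cancel k h -> involutive f -> involutive (h \o f \o k).
Proof. by move=> hK kK fK x /=; rewrite hK fK kK. Qed.

Lemma relabel_neq (P Q : eqType) (h : P -> Q) (k : Q -> P) (f : P -> P) :
  cancel h k -> cancel k h -> (forall x, f x != x) -> forall y, (h \o f \o k) y != y.
Proof.
move=> hK kK fx y; apply/negP => /eqP /= E; have /negP := fx (k y); apply.
by rewrite -[X in X == _]hK E.
Qed.

Definition relabel p q p' q' (h : bpts p q -> bpts p' q') (k : bpts p' q' -> bpts p q)
    (hK : cancel h k) (kK : cancel k h) (D : diagram p q) : diagram p' q' :=
  mk_diagram (relabel_involutive hK kK (@mate_involutive p q D))
             (relabel_neq hK kK (@mate_neq p q D)).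

Section BrauerModules.
Context (C : fieldType).

(* B_p^q, the free left Lambda-module on the diagrams p -> q *)
Definition brauer (p q : nat) : Type := {ffun diagram p q -> (grassmann C)^o}.

HB.instance Definition _ p q := GRing.Lmodule.on (brauer p q).

Definition dg p q (D : diagram p q) : brauer p q := [ffun D' => (D' == D)%:R].

Definition brauer_lin p q p' q' (f : diagram p q -> diagram p' q')
    (x : brauer p q) : brauer p' q' :=
  \sum_D x D *: dg (f D).

(* Composing D1 : q -> r (above) with D2 : p -> q (below): the points of the
   stacked picture are the p bottom, q middle and r top points. *)
Definition lower_pt p q r (x : bpts p q) : (bpts p q + 'I_r)%type := inl x.

Definition upper_pt p q r (x : bpts q r) : (bpts p q + 'I_r)%type :=
  match x with inl j => inl (inr j) | inr k => inr k end.

Definition outer_pt p q r (x : bpts p r) : (bpts p q + 'I_r)%type :=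
  match x with inl i => inl (inl i) | inr k => inr k end.

Definition stack_edge p q r (D1 : diagram q r) (D2 : diagram p q) :
    rel (bpts p q + 'I_r)%type :=
  fun z z' =>
    [exists x, (lower_pt r x == z) && (lower_pt r (D2 x) == z')] ||
    [exists x, (upper_pt p x == z) && (upper_pt p (D1 x) == z')].

(* D is the diagram obtained from the stacked picture by removing loops *)
Definition is_composite p q r (D1 : diagram q r) (D2 : diagram p q)
    (D : diagram p r) : bool :=
  [forall x : bpts p r,
     connect (stack_edge D1 D2) (outer_pt q x) (outer_pt q (D x))].

(* the number of connected components consisting of middle points *)
Definition nloops p q r (D1 : diagram q r) (D2 : diagram p q) : nat :=
  n_comp (stack_edge D1 D2)
    [pred z | [forall x : bpts p r, ~~ connect (stack_edge D1 D2) z (outer_pt q x)]].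

Definition brauer_mul (delta : C) p q r (x : brauer q r) (y : brauer p q) :
    brauer p r :=
  [ffun D => \sum_D1 \sum_(D2 | is_composite D1 D2 D)
     (delta ^+ nloops D1 D2)%:A * (x D1 * y D2)].

End BrauerModules.

Definition id_mate d (x : bpts d d) : bpts d d :=
  match x with inl a => inr a | inr a => inl a end.

Lemma id_mateK d : involutive (@id_mate d). Proof. by case. Qed.
Lemma id_mate_neq d x : @id_mate d x != x. Proof. by case: x. Qed.

Definition id_diagram d : diagram d d := mk_diagram (@id_mateK d) (@id_mate_neq d).

Definition s_mate d (i j : 'I_d) (x : bpts d d) : bpts d d :=
  match x with inl a => inr (tperm i j a) | inr a => inl (tperm i j a) end.

Lemma s_mateK d i j : involutive (@s_mate d i j).
Proof. by case=> a /=; rewrite tpermK. Qed.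
Lemma s_mate_neq d i j x : @s_mate d i j x != x. Proof. by case: x. Qed.

Definition s_diagram d (i j : 'I_d) : diagram d d :=
  mk_diagram (@s_mateK d i j) (@s_mate_neq d i j).

Definition e_mate d (i j : 'I_d) (x : bpts d d) : bpts d d :=
  match x with
  | inl a => if a \in [:: i; j] then inl (tperm i j a) else inr a
  | inr a => if a \in [:: i; j] then inr (tperm i j a) else inl a
  end.

Lemma e_mateK d i j : involutive (@e_mate d i j).
Proof.
have tm a : (tperm i j a \in [:: i; j]) = (a \in [:: i; j]).
  rewrite !inE; case: tpermP => [-> | -> | //]; by rewrite !eqxx ?orbT.
by case=> a /=; case: ifP => /= aij; rewrite ?tm aij ?tpermK.
Qed.

Lemma e_mate_neq d (i j : 'I_d) : i != j -> forall x, e_mate i j x != x.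
Proof.
move=> ij [] a /=; case: ifP => //; rewrite !inE => /orP[] /eqP -> ;
  rewrite ?tpermL ?tpermR; apply/eqP => -[] E; by rewrite -?E ?eqxx // ?E ?eqxx in ij.
Qed.

Definition e_diagram d (i j : 'I_d) (ij : i != j) : diagram d d :=
  mk_diagram (@e_mateK d i j) (e_mate_neq ij).

Lemma ord_succ_neq d (i j : 'I_d) : j = i.+1 :> nat -> i != j.
Proof. by move=> E; apply/eqP => /(congr1 val) /=; rewrite E => /eqP; rewrite -[X in X == _]addn0 -addn1 eqn_add2l. Qed.

Definition bend p q (x : bpts p.+1 q) : bpts p q.+1 :=
  match x with
  | inl i => if unlift ord0 i is Some i' then inl i' else inr ord0
  | inr j => inr (lift ord0 j)
  end.

Definition unbend p q (x : bpts p q.+1) : bpts p.+1 q :=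
  match x with
  | inl i => inl (lift ord0 i)
  | inr j => if unlift ord0 j is Some j' then inr j' else inl ord0
  end.

Lemma bendK p q : cancel (@bend p q) (@unbend p q).
Proof.
case=> a /=; last by rewrite liftK.
by case: unliftP => [b ->|->] //=; rewrite unlift_none.
Qed.

Lemma unbendK p q : cancel (@unbend p q) (@bend p q).
Proof.
case=> a /=; first by rewrite liftK.
by case: unliftP => [b ->|->] //=; rewrite unlift_none.
Qed.

Section BrauerAction.
Context (C : fieldType).

Definition U p q : brauer C p.+1 q -> brauer C p q.+1 :=
  brauer_lin (relabel (@bendK p q) (@unbendK p q)).

Definition cast_top p q q' (e : q = q') (x : brauer C p q) : brauer C p q' :=
  eq_rect q (brauer C p) x q' e.

Fixpoint Uiter k p q : brauer C (k + p) q -> brauer C p (k + q) :=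
  match k with
  | 0 => id
  | k'.+1 => fun x => cast_top (addnS k' q) (@Uiter k' p q.+1 (@U (k' + p) q x))
  end.

(* 2d is written d + d *)
Definition Ud d (x : brauer C (d + d) 0) : brauer C d d :=
  cast_top (addn0 d) (@Uiter d d 0 x).

End BrauerAction.

(* D_0 pairs the points 2i and 2i+1 (counting from 0). *)
Definition D0_nat (k : nat) : nat := if odd k then k.-1 else k.+1.

Lemma D0_nat_lt d (k : 'I_(d + d)) : (D0_nat k < d + d)%N.
Proof.
case: k => k /= kd; rewrite /D0_nat; case: (boolP (odd k)) => ok.
  exact: leq_ltn_trans (leq_pred k) kd.
rewrite ltn_neqAle kd andbT; apply/eqP => /(congr1 odd).
by rewrite /= (negbTE ok) oddD addbb.
Qed.

Lemma D0_natK : involutive D0_nat.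
Proof.
by case=> [|k] //; rewrite /D0_nat /=; case: (boolP (odd k)) => /= ok;
  rewrite ?ok ?(negbTE ok).
Qed.

Lemma D0_nat_neq k : D0_nat k != k.
Proof. by case: k => // k; rewrite /D0_nat; case: ifP => _ /=; rewrite neq_ltn leqnn ?orbT. Qed.

Definition D0_mate d (x : bpts (d + d) 0) : bpts (d + d) 0 :=
  match x with inl k => inl (Ordinal (D0_nat_lt k)) | inr k => inr k end.

Lemma D0_mateK d : involutive (@D0_mate d).
Proof. by case=> [k|[]//]; congr inl; apply: val_inj; apply: D0_natK. Qed.

Lemma D0_mate_neq d x : @D0_mate d x != x.
Proof.
case: x => [k|[]//]; apply/eqP => -[] /(congr1 val) /= /eqP.
by rewrite (negbTE (D0_nat_neq k)).
Qed.

Definition D0 d : diagram (d + d) 0 := mk_diagram (@D0_mateK d) (@D0_mate_neq d).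

Definition bperm N q (s : 'S_N) (x : bpts N q) : bpts N q :=
  match x with inl i => inl (s i) | inr j => inr j end.

Lemma bpermK N q (s : 'S_N) : cancel (@bperm N q s) (@bperm N q s^-1).
Proof. by case=> //= a; rewrite permK. Qed.

Lemma bpermVK N q (s : 'S_N) : cancel (@bperm N q s^-1) (@bperm N q s).
Proof. by case=> //= a; rewrite permKV. Qed.

(* D s has the pairs {s^-1 a, s^-1 b} for {a, b} a pair of D. *)
Definition diag_perm N q (D : diagram N q) (s : 'S_N) : diagram N q :=
  relabel (@bpermVK N q s) (@bpermK N q s) D.

Definition CSym (C : fieldType) (N : nat) : Type := {ffun 'S_N -> C^o}.
HB.instance Definition _ (C : fieldType) N := Vector.on (CSym C N).

Definition LSym (C : fieldType) (N : nat) : Type := {ffun 'S_N -> (grassmann C)^o}.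
HB.instance Definition _ (C : fieldType) N := GRing.Lmodule.on (LSym C N).

Definition diag_act (C : fieldType) N q (D : diagram N q) (x : LSym C N) :
    brauer C N q :=
  \sum_(s : 'S_N) x s *: dg C (diag_perm D s).

Definition is_partition (N : nat) (mu : seq nat) : bool :=
  [&& sorted geq mu, 0%N \notin mu & sumn mu == N].

(* The boxes of the Young diagram of mu are numbered row by row from 0:
   box k lies in row reshape_index mu k and column reshape_offset mu k. *)
Definition row_stab N (mu : seq nat) (s : 'S_N) : bool :=
  [forall k : 'I_N, reshape_index mu (s k) == reshape_index mu k].

Definition col_stab N (mu : seq nat) (s : 'S_N) : bool :=
  [forall k : 'I_N, reshape_offset mu (s k) == reshape_offset mu k].

(* the product of the row symmetrizer and the column antisymmetrizer of the
   tableau above *)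
Definition young_symmetrizer (C : fieldType) N (mu : seq nat) : CSym C N :=
  [ffun s => \sum_(a : 'S_N | row_stab mu a)
             \sum_(b : 'S_N | col_stab mu b && ((a * b)%g == s)) (-1) ^+ b].

(* g x h in the group algebra *)
Definition translate (C : fieldType) N (g h : 'S_N) (x : CSym C N) : CSym C N :=
  [ffun s => x (g^-1 * s * h^-1)%g].

(* The simple two-sided ideal of C Sym_N attached to mu is generated by a Young
   symmetrizer; for mu = (N) this is the sum of all permutations, which spans the
   trivial representation.  The ideal does not depend on the choice of tableau,
   nor on the order in which permutations are composed. *)
Definition young_ideal (C : fieldType) N (mu : seq nat) : {vspace CSym C N} :=
  <<[seq translate g h (young_symmetrizer C N mu) | g <- enum 'S_N, h <- enum 'S_N]>>%VS.

(* l (x) y *)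
Definition ltensor (C : fieldType) N (l : grassmann C) (y : CSym C N) : LSym C N :=
  [ffun s => (y s : C) *: l].

(* I(mu) = Lambda (x)_C young_ideal mu, inside Lambda Sym_N *)
Definition in_Imu (C : fieldType) N (mu : seq nat) (x : LSym C N) : Prop :=
  exists2 r : seq (grassmann C * CSym C N),
    (forall t, t \in r -> t.2 \in young_ideal C N mu) &
    x = \sum_(t <- r) ltensor t.1 t.2.

(* the Young diagram of mu contains a rectangle with a rows and b columns *)
Definition contains_rect (a b : nat) (mu : seq nat) : Prop :=
  forall i, (i < a)%N -> (b <= nth 0 mu i)%N.

(* I(m, n), the sum of the ideals I(mu) *)
Definition in_I (C : fieldType) (m n N : nat) (x : LSym C N) : Prop :=
  exists2 r : seq (seq nat * LSym C N),
    (forall t, t \in r ->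
       [/\ is_partition N t.1, contains_rect m.+1 (2 * n).+1 t.1 & in_Imu t.1 t.2]) &
    x = \sum_(t <- r) t.2.

(* eta is the homomorphism of Lambda-algebras B_d(delta) -> End_G(T^d(V)) with
   the prescribed values on the generators s_i and e_i. *)
Record is_eta (C : fieldType) (W : osp_space C) (d N : nat) (delta : C)
    (b b' : N.-tuple W) (eta : brauer C d d -> EndG W d) : Prop := {
  eta_add : forall x y t, eta (x + y) t = eta x t + eta y t;
  eta_scale : forall l x t, eta (l *: x) t = lact (@tpar C W d) l (eta x t);
  eta_one : forall t, eta (dg C (id_diagram d)) t = t;
  eta_mul : forall x y t, eta (brauer_mul delta x y) t = eta x (eta y t);
  eta_s : forall i j : 'I_d, j = i.+1 :> nat ->
    acts_as_tau i j (eta (dg C (s_diagram i j)));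
  eta_e : forall (i j : 'I_d) (ij : j = i.+1 :> nat),
    acts_as_gamma b b' i j (eta (dg C (e_diagram (ord_succ_neq ij))))
}.

(* Main.v *)
Require Import Defs.
From HB Require Import structures.
From mathcomp Require Import all_boot all_order all_algebra all_fingroup.
From mathcomp Require Import finmap monalg.
From mathcomp Require Import reals complex.
From mathcomp Require Import zify ring.

(* Comparing the coefficients of the monomials of Lambda reduces the statement
   to complex coefficients.  Lowering the indices of eta(D) with the form turns
   it into the multilinear form on T^(2d)(V) that contracts the pairs of the
   diagram 2d -> 0 from which D is bent; these forms are permuted, with signs,
   by Sym_(2d).  So the kernel of eta is U^d(D0 y), with y ranging over the
   elements killing the form of D0.

   Averaging over the stabilizer of D0, one may take y = y h for every h in that
   stabilizer.  Such a y kills every form on T^(2d)(V): applying gl(V) in the odd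
   slots, together with the symmetry of y, produces all forms from that of D0.

   Finally, y kills all forms exactly if it lies in the sum of the ideals of the
   partitions containing the (m+1) x (2n+1) rectangle (the hook theorem).  For
   such a partition, a tensor that is symmetric along rows and alternating along
   columns is shown to vanish by an exchange argument on fillings of the diagram;
   for the others an explicit filling gives a form not killed by the Young
   symmetrizer.  The Young symmetrizers generate the whole group algebra, since
   their class functions are orthogonal and as many as the cycle types. *)

Set Implicit Arguments.
Unset Strict Implicit.
Unset Printing Implicit Defensive.

Import Order.TTheory GRing.Theory Num.Theory.
Local Open Scope ring_scope.

(** * Signs of permutations of parity-graded letters *)

(** As an operator, a diagram has inputs and outputs that are permuted separately. Once the outputs
    are lowered, all 2d points lie on one line, and a single signed action of Sym_(2d) governs every
    diagram. The tops are read from right to left and then the bottoms from left to right: bending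
    leaves these positions unchanged, and the sign of a matching is the parity of the crossings
    between its odd arcs. The delicate point is to pass from one form to all forms. A matrix unit
    summed over all slots commutes with y, but it is needed in a single slot. Invariance of y under
    the stabilizer of D0 makes the slots of the untouched pairs equivalent, and characteristic zero
    allows division by their number. The inverse Gram matrix then trades the contraction of one pair
    for an arbitrary dependence on its two letters. The size of the rectangle comes from two counts:
    a column holds at most m even letters, which must be distinct, and levels among 2n odd ranks
    cannot increase strictly along 2n+1 columns. *)

Section InversionParity.
Variable N : nat.
Implicit Types (g h : 'S_N) (p q : 'I_N -> bool).

(** The exclusive or makes the condition symmetric in [i] and [j] and additive along products, so
    that sums over pairs can be reindexed by any permutation. *)
Definition swaps g (i j : 'I_N) : bool := (i < j)%N (+) (g i < g j)%N.

(* Parity of the number of inversions of g between odd positions of p *)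
Definition inv_par g p : bool :=
  \big[addb/false]_(ij : 'I_N * 'I_N | (ij.1 < ij.2)%N)
    (swaps g ij.1 ij.2 && (p ij.1 && p ij.2)).

Lemma swapsM g h i j : swaps (g * h)%g i j = swaps g i j (+) swaps h (g i) (g j).
Proof. by rewrite /swaps !permM addbA addbK. Qed.

Lemma swapsC g i j : swaps g i j = swaps g j i.
Proof.
rewrite /swaps; case: (eqVneq i j) => [->//|nij].
have: (i : nat) != j by [].
have: (g i : nat) != g j by apply: contraNneq nij => /val_inj /perm_inj ->.
lia.
Qed.

Lemma swapsxx g i : swaps g i i = false.
Proof. by rewrite /swaps !ltnn. Qed.

(** Both sums choose one ordering of each two-element subset, and a symmetric summand does not see
    which. *)
Lemma xor_pairs_order (psi : 'I_N -> 'I_N -> bool) g :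
  (forall i j, psi i j = psi j i) ->
  \big[addb/false]_(ij : 'I_N * 'I_N | (g ij.1 < g ij.2)%N) psi ij.1 ij.2 =
  \big[addb/false]_(ij : 'I_N * 'I_N | (ij.1 < ij.2)%N) psi ij.1 ij.2.
Proof.
move=> psiC.
rewrite (bigID (fun ij : 'I_N * 'I_N => (ij.1 < ij.2)%N)) /=.
rewrite [RHS](bigID (fun ij : 'I_N * 'I_N => (g ij.1 < g ij.2)%N)) /=; congr (_ (+) _).
  by apply: eq_bigl => ij; rewrite andbC.
rewrite (reindex_inj (h := fun ij : 'I_N * 'I_N => (ij.2, ij.1))) /=; last first.
  by move=> [a b] [c e] /= [-> ->].
apply: eq_big => [[i j]|[i j] _] /=; last exact: psiC.
have : ((g i : nat) == g j) = ((i : nat) == j).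
  exact: (inj_eq (inj_comp val_inj (@perm_inj _ g))).
lia.
Qed.

Lemma xor_pairs_perm (psi : 'I_N -> 'I_N -> bool) g :
  (forall i j, psi i j = psi j i) ->
  \big[addb/false]_(ij : 'I_N * 'I_N | (ij.1 < ij.2)%N) psi (g ij.1) (g ij.2) =
  \big[addb/false]_(ij : 'I_N * 'I_N | (ij.1 < ij.2)%N) psi ij.1 ij.2.
Proof.
move=> psiC; rewrite -(xor_pairs_order g^-1 psiC).
rewrite [RHS](reindex_inj (h := fun ij : 'I_N * 'I_N => (g ij.1, g ij.2))) /=.
  by apply: eq_bigl => ij; rewrite !permK.
by move=> [a b] [c e] /= [] /perm_inj -> /perm_inj ->.
Qed.

(** [swaps] is additive along a product, and the second summand is transported by [g]. This cocycle
    identity is what makes signed permutation of words an action. *)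
Lemma inv_parM g h p : inv_par (g * h)%g p = inv_par g p (+) inv_par h (p \o g^-1%g).
Proof.
rewrite /inv_par -(xor_pairs_perm g (psi := fun i j =>
  swaps h i j && ((p \o g^-1%g) i && (p \o g^-1%g) j))); last first.
  by move=> i j; rewrite swapsC [X in _ && X]andbC.
rewrite -big_split /=; apply: eq_bigr => ij _.
by rewrite swapsM !permK; case: (p _); case: (p _); rewrite ?andbT ?andbF.
Qed.

Lemma eq_inv_par g p q : p =1 q -> inv_par g p = inv_par g q.
Proof. by move=> pq; apply: eq_bigr => ij _; rewrite !pq. Qed.

Lemma inv_par1 p : inv_par 1%g p = false.
Proof. by rewrite /inv_par big1 // => ij _; rewrite /swaps !perm1 addbb. Qed.

Lemma inv_par_fix g p : (forall i, p i -> g i = i) -> inv_par g p = false.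
Proof.
move=> gp; rewrite /inv_par big1 // => ij _.
case: (boolP (p ij.1)) => [p1|]; last by rewrite andbF.
case: (boolP (p ij.2)) => [p2|]; last by rewrite !andbF.
by rewrite /swaps !gp ?addbb.
Qed.

Lemma addb_big_pair (psi : 'I_N -> 'I_N -> bool) :
  (forall i, psi i i = false) ->
  \big[addb/false]_(ij : 'I_N * 'I_N | (ij.1 < ij.2)%N) (psi ij.1 ij.2 (+) psi ij.2 ij.1) =
  \big[addb/false]_(ij : 'I_N * 'I_N) psi ij.1 ij.2.
Proof.
move=> psi0; rewrite big_split /=.
rewrite [X in _ (+) X](reindex_inj (h := fun ij : 'I_N * 'I_N => (ij.2, ij.1))) /=;
  last by move=> [a b] [c e] /= [-> ->].
rewrite [RHS](bigID (fun ij : 'I_N * 'I_N => (ij.1 < ij.2)%N)) /=; congr (_ (+) _).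
rewrite big_mkcond [RHS]big_mkcond; apply: eq_bigr => -[i j] _ /=.
by case: ltngtP => // /val_inj ->; rewrite psi0.
Qed.

(** For fixed [g], [inv_par g] is a quadratic form over the field with two elements in the parity
    vector; the last sum is its polarization. *)
Lemma inv_parD g p q :
  inv_par g (fun i => p i (+) q i) =
  inv_par g p (+) inv_par g q (+)
  \big[addb/false]_(ij : 'I_N * 'I_N) (swaps g ij.1 ij.2 && (p ij.1 && q ij.2)).
Proof.
rewrite -(addb_big_pair (psi := fun i j => swaps g i j && (p i && q j))); last first.
  by move=> i; rewrite swapsxx.
rewrite /inv_par -!big_split /=; apply: eq_bigr => -[i j] _ /=.
by rewrite (swapsC g j i); case: (swaps _ _ _); case: (p i); case: (p j);
  case: (q i); case: (q j).
Qed.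

Lemma big_addb_pred1 (I : finType) (i : I) (F : I -> bool) :
  \big[addb/false]_(j : I) ((j == i) && F j) = F i.
Proof.
rewrite (bigD1 i) //= eqxx big1 ?addbF // => j /negbTE ->; by [].
Qed.

Lemma inv_par_flip g p (i : 'I_N) (b : bool) :
  inv_par g (fun j => p j (+) (b && (j == i))) =
  inv_par g p (+) (b && \big[addb/false]_(l : 'I_N) (swaps g l i && p l)).
Proof.
case: b; last by rewrite addbF; apply: eq_inv_par => j; rewrite addbF.
rewrite inv_parD (_ : inv_par g (fun j => true && _) = false) ?addbF; last first.
  rewrite /inv_par big1 // => -[a c] /= ac.
  by apply: contraTF ac => /andP[_ /andP[/eqP -> /eqP ->]]; rewrite ltnn.
congr (_ (+) _); rewrite -(pair_bigA _ (fun a c => swaps g a c && (p a && (c == i)))) /=.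
apply: eq_bigr => l _.
under eq_bigr => c _ do rewrite andbA andbC.
by rewrite big_addb_pred1.
Qed.

(** A letter between the two positions is passed once by each of two letters of equal parity, so
    only the exchange of these two letters counts. *)
Lemma inv_par_tperm i j p : p i = p j -> i != j -> inv_par (tperm i j) p = p i.
Proof.
move=> pij nij; pose q k := p k && (k != i) && (k != j).
have swt l : l != i -> l != j -> swaps (tperm i j) l i = swaps (tperm i j) l j.
  by move=> li lj; rewrite /swaps tpermL tpermR tpermD 1?eq_sym // addbC.
rewrite (eq_inv_par _ (q := fun k => (q k (+) (p i && (k == i))) (+) (p i && (k == j)))).
  rewrite !inv_par_flip inv_par_fix => [|k]; last first.
    by rewrite /q => /andP[/andP[_ ki] kj]; rewrite tpermD // eq_sym.
  case: (p i) => //=.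
  have -> : \big[addb/false]_l (swaps (tperm i j) l j && (q l (+) (l == i))) =
     (\big[addb/false]_l (swaps (tperm i j) l j && q l)) (+) swaps (tperm i j) i j.
    rewrite -(big_addb_pred1 i (fun l => swaps (tperm i j) l j)) -big_split /=.
    by apply: eq_bigr => l _; case: (l == i); case: (q l); case: (swaps _ _ _).
  have -> : \big[addb/false]_l (swaps (tperm i j) l i && q l) =
            \big[addb/false]_l (swaps (tperm i j) l j && q l).
    apply: eq_bigr => l _; rewrite /q.
    case: eqP => [->|/eqP li]; first by rewrite !andbF.
    case: eqP => [->|/eqP lj]; first by rewrite !andbF.
    by rewrite swt.
  rewrite addbA addbb /= /swaps tpermL tpermR.
  by move: nij; rewrite -(inj_eq val_inj) /=; case: ltngtP.
move=> k; rewrite /q; case: (eqVneq k i) => [->|ki] /=.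
  by rewrite (negbTE nij) !andbF andbT addbF.
by case: (eqVneq k j) => [->|kj] /=; rewrite ?andbF ?andbT ?addbF ?pij.
Qed.

Lemma val_tperm_adj (i j k : 'I_N) : j = i.+1 :> nat ->
  tperm i j k = (if k == i :> nat then i.+1 else if k == i.+1 :> nat then i : nat else k) :> nat.
Proof.
move=> ij; case: tpermP => [->|->|/eqP ki /eqP kj]; first by rewrite eqxx.
  by rewrite ij eqxx; case: eqP => //; lia.
by move: ki kj; rewrite -!val_eqE /= ij => /negbTE -> /negbTE ->.
Qed.

Lemma inv_par_adj (i j : 'I_N) p : j = i.+1 :> nat ->
  inv_par (tperm i j) p = p i && p j.
Proof.
move=> ij; have nij : i != j by rewrite -(inj_eq val_inj) /= ij neq_ltn ltnSn.
rewrite /inv_par (bigD1 (i, j)) /= ?ij // big1 => [|[a c] /= /andP[ac nac]].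
  by rewrite addbF /swaps tpermL tpermR ij ltnSn ltnNge leqnSn.
suff -> : swaps (tperm i j) a c = false by [].
rewrite /swaps ac; apply/negbTE; rewrite negbK.
rewrite !val_tperm_adj //; move: nac; rewrite xpair_eqE -!val_eqE /= ij.
case: (nat_of_ord a =P i) => ? /=; case: (nat_of_ord c =P i) => ? /=;
  case: (nat_of_ord a =P i.+1) => ? /=; case: (nat_of_ord c =P i.+1) => ? /=; lia.
Qed.

End InversionParity.

(** * The group algebra and its signed action on multilinear forms *)

Section GroupAlgebra.
Variables (C : fieldType) (N : nat).
Implicit Types (x y z : CSym C N) (g h s : 'S_N).

Definition conv x y : CSym C N := [ffun s => \sum_g (x g : C) * y (g^-1 * s)%g].

Definition gbase g : CSym C N := [ffun s => (s == g)%:R].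

Lemma sum_delta (I : finType) (i : I) (F : I -> C) : \sum_j (j == i)%:R * F j = F i.
Proof. by rewrite (bigD1 i) //= eqxx mul1r big1 ?addr0 // => j /negbTE ->; rewrite mul0r. Qed.

Lemma convA : associative conv.
Proof.
move=> x y z; apply/ffunP => s; rewrite !ffunE.
under [RHS]eq_bigr => h _ do rewrite ffunE mulr_suml.
rewrite exchange_big; apply: eq_bigr => g _ /=.
rewrite ffunE mulr_sumr (reindex_inj (mulgI g^-1%g)) /=.
by apply: eq_bigr => h _; rewrite mulrA invMg invgK !mulgA mulgK.
Qed.

Lemma conv1x : left_id (gbase 1) conv.
Proof.
move=> x; apply/ffunP => s; rewrite ffunE.
under eq_bigr => g _ do rewrite ffunE.
by rewrite sum_delta invg1 mul1g.
Qed.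

Lemma convx1 : right_id (gbase 1) conv.
Proof.
move=> x; apply/ffunP => s; rewrite ffunE.
under eq_bigr => g _ do rewrite ffunE mulrC -(inj_eq (mulgI g)) mulKVg mulg1 eq_sym.
by rewrite sum_delta.
Qed.

Lemma convDl : left_distributive conv +%R.
Proof.
move=> x y z; apply/ffunP => s; rewrite !ffunE -big_split.
by apply: eq_bigr => g _; rewrite ffunE mulrDl.
Qed.

Lemma convDr : right_distributive conv +%R.
Proof.
move=> x y z; apply/ffunP => s; rewrite !ffunE -big_split.
by apply: eq_bigr => g _; rewrite ffunE mulrDr.
Qed.

Lemma gbase1_neq0 : gbase 1 != 0.
Proof. by apply/eqP => /ffunP/(_ 1%g)/eqP; rewrite !ffunE eqxx oner_eq0. Qed.

HB.instance Definition _ := GRing.Zmodule_isNzRing.Build (CSym C N)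
  convA conv1x convx1 convDl convDr gbase1_neq0.

Lemma conv_scaleAl (a : C) x y : a *: (x * y) = (a *: x) * y.
Proof.
apply/ffunP => s; rewrite !ffunE scaler_sumr.
by apply: eq_bigr => g _; rewrite !ffunE scalerAl.
Qed.

Lemma conv_scaleAr (a : C) x y : a *: (x * y) = x * (a *: y).
Proof.
apply/ffunP => s; rewrite !ffunE scaler_sumr.
by apply: eq_bigr => g _; rewrite !ffunE scalerAr.
Qed.

HB.instance Definition _ := GRing.Lmodule_isLalgebra.Build C (CSym C N) conv_scaleAl.
HB.instance Definition _ := GRing.Lalgebra_isAlgebra.Build C (CSym C N) conv_scaleAr.

Lemma CSymME x y s : (x * y) s = \sum_g (x g : C) * y (g^-1 * s)%g.
Proof. by rewrite ffunE. Qed.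

Lemma gbaseE g s : gbase g s = (s == g)%:R. Proof. by rewrite ffunE. Qed.

Lemma gbase1 : gbase 1 = 1. Proof. by []. Qed.

Lemma gbaseMl g x s : (gbase g * x) s = x (g^-1 * s)%g.
Proof.
rewrite CSymME; under eq_bigr => h _ do rewrite gbaseE.
by rewrite sum_delta.
Qed.

Lemma gbaseMr g x s : (x * gbase g) s = x (s * g^-1)%g.
Proof.
rewrite CSymME (bigD1 (s * g^-1)%g) //= gbaseE invMg invgK mulgKV eqxx mulr1 big1 ?addr0 //.
move=> h hs; rewrite gbaseE -(inj_eq (mulgI h)) mulKVg -(inj_eq (mulIg g^-1%g)) mulgK.
by rewrite eq_sym (negbTE hs) mulr0.
Qed.

Lemma gbaseM g h : gbase g * gbase h = gbase (g * h).
Proof. by apply/ffunP => s; rewrite gbaseMl !gbaseE -(inj_eq (mulgI g)) mulKVg. Qed.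

Lemma CSym_sum x : x = \sum_g (x g : C) *: gbase g.
Proof.
apply/ffunP => s; rewrite sum_ffunE (bigD1 s) //= big1 => [|g gs].
  by rewrite addr0 !ffunE eqxx [_ *: _]mulr1.
by rewrite !ffunE eq_sym (negbTE gs) scaler0.
Qed.

Lemma translateE g h x : translate g h x = gbase g * x * gbase h.
Proof. by apply/ffunP => s; rewrite gbaseMr gbaseMl ffunE mulgA. Qed.

End GroupAlgebra.

(** A transposition at distance [k + 1] is conjugate, by the adjacent one at its left end, to a
    transposition at distance [k]. *)
Lemma perm_adj_ind (N : nat) (P : 'S_N -> Prop) :
  P 1%g ->
  (forall (s : 'S_N) (i j : 'I_N), j = i.+1 :> nat -> P s -> P (tperm i j * s)%g) ->
  forall s, P s.
Proof.
move=> P1 Padj.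
have Pt k (i j : 'I_N) s : j = (i + k)%N :> nat -> P s -> P (tperm i j * s)%g.
  elim: k i j s => [|k IH] i j s ij Ps.
    by rewrite (_ : j = i) ?tperm1 ?mul1g //; apply: val_inj; rewrite /= ij addn0.
  have lt1 : (i.+1 < N)%N by have := ltn_ord j; rewrite ij; lia.
  pose l := Ordinal lt1.
  case: (posnP k) => [k0|k0]; first by apply: (Padj) => //; rewrite ij k0 addn1.
  have -> : tperm i j = (tperm i l * (tperm l j * tperm i l))%g.
    rewrite -{1}(tpermV i l) -/(conjg _ _) tpermJ tpermR.
    by rewrite tpermD // -val_eqE /= ?ij; lia.
  rewrite -!mulgA; apply: (Padj) => //; apply: (IH); first by rewrite /= ij; lia.
  exact: (Padj).
have Pt' (i j : 'I_N) s : P s -> P (tperm i j * s)%g.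
  case: (leqP i j) => [ij|/ltnW ij]; last rewrite tpermC.
    by apply: (Pt (j - i)%N); rewrite subnKC.
  by apply: (Pt (i - j)%N); rewrite subnKC.
move=> s; case: (prod_tpermP s) => ts -> _.
by elim: ts => [|[i j] ts IH]; rewrite ?big_nil // big_cons; apply: Pt'.
Qed.

Section SignedAction.
Variables (C : fieldType) (N : nat) (X : finType) (par : X -> bool).

(** A multilinear form on the [N]-th tensor power, stored by its values on basis tensors; a word in
    the letters [X] names a basis tensor. *)
Definition form : Type := {ffun {ffun 'I_N -> X} -> C^o}.
HB.instance Definition _ := GRing.Lmodule.on form.

Implicit Types (F : form) (g h : 'S_N) (f : {ffun 'I_N -> X}) (x y : CSym C N).

Definition fcomp f g : {ffun 'I_N -> X} := [ffun i => f (g i)].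

(** The sign rule for permuting graded letters: each exchange of two odd letters costs a sign. *)
Definition psign g f : C := (-1) ^+ inv_par g (par \o f).

Definition pact g F : form := [ffun f => psign g f * F (fcomp f g^-1)].

Definition act x F : form := \sum_g (x g : C) *: pact g F.

Lemma fcomp1 f : fcomp f 1 = f.
Proof. by apply/ffunP => i; rewrite ffunE perm1. Qed.

Lemma fcompM f g h : fcomp (fcomp f h) g = fcomp f (g * h).
Proof. by apply/ffunP => i; rewrite !ffunE permM. Qed.

Lemma fcompK f g : fcomp (fcomp f g) g^-1 = f.
Proof. by rewrite fcompM mulVg fcomp1. Qed.

Lemma fcompKV f g : fcomp (fcomp f g^-1) g = f.
Proof. by rewrite fcompM mulgV fcomp1. Qed.

Lemma psignM g h f : psign (g * h) f = psign g f * psign h (fcomp f g^-1).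
Proof.
rewrite /psign inv_parM signr_addb; congr (_ * _ ^+ _); congr nat_of_bool.
by apply: eq_inv_par => i; rewrite /= ffunE.
Qed.

Lemma pactM g h F : pact (g * h) F = pact g (pact h F).
Proof.
by apply/ffunP => f; rewrite !ffunE psignM fcompM invMg mulrA.
Qed.

Lemma pact1 F : pact 1 F = F.
Proof. by apply/ffunP => f; rewrite !ffunE /psign inv_par1 mul1r invg1 fcomp1. Qed.

Lemma pactD g F F' : pact g (F + F') = pact g F + pact g F'.
Proof. by apply/ffunP => f; rewrite !ffunE mulrDr. Qed.

Lemma pactZ g (a : C) F : pact g (a *: F) = a *: pact g F.
Proof. by apply/ffunP => f; rewrite !ffunE; exact: mulrCA. Qed.

Lemma pact0 g : pact g 0 = 0.
Proof. by apply/ffunP => f; rewrite !ffunE mulr0. Qed.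

Lemma pact_sum g (I : Type) (r : seq I) (P : pred I) (F : I -> form) :
  pact g (\sum_(i <- r | P i) F i) = \sum_(i <- r | P i) pact g (F i).
Proof. exact: (big_morph _ (pactD g) (pact0 g)). Qed.

Lemma actDr x F F' : act x (F + F') = act x F + act x F'.
Proof. by rewrite -big_split; apply: eq_bigr => g _; rewrite pactD scalerDr. Qed.

Lemma act0r x : act x 0 = 0.
Proof. by rewrite /act big1 // => g _; rewrite pact0 scaler0. Qed.

Lemma actZr x (a : C) F : act x (a *: F) = a *: act x F.
Proof.
by rewrite scaler_sumr; apply: eq_bigr => g _; rewrite pactZ !scalerA mulrC.
Qed.

Lemma act_sumr x (I : Type) (r : seq I) (P : pred I) (F : I -> form) :
  act x (\sum_(i <- r | P i) F i) = \sum_(i <- r | P i) act x (F i).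
Proof. exact: (big_morph _ (actDr x) (act0r x)). Qed.

Lemma actDl x y F : act (x + y) F = act x F + act y F.
Proof. by rewrite -big_split; apply: eq_bigr => g _; rewrite ffunE scalerDl. Qed.

Lemma act0l F : act 0 F = 0.
Proof. by rewrite /act big1 // => g _; rewrite ffunE scale0r. Qed.

Lemma actZl (a : C) x F : act (a *: x) F = a *: act x F.
Proof. by rewrite scaler_sumr; apply: eq_bigr => g _; rewrite ffunE scalerA. Qed.

Lemma act_suml (I : Type) (r : seq I) (P : pred I) (x : I -> CSym C N) F :
  act (\sum_(i <- r | P i) x i) F = \sum_(i <- r | P i) act (x i) F.
Proof. exact: (big_morph (fun x => act x F) (fun x y => actDl x y F) (act0l F)). Qed.

Lemma act_gbase g F : act (gbase C g) F = pact g F.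
Proof.
rewrite /act (bigD1 g) //= gbaseE eqxx scale1r big1 ?addr0 // => h hg.
by rewrite gbaseE (negbTE hg) scale0r.
Qed.

Lemma actM x y F : act (x * y) F = act x (act y F).
Proof.
rewrite {1}[x]CSym_sum {1}[y]CSym_sum mulr_suml act_suml; apply: eq_bigr => g _.
rewrite mulr_sumr act_suml pact_sum scaler_sumr; apply: eq_bigr => h _.
by rewrite -scalerAl -scalerAr gbaseM !actZl act_gbase pactM pactZ.
Qed.

Definition dform f : form := [ffun f' => (f' == f)%:R].

Lemma form_sum F : F = \sum_f (F f : C) *: dform f.
Proof.
apply/ffunP => f; rewrite sum_ffunE (bigD1 f) //= big1 => [|g gs].
  by rewrite addr0 !ffunE eqxx [_ *: _]mulr1.
by rewrite !ffunE eq_sym (negbTE gs) scaler0.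
Qed.

Lemma pact_dform g f : pact g (dform f) = psign g (fcomp f g) *: dform (fcomp f g).
Proof.
apply/ffunP => f'; rewrite !ffunE.
have -> : (fcomp f' g^-1 == f) = (f' == fcomp f g).
  by apply/eqP/eqP => [<-|->]; rewrite ?fcompKV ?fcompK.
by case: eqP => [->|_]; rewrite ?scaler0 ?mulr0.
Qed.

End SignedAction.

(** * Young symmetrizers *)

Lemma eq_opp0 (C : numFieldType) (V : lmodType C) (u : V) : u = - u -> u = 0.
Proof.
move=> /eqP; rewrite -addr_eq0 -mulr2n -scaler_nat scaler_eq0 pnatr_eq0 /=.
by move/eqP.
Qed.

Section SymAltSums.
Variables (C : numFieldType) (N : nat).
Implicit Types (P : pred 'S_N) (x y u v : CSym C N) (g s t : 'S_N).

Definition symsum P : CSym C N := \sum_(s | P s) gbase C s.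
Definition altsum P : CSym C N := \sum_(s | P s) (-1) ^+ s *: gbase C s.

Lemma symsumMl P g : (forall s, P (g * s)%g = P s) -> gbase C g * symsum P = symsum P.
Proof.
move=> Pg; rewrite mulr_sumr [RHS](reindex_inj (mulgI g)) /=.
by apply: eq_big => s; rewrite ?Pg // gbaseM.
Qed.

Lemma symsumMr P g : (forall s, P (s * g)%g = P s) -> symsum P * gbase C g = symsum P.
Proof.
move=> Pg; rewrite mulr_suml [RHS](reindex_inj (mulIg g)) /=.
by apply: eq_big => s; rewrite ?Pg // gbaseM.
Qed.

Lemma altsumMl P g : (forall s, P (g * s)%g = P s) ->
  gbase C g * altsum P = (-1) ^+ g *: altsum P.
Proof.
move=> Pg; rewrite mulr_sumr [altsum P](reindex_inj (mulgI g)) scaler_sumr /=.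
apply: eq_big => s; rewrite ?Pg // => _.
by rewrite -scalerAr gbaseM scalerA odd_permM signr_addb mulrA -signr_addb addbb mul1r.
Qed.

Lemma altsumMr P g : (forall s, P (s * g)%g = P s) ->
  altsum P * gbase C g = (-1) ^+ g *: altsum P.
Proof.
move=> Pg; rewrite mulr_suml [altsum P](reindex_inj (mulIg g)) scaler_sumr /=.
apply: eq_big => s; rewrite ?Pg // => _.
rewrite -scalerAl gbaseM scalerA odd_permM signr_addb mulrCA -signr_addb addbb mulr1.
by [].
Qed.

Lemma absorb_opp0 x y t : x * gbase C t = x -> gbase C t * y = - y -> x * y = 0.
Proof. by move=> xt ty; apply: eq_opp0; rewrite -{1}xt -mulrA ty mulrN. Qed.

Lemma opp_absorb0 x y t : x * gbase C t = - x -> gbase C t * y = y -> x * y = 0.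
Proof. by move=> xt ty; apply: eq_opp0; rewrite -{1}ty mulrA xt mulNr. Qed.

Lemma sandwich_gbase u v x : u * x * v != 0 -> exists g, u * gbase C g * v != 0.
Proof.
move=> nz; apply/existsP; apply: contraNT nz; rewrite negb_exists => /forallP e.
rewrite [x]CSym_sum mulr_sumr mulr_suml big1 // => g _.
by rewrite -scalerAr -scalerAl; have := e g; rewrite negbK => /eqP ->; rewrite scaler0.
Qed.

Lemma gbase_tpermJ (i j : 'I_N) g :
  gbase C (tperm i j) * gbase C g = gbase C g * gbase C (tperm (g i) (g j)).
Proof. by rewrite !gbaseM -tpermJ conjgE !mulgA mulgV mul1g. Qed.

End SymAltSums.

Lemma perm_absE (N : nat) (T : eqType) (r : 'I_N -> T) (g s : 'S_N) :
  [forall k, r (g k) == r k] ->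
  ([forall k, r ((g * s)%g k) == r k] = [forall k, r (s k) == r k]) *
  ([forall k, r ((s * g)%g k) == r k] = [forall k, r (s k) == r k]).
Proof.
move=> /forallP gP; split; apply/forallP/forallP => sP k.
- have := sP (g^-1%g k); rewrite permM permKV => /eqP ->.
  by have := gP (g^-1%g k); rewrite permKV eq_sym.
- by rewrite permM (eqP (sP _)).
- by have := sP k; rewrite permM (eqP (gP _)).
- by rewrite permM (eqP (gP _)).
Qed.

(** * Rows and columns of a tableau *)

Section Tableau.
Variables (N : nat) (mu : seq nat).
Hypothesis muN : sumn mu = N.
Implicit Types (k : 'I_N) (g s : 'S_N).

Definition trow k := reshape_index mu k.
Definition tcol k := reshape_offset mu k.

Lemma tbox_inj k k' : trow k = trow k' -> tcol k = tcol k' -> k = k'.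
Proof.
move=> er ec; apply: val_inj; rewrite /= -(reshape_indexK mu k) -(reshape_indexK mu k').
by congr flatten_index.
Qed.

Lemma tcol_lt k : (tcol k < nth 0%N mu (trow k))%N.
Proof. by apply: reshape_offsetP; rewrite muN ltn_ord. Qed.

Lemma trow_lt k : (trow k < size mu)%N.
Proof. by apply: reshape_indexP; rewrite muN ltn_ord. Qed.

Lemma tbox_ex i j : (j < nth 0%N mu i)%N -> exists k, trow k = i /\ tcol k = j.
Proof.
move=> lt; have ltN : (flatten_index mu i j < N)%N by rewrite -muN flatten_indexP.
by exists (Ordinal ltN); rewrite /trow /tcol /= flatten_indexKl ?flatten_indexKr.
Qed.

Lemma row_stabP s : reflect (forall k, trow (s k) = trow k) (row_stab mu s).
Proof. by apply: (iffP forallP) => sP k; apply/eqP; apply: sP. Qed.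

Lemma col_stabP s : reflect (forall k, tcol (s k) = tcol k) (col_stab mu s).
Proof. by apply: (iffP forallP) => sP k; apply/eqP; apply: sP. Qed.

Lemma row_stabV s : row_stab mu s -> row_stab mu s^-1.
Proof. by move=> /row_stabP sP; apply/row_stabP => k; rewrite -sP permKV. Qed.

Lemma col_stabV s : col_stab mu s -> col_stab mu s^-1.
Proof. by move=> /col_stabP sP; apply/col_stabP => k; rewrite -sP permKV. Qed.

Lemma row_stab_tperm k k' : trow k = trow k' -> row_stab mu (tperm k k').
Proof. by move=> e; apply/row_stabP => l; case: tpermP => [->|->|]. Qed.

Lemma col_stab_tperm k k' : tcol k = tcol k' -> col_stab mu (tperm k k').
Proof. by move=> e; apply/col_stabP => l; case: tpermP => [->|->|]. Qed.

Lemma row_col_stab1 s : row_stab mu s -> col_stab mu s -> s = 1%g.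
Proof.
move=> /row_stabP rs /col_stabP cs; apply/permP => k; rewrite perm1.
by apply: tbox_inj.
Qed.

Lemma card_row_col i c :
  #|[set k | (trow k == i) && (tcol k < c)%N]| = minn (nth 0%N mu i) c.
Proof.
have ltN (j : 'I_(minn (nth 0%N mu i) c)) : (flatten_index mu i j < N)%N.
  by rewrite -muN flatten_indexP // (leq_trans (ltn_ord j)) // geq_minl.
have ltj (j : 'I_(minn (nth 0%N mu i) c)) : (j < nth 0%N mu i)%N.
  by rewrite (leq_trans (ltn_ord j)) // geq_minl.
rewrite -[RHS]card_ord -(card_imset (f := fun j => Ordinal (ltN j))); last first.
  move=> j j' /(congr1 tcol); rewrite /tcol /= !flatten_indexKr //.
  exact: val_inj.
congr #|pred_of_set _|; apply/setP => k; rewrite inE; apply/andP/imsetP => [[/eqP ri ci]|].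
  have lt : (tcol k < minn (nth 0%N mu i) c)%N by rewrite leq_min -ri tcol_lt.
  exists (Ordinal lt) => //; apply: val_inj.
  by rewrite /= -ri /trow /tcol reshape_indexK.
move=> [j _ ->]; rewrite /trow /tcol /= flatten_indexKl // eqxx flatten_indexKr //.
by rewrite (leq_trans (ltn_ord j)) // geq_minr.
Qed.

Lemma card_tcol_lt c :
  #|[set k | (tcol k < c)%N]| = (\sum_(i < size mu) minn (nth 0%N mu i) c)%N.
Proof.
rewrite -sum1_card (partition_big (fun k => Ordinal (trow_lt k)) predT) //=.
apply: eq_bigr => i _; rewrite -card_row_col -sum1_card; apply: eq_bigl => k.
by rewrite !inE andbC.
Qed.

End Tableau.

Lemma card_perm_preim (N : nat) (P : pred 'I_N) (g : 'S_N) :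
  #|[set k | P (g k)]| = #|[set k | P k]|.
Proof.
rewrite -(card_imset _ (@perm_inj _ g)); congr #|pred_of_set _|; apply/setP => k.
apply/imsetP/idP => [[l] + ->|]; rewrite !inE // => Pk.
by exists (g^-1%g k); rewrite ?inE permKV.
Qed.

(* Two fillings whose rows and columns meet at most once are compared in
   dominance order; the counts min(mu_i, c) sum to the first c column lengths. *)
Section RowsMeetColumns.
Variables (N : nat) (mu nu : seq nat) (g : 'S_N).
Hypotheses (muN : sumn mu = N) (nuN : sumn nu = N).
Hypothesis meet : forall k k' : 'I_N,
  trow mu k = trow mu k' -> tcol nu (g k) = tcol nu (g k') -> k = k'.

Lemma card_row_meet i c :
  (#|[set k | (trow mu k == i) && (tcol nu (g k) < c)]| <= minn (nth 0%N mu i) c)%N.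
Proof.
rewrite leq_min; apply/andP; split.
  rewrite -[X in (_ <= X)%N]minnn -(card_row_col muN) subset_leq_card //.
  apply/subsetP => k; rewrite !inE => /andP[/eqP ri _]; rewrite ri eqxx /= -ri.
  exact: tcol_lt.
set S := [set k | _].
have Sc k : k \in S -> (tcol nu (g k) < c)%N by rewrite inE => /andP[].
have Sr k : k \in S -> trow mu k = i by rewrite inE => /andP[/eqP].
case: (posnP c) => [c0|c0].
  by rewrite [X in (_ <= X)%N]c0 leqn0 cards_eq0; apply/eqP/setP => k; rewrite !inE c0 ltn0 andbF.
case: c c0 S Sc Sr => // c _ S Sc Sr.
rewrite -[X in (_ <= X)%N]card_ord -(card_in_imset (f := fun k => inord (tcol nu (g k)) : 'I_c.+1)).
  by rewrite max_card.
move=> k k' kS k'S /(congr1 val) /=; rewrite !inordK ?Sc // => e.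
by apply: meet; rewrite ?Sr.
Qed.

Lemma meet_sum c :
  (#|[set k : 'I_N | (tcol nu k < c)%N]| =
   \sum_(i < size mu) #|[set k | (trow mu k == i) && (tcol nu (g k) < c)%N]|)%N.
Proof.
rewrite -(card_perm_preim _ g) -sum1_card.
rewrite (partition_big (fun k => Ordinal (trow_lt muN k)) predT) //=.
apply: eq_bigr => i _; rewrite -sum1_card; apply: eq_bigl => k.
by rewrite !inE andbC.
Qed.

Lemma meet_dominates c :
  (\sum_(i < size nu) minn (nth 0%N nu i) c <= \sum_(i < size mu) minn (nth 0%N mu i) c)%N.
Proof.
by rewrite -(card_tcol_lt nuN) meet_sum; apply: leq_sum => i _; apply: card_row_meet.
Qed.

End RowsMeetColumns.

(** Comparing [mu] with itself turns all dominance inequalities into equalities. Hence the column of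
    [g k] is no longer than allowed by the row of [k], that is, the two meet in a box. Sending [k]
    to this box is the required row permutation, injective by the hypothesis. *)
Lemma meet_row_col (N : nat) (mu : seq nat) (g : 'S_N) (muN : sumn mu = N) :
  (forall k k' : 'I_N,
    trow mu k = trow mu k' -> tcol mu (g k) = tcol mu (g k') -> k = k') ->
  exists r, [/\ row_stab mu r, col_stab mu (r^-1 * g)%g & g = (r * (r^-1 * g))%g].
Proof.
move=> meet.
have eqm i c : (i < size mu)%N ->
    #|[set k | (trow mu k == i) && (tcol mu (g k) < c)%N]| = minn (nth 0%N mu i) c.
  move=> lti; have := meet_sum mu g muN c; rewrite (card_tcol_lt muN).
  move/esym/eqP; rewrite eqn_leq => /andP[_ le].
  have le1 (j : 'I_(size mu)) : (#|[set k | (trow mu k == j) && (tcol mu (g k) < c)%N]| <=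
    minn (nth 0%N mu j) c)%N by exact: card_row_meet.
  apply/eqP; rewrite eqn_leq (le1 (Ordinal lti)) /=.
  move: le; rewrite (bigD1 (Ordinal lti)) //= [X in (_ <= X)%N](bigD1 (Ordinal lti)) //=.
  have : (\sum_(j < size mu | j != Ordinal lti)
     #|[set k | (trow mu k == j) && (tcol mu (g k) < c)%N]| <=
     \sum_(j < size mu | j != Ordinal lti) minn (nth 0%N mu j) c)%N by apply: leq_sum.
  by move: (\sum_(_ < _ | _) _)%N (\sum_(_ < _ | _) _)%N => u v uv le; rewrite -(leq_add2r u) (leq_trans le) ?leq_add2l.
have box k : (tcol mu (g k) < nth 0%N mu (trow mu k))%N.
  have := eqm (trow mu k) (nth 0%N mu (trow mu k)) (trow_lt muN k).
  rewrite -(card_row_col muN) => e.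
  have sub : [set l | (trow mu l == trow mu k) && (tcol mu (g l) < nth 0%N mu (trow mu k))%N] \subset
     [set l | (trow mu l == trow mu k) && (tcol mu l < nth 0%N mu (trow mu k))%N].
    apply/subsetP => l; rewrite !inE => /andP[/eqP ri _]; rewrite ri eqxx /= -ri.
    exact: tcol_lt.
  have /(_ k) := subset_cardP e sub.
  by rewrite !inE eqxx /= tcol_lt.
have ltN k : (flatten_index mu (trow mu k) (tcol mu (g k)) < N)%N.
  by rewrite -[X in (_ < X)%N]muN flatten_indexP.
pose r0 k : 'I_N := Ordinal (ltN k).
have r0r k : trow mu (r0 k) = trow mu k by rewrite /trow /= flatten_indexKl ?box.
have r0c k : tcol mu (r0 k) = tcol mu (g k) by rewrite /tcol /= flatten_indexKr ?box.
have r0I : injective r0 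
  by move=> k k' e; apply: meet; [rewrite -(r0r k) -(r0r k') e | rewrite -(r0c k) -(r0c k') e].
exists (perm r0I); split; last by rewrite mulgA mulgV mul1g.
  by apply/row_stabP => k; rewrite permE r0r.
apply/col_stabP => k; rewrite permM -r0c.
by rewrite -(permE r0I) permKV.
Qed.

(** Differences of consecutive sums count the parts larger than [c], and these counts determine the
    multiset of positive parts. Zero parts are invisible in the sums but excluded in a partition. *)
Lemma partition_eq (N : nat) (mu nu : seq nat) :
  is_partition N mu -> is_partition N nu ->
  (forall c, \sum_(i < size mu) minn (nth 0%N mu i) c = \sum_(i < size nu) minn (nth 0%N nu i) c)%N ->
  mu = nu.
Proof.
move=> /and3P[smu mu0 _] /and3P[snu nu0 _] e.
have sumE (s : seq nat) c : (\sum_(i < size s) minn (nth 0%N s i) c = \sum_(x <- s) minn x c)%N.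
  by rewrite (big_nth 0) big_mkord.
have cntE (s : seq nat) c :
    (\sum_(x <- s) minn x c.+1 = \sum_(x <- s) minn x c + count (fun x => c < x) s)%N.
  elim: s => [|x s IH]; rewrite ?big_nil // !big_cons IH /=.
  by case: (ltnP c x) => /= ?; lia.
have cnt c : count (fun x => c < x)%N mu = count (fun x => c < x)%N nu.
  by have := e c.+1; have := e c; rewrite !sumE !cntE; lia.
have geq_tr : transitive geq by move=> a b c ba ac; exact: leq_trans ac ba.
have geq_as : antisymmetric geq by move=> a b; rewrite /= andbC -eqn_leq => /eqP.
apply: (sorted_eq geq_tr geq_as) => //; apply/allP => v _ /=; apply/eqP.
case: v => [|v]; first by rewrite (count_memPn mu0) (count_memPn nu0).
have cE (s : seq nat) : (count_mem v.+1 s + count (fun x => v.+1 < x) s = count (fun x => v < x) s)%N.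
  elim: s => //= x s <-; case: (ltngtP x v.+1) => ?; rewrite ?eqxx //=; lia.
by apply/eqP; rewrite -(eqn_add2r (count (fun x => v.+1 < x) mu)%N) cE cnt -cE -cnt.
Qed.

(** * Products of Young symmetrizers *)

Section YoungSymmetrizer.
Variables (C : numFieldType) (N : nat).
Implicit Types (mu nu : seq nat) (x : CSym C N).

Notation rowsym mu := (symsum C (@row_stab N mu)).
Notation colalt mu := (altsum C (@col_stab N mu)).
Notation ysym mu := (young_symmetrizer C N mu).

Lemma ysymE mu : ysym mu = rowsym mu * colalt mu.
Proof.
apply/ffunP => s; rewrite ffunE mulr_suml sum_ffunE; apply: eq_bigr => a _.
rewrite mulr_sumr sum_ffunE big_mkcondr; apply: eq_bigr => b _.
rewrite -scalerAr gbaseM !ffunE eq_sym.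
by case: eqP => _; [rewrite [_ *: _]mulr1 | rewrite scaler0].
Qed.

Lemma rowsymMl mu r : row_stab mu r -> gbase C r * rowsym mu = rowsym mu.
Proof. by move=> rr; apply: symsumMl => s; apply: (perm_absE _ rr).1. Qed.

Lemma rowsymMr mu r : row_stab mu r -> rowsym mu * gbase C r = rowsym mu.
Proof. by move=> rr; apply: symsumMr => s; apply: (perm_absE _ rr).2. Qed.

Lemma colaltMl mu k : col_stab mu k -> gbase C k * colalt mu = (-1) ^+ k *: colalt mu.
Proof. by move=> rr; apply: altsumMl => s; apply: (perm_absE _ rr).1. Qed.

Lemma colaltMr mu k : col_stab mu k -> colalt mu * gbase C k = (-1) ^+ k *: colalt mu.
Proof. by move=> rr; apply: altsumMr => s; apply: (perm_absE _ rr).2. Qed.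

(** The transposition of [k] and [k'] is absorbed by the row sum; moved across [g] it becomes a
    column transposition, which negates the alternating sum. *)
Lemma rowsym_colalt0 mu nu (g : 'S_N) (k k' : 'I_N) : k != k' ->
  trow mu k = trow mu k' -> tcol nu (g k) = tcol nu (g k') ->
  rowsym mu * gbase C g * colalt nu = 0.
Proof.
move=> nk er ec; rewrite -mulrA.
apply: (absorb_opp0 (t := tperm k k')); first by rewrite rowsymMr // row_stab_tperm.
rewrite mulrA gbase_tpermJ -mulrA colaltMl ?col_stab_tperm // odd_tperm.
by rewrite inj_eq ?nk /= ?scaleN1r ?mulrN //; exact: perm_inj.
Qed.

Lemma colalt_rowsym0 mu nu (g : 'S_N) (k k' : 'I_N) : k != k' ->
  tcol mu k = tcol mu k' -> trow nu (g k) = trow nu (g k') ->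
  colalt mu * gbase C g * rowsym nu = 0.
Proof.
move=> nk er ec; rewrite -mulrA.
apply: (opp_absorb0 (t := tperm k k')).
  by rewrite colaltMr ?col_stab_tperm // odd_tperm nk scaleN1r.
by rewrite mulrA gbase_tpermJ -mulrA rowsymMl // row_stab_tperm.
Qed.

Lemma meet_or_pair mu nu (g : 'S_N) :
  (forall k k' : 'I_N, trow mu k = trow mu k' -> tcol nu (g k) = tcol nu (g k') -> k = k') \/
  exists k k' : 'I_N, [/\ k != k', trow mu k = trow mu k' & tcol nu (g k) = tcol nu (g k')].
Proof.
case: (boolP [exists k : 'I_N, [exists k' : 'I_N,
   [&& k != k', trow mu k == trow mu k' & tcol nu (g k) == tcol nu (g k')]]]).
  by move=> /existsP[k /existsP[k' /and3P[? /eqP ? /eqP ?]]]; right; exists k, k'.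
rewrite negb_exists => /forallP nex; left => k k' er ec.
have := nex k; rewrite negb_exists => /forallP/(_ k').
by rewrite er ec !eqxx !andbT negbK => /eqP.
Qed.

Lemma ysym1 mu : sumn mu = N -> ysym mu 1%g = 1.
Proof.
move=> muN; rewrite ffunE (bigD1 1%g) /=; last first.
  by apply/row_stabP => k; rewrite perm1.
rewrite (big_pred1 1%g) => [|s]; last first.
  apply/andP/eqP => [[_ /eqP]|->]; rewrite mul1g //; split=> //.
  by apply/col_stabP => k; rewrite perm1.
rewrite odd_perm1 big1 ?addr0 // => a /andP[ra na1].
rewrite big1 // => b /andP[cb /eqP ab1].
have ba : b = a^-1%g by apply: (mulgI a); rewrite ab1 mulgV.
have b1 : b = 1%g by apply: (row_col_stab1 (mu := mu)) => //; rewrite ba row_stabV.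
by move: ab1 na1; rewrite b1 mulg1 => ->; rewrite eqxx.
Qed.

(** A permutation either is a row times a column permutation, where the two symmetries compute the
    value from that at 1, or it moves two boxes of one row into one column, where a transposition
    shows that the value equals its negative. *)
Lemma von_Neumann mu (z : CSym C N) : sumn mu = N ->
  (forall r, row_stab mu r -> gbase C r * z = z) ->
  (forall k, col_stab mu k -> z * gbase C k = (-1) ^+ k *: z) ->
  z = z 1%g *: ysym mu.
Proof.
move=> muN.
have val (y : CSym C N) : (forall r, row_stab mu r -> gbase C r * y = y) ->
    (forall k, col_stab mu k -> y * gbase C k = (-1) ^+ k *: y) ->
    forall r k, row_stab mu r -> col_stab mu k -> y (r * k)%g = (-1) ^+ k * y 1%g :> C.
  move=> yr yc r k rr ck; rewrite -{1}(yr r rr) gbaseMl mulgA mulVg mul1g.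
  have := congr1 (fun u : CSym C N => u 1%g) (yc _ (col_stabV ck)).
  by rewrite gbaseMr invgK mul1g ffunE odd_permV.
have zero (y : CSym C N) : (forall r, row_stab mu r -> gbase C r * y = y) ->
    (forall k, col_stab mu k -> y * gbase C k = (-1) ^+ k *: y) ->
    forall (g : 'S_N) (k k' : 'I_N), k != k' ->
    trow mu k = trow mu k' -> tcol mu (g k) = tcol mu (g k') -> y g = 0.
  move=> yr yc g k k' nk er ec.
  have cg : col_stab mu (tperm (g k) (g k')) by exact: col_stab_tperm.
  have nkg : g k != g k' by rewrite (inj_eq perm_inj).
  have := yc _ cg; rewrite odd_tperm nkg scaleN1r.
  move/(congr1 (fun u : CSym C N => u (tperm k k' * g)%g)).
  have comm : (tperm k k' * g = g * tperm (g k) (g k'))%g.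
    by rewrite -tpermJ conjgE !mulgA mulgV mul1g.
  rewrite gbaseMr tpermV {1}comm -mulgA tperm2 mulg1 ffunE => e.
  have := congr1 (fun u : CSym C N => u g) (yr _ (row_stab_tperm er)).
  rewrite gbaseMl tpermV => e2; move: e; rewrite e2 => /eqP.
  by rewrite -addr_eq0 -mulr2n mulrn_eq0 /= => /eqP.
have cr r : row_stab mu r -> gbase C r * ysym mu = ysym mu.
  by move=> rr; rewrite ysymE mulrA rowsymMl.
have cc k : col_stab mu k -> ysym mu * gbase C k = (-1) ^+ k *: ysym mu.
  by move=> ck; rewrite ysymE -mulrA colaltMr // scalerAr.
move=> zr zc; apply/ffunP => g; rewrite ffunE.
case: (meet_or_pair mu mu g) => [meet|[k [k' [nk er ec]]]].
  have [r [rr ck ->]] := meet_row_col muN meet.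
  by rewrite !val // ysym1 // [_ *: _]mulrC mulr1.
by rewrite !(zero _ _ _ g k k') // scaler0.
Qed.

Lemma ysym_sandwich mu x : sumn mu = N ->
  exists a : C, ysym mu * x * ysym mu = a *: ysym mu.
Proof.
move=> muN; exists ((ysym mu * x * ysym mu) 1%g); apply: von_Neumann => // [r rr|k ck].
  by rewrite {1}ysymE !mulrA rowsymMl // -ysymE.
by rewrite {2}ysymE -!mulrA colaltMr // -!scalerAr -ysymE.
Qed.

(** If the product is nonzero, then so are a column-row product inside it and the row-column product
    of its outer factors. Each bounds how rows and columns meet, which gives dominance in one
    direction; both together force [mu = nu]. *)
Lemma ysym_orthogonal mu nu x :
  is_partition N mu -> is_partition N nu -> mu != nu -> ysym mu * x * ysym nu = 0.
Proof.
move=> pmu pnu nmn; have /and3P[_ _ /eqP muN] := pmu; have /and3P[_ _ /eqP nuN] := pnu.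
have := nmn; apply: contraNeq => nz; apply/eqP; apply: (partition_eq pmu pnu) => c.
apply/eqP; rewrite eqn_leq.
have nz1 : colalt mu * x * rowsym nu != 0.
  apply: contra_neq nz => e.
  by rewrite !ysymE -!mulrA (mulrA (colalt mu)) (mulrA (colalt mu * _)) e mul0r mulr0.
have nz2 : rowsym mu * (colalt mu * x * rowsym nu) * colalt nu != 0.
  by apply: contra_neq nz => e; rewrite !ysymE -e !mulrA.
apply/andP; split.
  (* some permutation moves the columns of mu across the rows of nu *)
  have [g ng] := sandwich_gbase nz1.
  apply: (meet_dominates (g := g^-1%g)) => // k k' er ec; apply: contraNeq ng => nk.
  apply/eqP; apply: (colalt_rowsym0 (k := g^-1%g k) (k' := g^-1%g k')) => //.
    by rewrite (inj_eq perm_inj).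
  by rewrite !permKV.
have [g ng] := sandwich_gbase nz2.
apply: (meet_dominates (g := g)) => // k k' er ec; apply: contraNeq ng => nk.
exact/eqP/(rowsym_colalt0 nk).
Qed.

End YoungSymmetrizer.

(** * Permutations of equal cycle type are conjugate *)

Section CycleType.
Variable N : nat.
Implicit Types (s t g : 'S_N) (A O : {set 'I_N}) (x y : 'I_N).

Lemma permX_porbit_eq s x i j :
  ((s ^+ i)%g x = (s ^+ j)%g x) <-> (i = j %[mod #|porbit s x|]).
Proof.
have n0 : (0 < #|porbit s x|)%N by rewrite lt0n card_porbit_neq0.
have Em k : (s ^+ k)%g x = (s ^+ (k %% #|porbit s x|))%g x.
  rewrite {1}(divn_eq k #|porbit s x|) expgD permM; congr (fun_of_perm _ _).
  by elim: (k %/ _)%N => [|q IH]; rewrite ?mul0n ?perm1 // mulSn expgD permM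
    [(s ^+ #|_|)%g x]permX iter_porbit.
split=> [|e]; last by rewrite Em e -Em.
rewrite Em [RHS]Em !permX => e; apply/eqP.
have lt k : (k %% #|porbit s x| < #|porbit s x|)%N by rewrite ltn_mod.
have := nth_uniq x _ _ (uniq_traject_porbit s x); rewrite size_traject => <- //.
by rewrite !nth_traject // e.
Qed.

Definition cycles s : seq {set 'I_N} :=
  sort (fun A B : {set 'I_N} => geq #|A| #|B|) (enum (porbits s)).

Definition cycle_type s : seq nat := [seq #|A| | A : {set 'I_N} <- cycles s].

Lemma mem_cycles s A : (A \in cycles s) = (A \in porbits s).
Proof. by rewrite mem_sort mem_enum. Qed.

Lemma cycle_type_partition s : is_partition N (cycle_type s).
Proof.
apply/and3P; split.
- rewrite /cycle_type sorted_map; apply: sort_sorted => A B; exact: leq_total.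
- apply/mapP => -[A]; rewrite mem_cycles => /imsetP[x _ ->] /esym/eqP.
  by rewrite (negbTE (card_porbit_neq0 s x)).
- rewrite /cycle_type sumnE big_map (perm_big _ (permEl (perm_sort _ _))) /=.
  rewrite big_enum /=.
  rewrite -(card_partition (D := [set: 'I_N])) ?cardsT ?card_ord //.
  apply/and3P; split.
  + apply/eqP/setP => x; rewrite inE; apply/bigcupP; exists (porbit s x).
      exact: imset_f.
    exact: porbit_id.
  + apply/trivIsetP => _ _ /imsetP[x _ ->] /imsetP[y _ ->] nxy.
    rewrite -setI_eq0; apply: contraNT nxy => /set0Pn[z]; rewrite inE => /andP[zx zy].
    by move: zx zy; rewrite -!eq_porbit_mem => /eqP <- /eqP <-.
  + apply/negP => /imsetP[x _ /esym e].
    by have := porbit_id s x; rewrite e inE.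
Qed.

(** The default only makes the choice total: on a nonempty set the value is a member and does not
    depend on [x]. *)
Let rep A x : 'I_N := odflt x [pick y in A].

(** The sorted lists of cycles match index by index with equal lengths. After a base point is fixed
    in each cycle, the conjugator sends the [i]-th iterate in a cycle of [s] to the [i]-th iterate
    in the matching cycle of [t]. *)
Lemma cycle_type_conj s t : cycle_type s = cycle_type t ->
  exists g, t = (g^-1 * s * g)%g.
Proof.
move=> est.
have rep_mem A x y : y \in A -> rep A x \in A.
  by rewrite /rep; case: pickP => //= e; rewrite e.
have rep_def A x x' y : y \in A -> rep A x = rep A x'.
  by rewrite /rep; case: pickP => //= e; rewrite e.
have sz : size (cycles s) = size (cycles t) by have := congr1 size est; rewrite !size_map.
pose beta A := nth set0 (cycles t) (index A (cycles s)).
have bmem x : beta (porbit s x) \in porbits t.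
  by rewrite -mem_cycles mem_nth // -sz index_mem mem_cycles imset_f.
have bcard x : #|beta (porbit s x)| = #|porbit s x|.
  have lt : (index (porbit s x) (cycles s) < size (cycles s))%N.
    by rewrite index_mem mem_cycles imset_f.
  have := congr1 (fun l => nth 0%N l (index (porbit s x) (cycles s))) est.
  rewrite !(nth_map set0) -?sz // nth_index //.
  by rewrite mem_cycles imset_f.
have binj x y : beta (porbit s x) = beta (porbit s y) -> porbit s x = porbit s y.
  move/eqP; rewrite nth_uniq; first 1 last.
  - by rewrite -sz index_mem mem_cycles imset_f.
  - by rewrite -sz index_mem mem_cycles imset_f.
  - by rewrite sort_uniq enum_uniq.
  move/eqP => e; have cx : porbit s x \in cycles s by rewrite mem_cycles imset_f.
  have cy : porbit s y \in cycles s by rewrite mem_cycles imset_f.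
  by rewrite -(nth_index set0 cx) -(nth_index set0 cy) e.
have bne x : exists y, y \in beta (porbit s x).
  by have /imsetP[y _ ->] := bmem x; exists y; apply: porbit_id.
pose ra x := rep (porbit s x) x; pose rb x := rep (beta (porbit s x)) x.
have raP x : ra x \in porbit s x by apply: (rep_mem _ _ x); apply: porbit_id.
have rbP x : beta (porbit s x) = porbit t (rb x).
  have [y yb] := bne x; have := rep_mem _ x _ yb; rewrite -/(rb x).
  by have /imsetP[z _ ->] := bmem x; rewrite -eq_porbit_mem => /eqP.
have raE x y : porbit s x = porbit s y -> ra x = ra y.
  by rewrite /ra => ->; apply: (rep_def _ _ _ y); apply: porbit_id.
have rbE x y : porbit s x = porbit s y -> rb x = rb y.
  by move=> e; rewrite /rb e; have [z] := bne y; apply: rep_def.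
(* The exponent [i] is determined only modulo the cycle length; as matching cycles have equal
   length, the image is not affected. *)
have /fin_all_exists[f fP] : forall x, exists y, exists i,
    x = (s ^+ i)%g (ra x) /\ y = (t ^+ i)%g (rb x).
  move=> x; have := raP x; rewrite porbit_sym => /porbitP[i ei].
  by exists ((t ^+ i)%g (rb x)), i.
have cardab x : #|porbit s (ra x)| = #|porbit t (rb x)|.
  by rewrite -rbP bcard; congr #|pred_of_set _|; apply/eqP; rewrite eq_porbit_mem.
have forb x : porbit t (f x) = beta (porbit s x).
  by have [i [_ ->]] := fP x; rewrite porbit_perm -rbP.
have fI : injective f.
  move=> x y exy; have o : porbit s x = porbit s y by apply: binj; rewrite -!forb exy.
  have [i [ei fi]] := fP x; have [j [ej fj]] := fP y.
  move: exy; rewrite fi fj -(rbE _ _ o) => /permX_porbit_eq; rewrite -cardab.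
  by move/permX_porbit_eq; rewrite -ei (raE _ _ o) -ej.
exists (perm fI); apply/permP => y; rewrite !permM -{1}(permKV (perm fI) y).
move: ((perm fI)^-1%g y) => {y} x; rewrite !permE.
have o : porbit s (s x) = porbit s x by have := porbit_perm s 1 x; rewrite expg1.
have [i [ei fi]] := fP x; have [j [ej fj]] := fP (s x).
rewrite fj fi (rbE _ _ o) -permM -expgSr; apply/permX_porbit_eq; rewrite -cardab.
by apply/permX_porbit_eq; rewrite expgSr permM -ei -(raE _ _ o) -ej.
Qed.

End CycleType.

(** * The two-sided ideals of the Young symmetrizers span the group algebra *)

Section Completeness.
Variables (C : numFieldType) (N : nat).
Implicit Types (mu nu : seq nat) (x y : CSym C N) (g h s : 'S_N).
Notation ysym mu := (young_symmetrizer C N mu).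

Lemma young_ideal_gen mu g h : gbase C g * ysym mu * gbase C h \in young_ideal C N mu.
Proof.
by apply: memv_span; rewrite -translateE; apply/allpairsP; exists (g, h); rewrite !mem_enum.
Qed.

Lemma young_ideal_ind mu (Q : CSym C N -> Prop) :
  Q 0 -> (forall (a : C) x y, Q x -> Q y -> Q (a *: x + y)) ->
  (forall g h, Q (gbase C g * ysym mu * gbase C h)) ->
  forall x, x \in young_ideal C N mu -> Q x.
Proof.
move=> Q0 QD Qg x; rewrite /young_ideal -[X in <<X>>%VS]in_tupleE => /coord_span ->.
elim/big_ind: _ => // [y z Qy Qz|i _]; first by rewrite -[y]scale1r; apply: QD.
rewrite -[_ *: _]addr0; apply: QD => //.
by have /allpairsP[[g h] [_ _ ->]] := mem_nth 0 (ltn_ord i); rewrite translateE.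
Qed.

Lemma young_idealMl mu x y : x \in young_ideal C N mu -> y * x \in young_ideal C N mu.
Proof.
apply: (young_ideal_ind (Q := fun x => y * x \in young_ideal C N mu)) x => [|a x z Ix Iz|g h].
- by rewrite mulr0 mem0v.
- by rewrite mulrDr -scalerAr memvD ?memvZ.
rewrite [y]CSym_sum mulr_suml; apply: memv_suml => g' _.
by rewrite -scalerAl memvZ // !mulrA gbaseM young_ideal_gen.
Qed.

Lemma young_ideal_orthogonal mu nu x y :
  is_partition N mu -> is_partition N nu -> mu != nu ->
  x \in young_ideal C N mu -> y \in young_ideal C N nu -> x * y = 0.
Proof.
move=> pm pn nmn; apply: (young_ideal_ind (Q := fun x => _ -> x * y = 0)) x.
- by rewrite mul0r.
- by move=> a x x' H H' yI; rewrite mulrDl -scalerAl H // H' // scaler0 addr0.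
move=> g h; apply: (young_ideal_ind (Q := fun y => _ * y = 0)) y.
- by rewrite mulr0.
- by move=> a x x' H H'; rewrite mulrDr -scalerAr H H' scaler0 addr0.
move=> g' h'; have -> (G Y H G' Y' H' : CSym C N) :
  G * Y * H * (G' * Y' * H') = G * (Y * (H * G') * Y') * H' by rewrite !mulrA.
by rewrite ysym_orthogonal // mulr0 mul0r.
Qed.

(** The sum of all conjugates, a central element; classically it is a multiple of the irreducible
    character of [mu]. *)
Definition zsym mu : CSym C N := \sum_g gbase C g * ysym mu * gbase C g^-1.

Lemma zsym_ideal mu : zsym mu \in young_ideal C N mu.
Proof. by apply: memv_suml => g _; apply: young_ideal_gen. Qed.

Lemma zsymE mu s : zsym mu s = \sum_g (ysym mu (g^-1 * s * g)%g : C).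
Proof.
by rewrite sum_ffunE; apply: eq_bigr => g _; rewrite gbaseMr gbaseMl invgK mulgA.
Qed.

Lemma zsym_class mu s h : zsym mu (h^-1 * s * h)%g = zsym mu s.
Proof.
rewrite !zsymE [RHS](reindex_inj (mulgI h)); apply: eq_bigr => g _.
by rewrite invMg !mulgA.
Qed.

Lemma ysymV mu s : ysym mu s^-1%g =
  \sum_(a | row_stab mu a) \sum_(b | col_stab mu b && ((b * a)%g == s)) (-1) ^+ b :> C.
Proof.
have bij (P : 'S_N -> bool) : (forall a, P a -> P a^-1%g) -> forall a, P a^-1%g = P a.
  by move=> PV a; apply/idP/idP => /PV //; rewrite invgK.
rewrite ffunE (reindex_inj invg_inj); apply: eq_big => [a|a _].
  exact/(bij (row_stab mu))/row_stabV.
rewrite (reindex_inj invg_inj); apply: eq_big => [b|b _]; last by rewrite odd_permV.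
rewrite (bij (col_stab mu)); last exact: col_stabV.
by rewrite -invMg (inj_eq invg_inj).
Qed.

(** Inversion turns the products [a * b] of row and column permutations into products [b * a], which
    are conjugate to them with the same sign. *)
Lemma zsymV mu s : zsym mu s^-1%g = zsym mu s.
Proof.
have E u : \sum_g (ysym mu (g^-1 * u * g)%g : C) =
   \sum_(a | row_stab mu a) \sum_(b | col_stab mu b)
     \sum_g (if (a * b == g^-1 * u * g)%g then (-1) ^+ b else 0).
  under eq_bigr => g _ do rewrite ffunE.
  rewrite exchange_big; apply: eq_bigr => a _.
  under eq_bigr => g _ do rewrite big_mkcondr.
  by rewrite exchange_big.
have EV u : \sum_g (ysym mu (g^-1 * u * g)^-1%g : C) =
   \sum_(a | row_stab mu a) \sum_(b | col_stab mu b)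
     \sum_g (if (b * a == g^-1 * u * g)%g then (-1) ^+ b else 0).
  under eq_bigr => g _ do rewrite ysymV.
  rewrite exchange_big; apply: eq_bigr => a _.
  under eq_bigr => g _ do rewrite big_mkcondr.
  by rewrite exchange_big.
rewrite !zsymE.
under eq_bigr => g _.
  rewrite (_ : g^-1 * s^-1 * g = (g^-1 * s * g)^-1)%g; last by rewrite !invMg invgK mulgA.
  over.
rewrite EV E; apply: eq_bigr => a _; apply: eq_bigr => b _.
rewrite [RHS](reindex_inj (mulIg a^-1%g)); apply: eq_bigr => g _.
rewrite invMg invgK -!mulgA (inj_eq (mulgI a)) !mulgA.
by rewrite -[in RHS](inj_eq (mulIg a)) /= mulgKV.
Qed.

Lemma zsym1 mu : sumn mu = N -> zsym mu 1%g != 0.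
Proof.
move=> muN; rewrite zsymE; under eq_bigr => g _ do rewrite mulg1 mulVg ysym1 //.
by rewrite sumr_const pnatr_eq0 -lt0n; apply/card_gt0P; exists 1%g.
Qed.

Lemma zsym_int mu s : (zsym mu s : C) \is Num.real.
Proof.
rewrite zsymE rpred_sum // => g _; rewrite ffunE rpred_sum // => a _.
by rewrite rpred_sum // => b _; rewrite rpredX // realN real1.
Qed.

(** Symmetry under inversion makes the coefficient at 1 a sum of real squares, and the square of the
    coefficient at 1 is nonzero. *)
Lemma zsym_sqr mu : sumn mu = N -> (zsym mu * zsym mu) 1%g != 0.
Proof.
move=> muN; rewrite CSymME; under eq_bigr => g _ do rewrite mulg1 zsymV.
rewrite psumr_neq0 => [|g _]; last by rewrite -expr2 real_exprn_even_ge0 // zsym_int.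
apply/hasP; exists 1%g; rewrite ?mem_index_enum //= lt0r mulf_neq0 ?zsym1 //=.
by rewrite -expr2 real_exprn_even_ge0 // zsym_int.
Qed.

(* As many class functions zsym mu as cycle types: by orthogonality they are
   linearly independent, hence span all class functions, in particular 1. *)
Lemma one_in_young_ideals :
  exists2 P : seq (seq nat), uniq P && all (is_partition N) P &
  exists2 e : seq nat -> CSym C N,
    (forall mu, e mu \in young_ideal C N mu) & 1 = \sum_(mu <- P) e mu.
Proof.
(* Only the cycle types that occur are used, so that the matrix [A] below is square by
   construction. *)
pose P := undup [seq cycle_type s | s : 'S_N]; pose q := size P.
have Pp mu : mu \in P -> is_partition N mu.
  by rewrite mem_undup => /mapP[s _ ->]; apply: cycle_type_partition.
have Pn mu : mu \in P -> sumn mu = N by move=> /Pp /and3P[_ _ /eqP].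
have /fin_all_exists[rp rpP] : forall i : 'I_q, exists s : 'S_N, cycle_type s = nth [::] P i.
  move=> i; have := mem_nth [::] (ltn_ord i : i < size P)%N.
  by rewrite mem_undup => /mapP[s _ ->]; exists s.
have Pi (i : 'I_q) : nth [::] P i \in P by rewrite mem_nth.
have class (y : CSym C N) : (forall s h, y (h^-1 * s * h)%g = y s) ->
    (forall i, y (rp i) = 0) -> y = 0.
  move=> yc y0; apply/ffunP => s; rewrite ffunE.
  have sP : cycle_type s \in P by rewrite mem_undup map_f ?mem_enum.
  have lt : (index (cycle_type s) P < q)%N by rewrite index_mem.
  have [g e] : exists g, s = (g^-1 * rp (Ordinal lt) * g)%g.
    by apply: cycle_type_conj; rewrite rpP /= nth_index.
  by rewrite e yc y0.
pose A : 'M[C]_q := \matrix_(i, j) zsym (nth [::] P i) (rp j).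
have comb (v : 'rV[C]_q) s :
    (\sum_i v 0 i *: zsym (nth [::] P i)) s = \sum_i v 0 i * zsym (nth [::] P i) s :> C.
  by rewrite sum_ffunE; apply: eq_bigr => i _; rewrite ffunE.
(* A linear relation between the [zsym] is multiplied by one of them and read at 1: orthogonality
   leaves a single term, with nonzero factor by [zsym_sqr]. *)
have Afree : row_free A.
  apply/inj_row_free => v vA; apply/rowP => i; rewrite mxE.
  have z0 : \sum_i v 0 i *: zsym (nth [::] P i) = 0.
    apply: class => [s h|j]; first by rewrite !comb; apply: eq_bigr => k _; rewrite zsym_class.
    rewrite comb; have /rowP/(_ j) := vA; rewrite !mxE => {2}<-.
    by apply: eq_bigr => k _; rewrite mxE.
  have := congr1 (fun y => (y * zsym (nth [::] P i)) 1%g) z0.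
  rewrite mul0r [RHS]ffunE mulr_suml (bigD1 i) //= big1 ?addr0 => [|j ji].
    rewrite -scalerAl ffunE => /eqP; rewrite scaler_eq0 (negbTE (zsym_sqr _)) ?orbF.
      by move/eqP.
    by rewrite Pn.
  rewrite -scalerAl (young_ideal_orthogonal _ _ _ (zsym_ideal _) (zsym_ideal _)) ?scaler0 ?Pp //.
  by rewrite nth_uniq ?undup_uniq.
have Aunit : A \in unitmx by rewrite -row_free_unit.
pose v := (\row_j (1 : CSym C N) (rp j) : 'rV[C]_q) *m invmx A.
have one : 1 = \sum_i v 0 i *: zsym (nth [::] P i).
  apply/eqP; rewrite eq_sym -subr_eq0; apply/eqP; apply: class => [s h|j].
    rewrite !ffunE !comb; congr (_ - _).
      by apply: eq_bigr => k _; rewrite zsym_class.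
    rewrite -(inj_eq (mulgI h)) -(inj_eq (mulIg h^-1%g)).
    by rewrite mulg1 mulgV !mulgA mulgV mul1g mulgK.
  rewrite !ffunE comb; have /rowP/(_ j) := mulmxKV Aunit (\row_j (1 : CSym C N) (rp j)).
  rewrite -/v !mxE -gbase1 gbaseE => <-; apply/eqP; rewrite subr_eq0; apply/eqP.
  by apply: eq_bigr => k _; rewrite [A _ _]mxE.
exists P; first by rewrite undup_uniq; apply/allP.
exists (fun mu => \sum_(i : 'I_q | nth [::] P i == mu) v 0 i *: zsym mu).
  by move=> mu; apply: memv_suml => i _; apply: memvZ; apply: zsym_ideal.
rewrite one [RHS](big_nth [::]) big_mkord; apply: eq_bigr => i _.
rewrite (big_pred1 i) // => j; apply/eqP/eqP => [|-> //].
by move/eqP; rewrite nth_uniq ?undup_uniq // => /eqP /val_inj.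
Qed.

End Completeness.

(** * The kernel of the signed action on tensors *)

(** Splitting off the transposition of [i] and [g i], two odd positions, lowers the number of moved
    points. *)
Lemma inv_par_odd (N : nat) (g : 'S_N) (p : 'I_N -> bool) :
  (forall i, ~~ p i -> g i = i) -> inv_par g p = g :> bool.
Proof.
have [k] := ubnP #|[set i | g i != i]|; elim: k g => // k IH g lek gp.
case: (pickP (fun i => g i != i)) => [i gi|g1]; last first.
  have -> : g = 1%g by apply/permP => i; rewrite perm1; have /eqP := g1 i.
  by rewrite inv_par1 odd_perm1.
have pi : p i by apply: contraNT gi => /gp ->.
have pgi : p (g i) by apply: contraNT gi => /gp /perm_inj ->.
have nigi : i != g i by rewrite eq_sym.
pose t := tperm i (g i); pose h := (t * g)%g.
have thg : (t * h)%g = g by rewrite /h mulgA tperm2 mul1g.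
have hgi : h (g i) = g i by rewrite permM tpermR.
have hx x : g x = x -> h x = x.
  move=> gx; case: (eqVneq x (g i)) => [->//|xgi]; rewrite permM tpermD //; last by rewrite eq_sym.
  by apply: contraNneq gi => ->; apply/eqP.
have IHh : inv_par h p = h.
  apply: IH => [|x px]; last by apply/hx/gp.
  apply: (@leq_trans #|[set x | g x != x]|); last by rewrite -ltnS.
  apply: proper_card; apply/properP; split; last first.
    by exists (g i); rewrite !inE ?hgi ?eqxx // (inj_eq perm_inj).
  by apply/subsetP => x; rewrite !inE; apply: contra => /eqP /hx ->.
rewrite -{1}thg inv_parM inv_par_tperm ?pi //.
rewrite (eq_inv_par _ (q := p)) ?IHh => [|x]; last first.
  by rewrite /= tpermV; case: tpermP => [->|->|]; rewrite ?pi ?pgi.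
by rewrite -[in RHS]thg odd_permM odd_tperm nigi.
Qed.

(** Otherwise [t^-1] maps [B] into itself, hence onto itself, and the point of [B] coming from [x]
    would also come from [B]. *)
Lemma perm_exchange (N : nat) (t : 'S_N) (A B : {set 'I_N}) x :
  perm_on (A :|: B) t -> [disjoint A & B] -> x \in A -> t^-1%g x \in B ->
  exists2 y, y \in B & t^-1%g y \in A.
Proof.
move=> tAB dAB xA xB; case: (boolP [exists y in B, t^-1%g y \in A]).
  by move=> /existsP[y /andP[yB yA]]; exists y.
rewrite negb_exists => /forallP nex.
have sub : [set t^-1%g y | y in B] \subset B.
  apply/subsetP => _ /imsetP[y yB ->]; have := nex y; rewrite yB /= => nyA.
  have : t^-1%g y \in A :|: B by rewrite -(perm_closed _ tAB) permKV inE yB orbT.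
  by rewrite inE (negbTE nyA).
have eqB : [set t^-1%g y | y in B] = B.
  by apply/eqP; rewrite eqEcard sub (card_imset _ (@perm_inj _ _)) leqnn.
move: xB; rewrite -eqB => /imsetP[y yB /perm_inj xy].
by have := disjointFr dAB xA; rewrite xy yB.
Qed.

Lemma first_crossing (u : nat -> nat) (m k : nat) :
  (u 1 <= m)%N -> (m < u k.+1)%N ->
  exists a, [/\ (0 < a <= k)%N, (u a <= m)%N & (m < u a.+1)%N].
Proof.
elim: k => [|k IH] u1 uk; first by rewrite ltnNge u1 in uk.
case: (leqP (u k.+1) m) => [le|lt]; first by exists k.+1; rewrite leqnn.
by have [a [/andP[a0 ak] ? ?]] := IH u1 lt; exists a; rewrite a0 (leq_trans ak).
Qed.

Lemma not_increasing (a : nat -> nat) (k : nat) :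
  (forall c, c <= k -> 0 < a c <= k)%N ->
  exists c c', [/\ (c < c')%N, (c' <= k)%N & (a c' <= a c)%N].
Proof.
move=> ak; case: (boolP [exists i : 'I_k, (a i.+1 <= a i)%N]).
  by move=> /existsP[i ai]; exists i, i.+1.
rewrite negb_exists => /forallP inc.
have : forall c, (c <= k)%N -> (c < a c)%N.
  elim=> [|c IH] ck; first by have /andP[] := ak 0%N ck.
  have := inc (Ordinal ck); rewrite -ltnNge /=.
  by apply: leq_ltn_trans; apply: IH; apply: ltnW.
by move/(_ k (leqnn k)); have /andP[_] := ak k (leqnn k); lia.
Qed.

(** * Which Young symmetrizers kill all forms *)

Section HookTheorem.
Variables (C : numFieldType) (N : nat) (X : finType) (par : X -> bool) (mu : seq nat).
Hypothesis pmu : is_partition N mu.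

Let muN : sumn mu = N. Proof. by case/and3P: pmu => _ _ /eqP. Qed.

Notation letters := {ffun 'I_N -> X}.
Notation ysym := (young_symmetrizer C N mu).
Notation colalt := (altsum C (@col_stab N mu)).
Notation rowsym := (symsum C (@row_stab N mu)).
Notation m := #|[pred x | ~~ par x]|.
Notation k := #|[pred x | par x]|.
Implicit Types (f : letters) (g : 'S_N).

Definition lidx (x : X) : nat := index x (enum [pred y | par y == par x]).

Lemma lidx_inj x y : par x = par y -> lidx x = lidx y -> x = y.
Proof.
rewrite /lidx => pxy; rewrite pxy => e.
have inx z : par z = par y -> z \in enum [pred t | par t == par y].
  by move=> pz; rewrite mem_enum inE pz.
by have := nth_index x (inx x pxy); rewrite e (nth_index x (inx y erefl)).
Qed.

Lemma lidx_lt x : (lidx x < if par x then k else m)%N.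
Proof.
have -> : (if par x then k else m) = #|[pred y | par y == par x]|.
  by case: (par x); apply: eq_card => y; rewrite !inE; case: (par y).
by rewrite cardE index_mem mem_enum inE.
Qed.

Lemma lidx_ex b i : (i < if b then k else m)%N -> exists2 x, par x = b & lidx x = i.
Proof.
move=> lti; pose e := enum [pred y | par y == b].
have lts : (i < size e)%N.
  rewrite -cardE; apply: (leq_trans lti); case: (b); apply: subset_leq_card;
  by apply/subsetP => y; rewrite !inE; case: (par y).
have x0 : X by move: lts; case: (e) => // x _ _; exact: x.
have : nth x0 e i \in e by rewrite mem_nth.
rewrite mem_enum inE => /eqP px; exists (nth x0 e i) => //.
by rewrite /lidx px index_uniq ?enum_uniq.
Qed.

Lemma psign1 g f : (forall i, par (f i) -> g i = i) -> psign C par g f = 1.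
Proof. by move=> gp; rewrite /psign inv_par_fix. Qed.

Lemma psign_odd g f : (forall i, ~~ par (f i) -> g i = i) -> psign C par g f = (-1) ^+ g.
Proof. by move=> gp; rewrite /psign inv_par_odd. Qed.

Lemma ysym_dform f f' : act par ysym (dform C f) f' =
  \sum_(a | row_stab mu a) \sum_(b | col_stab mu b)
    (if fcomp f (a * b) == f' then (-1) ^+ b * psign C par (a * b) f' else 0).
Proof.
rewrite ysymE mulr_suml act_suml sum_ffunE; apply: eq_bigr => a _.
rewrite mulr_sumr act_suml sum_ffunE; apply: eq_bigr => b _.
rewrite -scalerAr gbaseM actZl act_gbase pact_dform !ffunE eq_sym.
by case: eqP => [->|_]; [rewrite !scalerA; exact: mulr1 | rewrite !scaler0].
Qed.

(* Even letters constant along the first m rows, odd letters constant along the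
   columns below: only terms contributing +1 return to this filling. *)
Lemma hook_filling_neq0 : (nth 0%N mu m <= k)%N ->
  exists f, act par ysym (dform C f) f != 0.
Proof.
move=> muk; have srt : sorted geq mu by case/and3P: pmu.
have /fin_all_exists[f0 f0P] : forall x : 'I_N, exists y : X,
    par y = (m <= trow mu x)%N /\ lidx y = if (trow mu x < m)%N then trow mu x else tcol mu x.
  move=> x; case: (ltnP (trow mu x) m) => [lt|le].
    by have [y py ly] := @lidx_ex false _ lt; exists y.
  have lt : (tcol mu x < k)%N.
    apply: leq_trans (tcol_lt muN x) _; apply: leq_trans _ muk.
    have geq_tr : transitive geq by move=> a b c ba ac; exact: leq_trans ac ba.
    apply: (sorted_leq_nth geq_tr leqnn 0%N srt) => //; last exact: trow_lt.
    by rewrite inE (leq_ltn_trans le) // trow_lt.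
  by have [y py ly] := @lidx_ex true _ lt; exists y.
pose f : letters := [ffun x => f0 x]; exists f.
have fp x : par (f x) = (m <= trow mu x)%N by rewrite ffunE; case: (f0P x).
have fi x : lidx (f x) = if (trow mu x < m)%N then trow mu x else tcol mu x.
  by rewrite ffunE; case: (f0P x).
(* Comparing letters of [f] at [b y] and [a^-1 y] shows that [b] fixes the boxes with even letters
   and [a] those with odd letters. So the graded sign of the product is the ordinary sign of [b],
   and the two cancel. *)
have term a b : row_stab mu a -> col_stab mu b -> fcomp f (a * b) = f ->
    (-1) ^+ b * psign C par (a * b) f = 1.
  move=> ra cb e; have rV := row_stabP _ _ (row_stabV ra); have cP := col_stabP _ _ cb.
  have eb y : f (b y) = f (a^-1%g y).
    by have /ffunP/(_ (a^-1%g y)) := e; rewrite ffunE permM permKV.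
  have rb y : (m <= trow mu (b y))%N = (m <= trow mu y)%N by rewrite -!fp eb !fp rV.
  have ifix y : ~~ par (f y) -> b y = y.
    rewrite fp -ltnNge => lty; have ltb : (trow mu (b y) < m)%N by rewrite ltnNge rb -ltnNge.
    apply: (tbox_inj (mu := mu)) => //.
    by have := congr1 lidx (eb y); rewrite !fi ltb rV lty.
  have afix y : par (f y) -> a y = y.
    rewrite fp => ley; suff ay : a^-1%g y = y by rewrite -{1}ay permKV.
    apply: (tbox_inj (mu := mu)) => //.
    have := congr1 lidx (eb y); rewrite !fi rV !ltnNge rb ley /= => <-; exact: cP.
  rewrite psignM psign1 // mul1r psign_odd => [|y]; first by rewrite -signr_addb addbb.
  rewrite ffunE => npy; apply: ifix; apply: contra npy; rewrite !fp rV //.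
rewrite ysym_dform.
rewrite (_ : \sum_(a | _) _ = \sum_(a | row_stab mu a)
   (#|[pred b | col_stab mu b && (fcomp f (a * b) == f)]|)%:R); last first.
  apply: eq_bigr => a ra; rewrite -sum1_card natr_sum big_mkcondr /=.
  by apply: eq_bigr => b cb; case: eqP => // e; rewrite term.
rewrite -natr_sum pnatr_eq0 -lt0n (bigD1 1%g) /=; last first.
  by apply/row_stabP => x; rewrite perm1.
rewrite addn_gt0; apply/orP; left; apply/card_gt0P; exists 1%g; rewrite inE mulg1 fcomp1 eqxx andbT.
by apply/col_stabP => x; rewrite perm1.
Qed.

Definition psi f : form C N X := act par ysym (dform C f).

Lemma pact_tperm_same f (i j : 'I_N) : i != j -> f i = f j ->
  pact par (tperm i j) (dform C f) = (-1) ^+ par (f i) *: dform C f.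
Proof.
move=> nij fij; rewrite pact_dform.
have -> : fcomp f (tperm i j) = f.
  by apply/ffunP => l; rewrite ffunE; case: tpermP => [->|->|].
by rewrite /psign inv_par_tperm //= fij.
Qed.

(** Exchanging equal even letters fixes the basis form, while the column antisymmetrizer negates
    it. *)
Lemma psi_even_column f (i j : 'I_N) : psi f != 0 -> i != j -> tcol mu i = tcol mu j ->
  ~~ par (f i) -> f i != f j.
Proof.
move=> nz nij cij pfi; apply: contraNneq nz => fij; apply/eqP; apply: eq_opp0.
rewrite {1}/psi -[dform C f]scale1r -[1]/((-1) ^+ false) -(negbTE pfi) -(pact_tperm_same nij fij).
rewrite -act_gbase -actM ysymE -mulrA colaltMr ?col_stab_tperm // odd_tperm nij scaleN1r.
by rewrite mulrN -ysymE -[X in act _ X _]scaleN1r actZl scaleN1r.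
Qed.

Definition column c : {set 'I_N} := [set x | tcol mu x == c].

(** For each column permutation [b], every row meeting [b^-1 Z] also meets the left column [c]. As
    [Z] has more elements than that column, two of them come from the same row; their transposition
    is absorbed by the row sum and negates the alternating sum over [Z]. *)
Lemma garnir (Z : {set 'I_N}) c c' : (c < c')%N ->
  {in Z, forall x, (tcol mu x == c) || (tcol mu x == c')} ->
  (#|column c| < #|Z|)%N ->
  ysym * altsum C (perm_on Z) = 0.
Proof.
move=> cc' Zc ltZ; rewrite ysymE -mulrA [colalt * _]mulr_suml mulr_sumr big1 // => b cb.
rewrite -scalerAl -scalerAr; apply/eqP; rewrite scaler_eq0; apply/orP; right; apply/eqP.
have cV := col_stabP _ _ (col_stabV cb).
have box (y : 'I_N) : exists z : 'I_N, y \in Z -> z \in column c /\ trow mu z = trow mu (b^-1%g y).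
  case: (boolP (y \in Z)) => yZ; last by exists y.
  have lt : (c < nth 0%N mu (trow mu (b^-1%g y)))%N.
    apply: leq_ltn_trans (tcol_lt muN (b^-1%g y)); rewrite cV.
    by case/orP: (Zc y yZ) => /eqP -> //; exact: ltnW.
  by have [z [zr zc]] := tbox_ex muN lt; exists z => _; rewrite inE zc.
have [h hP] := fin_all_exists box.
have /dinjectivePn[y yZ [y' /predD1P[/eqP ny y'Z] hy]] : ~~ dinjectiveb h Z.
  apply/negP => /dinjectiveP hI; move: ltZ; rewrite ltnNge => /negP; apply.
  rewrite -(card_in_imset hI); apply: subset_leq_card; apply/subsetP => _ /imsetP[y yZ ->].
  by case: (hP y yZ).
have er : trow mu (b^-1%g y) = trow mu (b^-1%g y').
  by rewrite -(hP y yZ).2 -(hP y' y'Z).2 hy.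
have ny' : y != y' by rewrite eq_sym.
apply: (absorb_opp0 (t := tperm (b^-1%g y) (b^-1%g y'))).
  by rewrite rowsymMr // row_stab_tperm.
rewrite mulrA gbase_tpermJ !permKV -mulrA altsumMl; last first.
  move=> s; have tZ : perm_on Z (tperm y y').
    apply/subsetP => x; rewrite inE; apply: contraR => xZ.
    by rewrite tpermD //; apply: contraNneq xZ => <-.
  apply/idP/idP => sZ; last exact: perm_onM.
  by rewrite -[s]mul1g -(tperm2 y y') -mulgA; apply: perm_onM.
by rewrite odd_tperm ny' scaleN1r mulrN.
Qed.

(** All even letters share rank 0, whereas a positive rank determines an odd letter. Only equal odd
    letters will have to be identified. *)
Definition lrank (x : X) : nat := if par x then (lidx x).+1 else 0.

Lemma lrank_inj x y : (0 < lrank x)%N -> lrank x = lrank y -> x = y.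
Proof.
rewrite /lrank; case px: (par x) => //; case py: (par y) => // _ [].
by apply: lidx_inj; rewrite px py.
Qed.

Lemma lrank_le x : (lrank x <= k)%N.
Proof. by have := lidx_lt x; rewrite /lrank; case: (par x). Qed.

(** It grows when letters of high rank move to the right. *)
Definition potential f : int := \sum_(x : 'I_N) (lrank (f x))%:Z * (tcol mu x)%:Z.

(* A permutation moving only letters of rank a across the two columns differs
   from a column permutation by transpositions of equal odd letters. *)
Lemma garnir_term f (E F : {set 'I_N}) c c' a (t : 'S_N) : c != c' -> (0 < a)%N ->
  E \subset column c -> F \subset column c' -> perm_on (E :|: F) t ->
  (forall z, tcol mu (t^-1%g z) != tcol mu z -> lrank (f z) = a) ->
  (-1) ^+ t *: act par ysym (pact par t (dform C f)) = psi f.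
Proof.
move=> ncc' a0 Ec Fc.
have [n] := ubnP #|[set z | tcol mu (t^-1%g z) != tcol mu z]|.
elim: n t => // n IH t len tEF ta.
case: (pickP (fun z => tcol mu (t^-1%g z) != tcol mu z)) => [z zm|no]; last first.
  have ct : col_stab mu t.
    by rewrite -[t]invgK; apply/col_stabV/col_stabP => z; have /negbFE/eqP := no z.
  rewrite -act_gbase -actM {1}ysymE -mulrA colaltMr // -scalerAr actZl scalerA -ysymE.
  by rewrite -signr_addb addbb scale1r.
have EF x : x \in E -> x \notin F.
  move=> xE; apply/negP => xF; have := subsetP Ec x xE; have := subsetP Fc x xF.
  by rewrite !inE => /eqP -> /eqP e; rewrite e eqxx in ncc'.
have tV x : x \in E :|: F -> t^-1%g x \in E :|: F.
  by move=> xEF; rewrite -(perm_closed _ tEF) permKV.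
have out x : x \notin E :|: F -> t^-1%g x = x.
  by move=> xEF; rewrite -{1}(out_perm tEF xEF) permK.
have cE x : x \in E -> tcol mu x = c by move/(subsetP Ec); rewrite inE => /eqP.
have cF x : x \in F -> tcol mu x = c' by move/(subsetP Fc); rewrite inE => /eqP.
have dEF : [disjoint E & F] by rewrite disjoint_subset; apply/subsetP.
have dFE : [disjoint F & E] by rewrite disjoint_sym.
have tFE : perm_on (F :|: E) t by rewrite setUC.
have [e eE eF] : exists2 e, e \in E & t^-1%g e \in F.
  have : z \in E :|: F by apply: contraR zm => /out ->.
  case/setUP => zEF.
    exists z => //; have : t^-1%g z \in E :|: F by rewrite tV // inE zEF.
    by case/setUP => // zE; rewrite !cE ?eqxx in zm.
  apply: (perm_exchange tFE dFE zEF).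
  have : t^-1%g z \in E :|: F by rewrite tV // inE zEF orbT.
  by case/setUP => // zE; rewrite !cF ?eqxx in zm.
have [e' e'F e'E] := perm_exchange tEF dEF eE eF.
have ne : e != e' by apply: contraTneq e'F => <-; apply: EF.
have re : lrank (f e) = a by apply: ta; rewrite (cF _ eF) (cE _ eE) eq_sym.
have re' : lrank (f e') = a by apply: ta; rewrite (cE _ e'E) (cF _ e'F).
have fe : f e = f e' by apply: lrank_inj; rewrite re.
have pe : par (f e) by move: re a0; rewrite /lrank; case: (par _) => // <-.
have sV x : (t * tperm e e')^-1%g x = t^-1%g (tperm e e' x) by rewrite invMg tpermV permM.
have sm x : tcol mu ((t * tperm e e')^-1%g x) != tcol mu x ->
    tcol mu (t^-1%g x) != tcol mu x.
  rewrite sV; case: tpermP => [->|->|//]; last by rewrite (cF _ eF) (cF _ e'F) eqxx.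
  by rewrite (cE _ e'E) (cE _ eE) eqxx.
(* Composing with the transposition of these two equal odd letters returns both to their columns.
   Its sign as a permutation cancels the sign of exchanging odd letters. *)
have <- : (-1) ^+ (t * tperm e e')%g *: act par ysym (pact par (t * tperm e e') (dform C f)) =
    psi f.
  apply: IH => [||x /sm]; last exact: ta.
    move: len; rewrite ltnS; apply: leq_trans; apply: proper_card; apply/properP; split.
      by apply/subsetP => x; rewrite !inE; apply: sm.
    exists e; rewrite !inE ?sV ?tpermL; first by rewrite (cF _ eF) (cE _ eE) eq_sym.
    by rewrite (cE _ e'E) (cE _ eE) eqxx.
  apply: perm_onM => //; apply/subsetP => x; rewrite inE; apply: contraR => xEF.
  by rewrite tpermD //; apply: contraNneq xEF => <-; rewrite inE ?eE ?e'F ?orbT.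
rewrite pactM (pact_tperm_same ne fe) pe expr1 pactZ actZr scalerA.
by rewrite odd_permM odd_tperm ne addbT signrN mulrNN mulr1.
Qed.

(* Each letter contributes its rank excess over a times its column displacement,
   and these have the same sign. *)
Lemma potential_garnir f (E F : {set 'I_N}) c c' a (t : 'S_N) : (c < c')%N ->
  E \subset column c -> F \subset column c' -> perm_on (E :|: F) t ->
  {in E, forall x, (a <= lrank (f x))%N} -> {in F, forall x, (lrank (f x) <= a)%N} ->
  (potential f <= potential (fcomp f t)) /\
  (potential f = potential (fcomp f t) ->
   forall z, tcol mu (t^-1%g z) != tcol mu z -> lrank (f z) = a).
Proof.
move=> cc' Ec Fc tEF Ea Fa.
pose term z : int := ((lrank (f z))%:Z - a%:Z) * ((tcol mu (t^-1%g z))%:Z - (tcol mu z)%:Z).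
have diff : potential (fcomp f t) - potential f = \sum_z term z.
  rewrite /potential [X in X - _](reindex_inj (@perm_inj _ t^-1%g)) /=.
  rewrite (eq_bigr (fun z => (lrank (f z))%:Z * (tcol mu (t^-1%g z))%:Z)); last first.
    by move=> z _; rewrite ffunE permKV.
  (* The total column displacement is zero, so [a] times it may be subtracted; ranks then become
     excesses over [a]. *)
  rewrite -sumrB -[LHS]subr0 -[X in _ - X](_ : \sum_z a%:Z *
      ((tcol mu (t^-1%g z))%:Z - (tcol mu z)%:Z) = 0); last first.
    rewrite -mulr_sumr sumrB [X in X - _](reindex_inj (@perm_inj _ t)) /=.
    by under eq_bigr => z _ do rewrite permK; rewrite subrr mulr0.
  by rewrite -sumrB; apply: eq_bigr => z _; rewrite /term mulrBl [X in _ = X - _]mulrBr.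
have cE x : x \in E -> tcol mu x = c by move/(subsetP Ec); rewrite inE => /eqP.
have cF x : x \in F -> tcol mu x = c' by move/(subsetP Fc); rewrite inE => /eqP.
have cEF x : x \in E :|: F -> (c <= tcol mu x <= c')%N.
  by case/setUP => [/cE|/cF] ->; rewrite leqnn ?(ltnW cc').
have tV x : x \in E :|: F -> t^-1%g x \in E :|: F.
  by move=> xEF; rewrite -(perm_closed _ tEF) permKV.
have term_ge0 z : 0 <= term z.
  rewrite /term; case: (boolP (z \in E :|: F)) => zEF; last first.
    have -> : t^-1%g z = z by rewrite -{1}(out_perm tEF zEF) permK.
    by rewrite subrr mulr0.
  have /andP[lo hi] := cEF _ (tV _ zEF); case/setUP: zEF => [zE|zF].
    by apply: mulr_ge0; rewrite subr_ge0 lez_nat ?Ea // (cE _ zE).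
  by apply: mulr_le0; rewrite subr_le0 lez_nat ?Fa // (cF _ zF).
split; first by rewrite -subr_ge0 diff sumr_ge0.
move=> e z zm; have /eqP := diff; rewrite e subrr eq_sym psumr_eq0 // => /allP/(_ z).
rewrite mem_index_enum => /(_ isT) /=; rewrite /term mulf_eq0 !subr_eq0 !eqz_nat.
by rewrite (negbTE zm) orbF => /eqP.
Qed.

(* Take a filling maximizing the potential among those with psi f != 0.  In each
   of the first k+1 columns at most m letters are even, so two of these columns
   violate strict increase of odd ranks, and a Garnir relation contradicts
   maximality. *)
Lemma contains_rect_psi f : contains_rect m.+1 k.+1 mu -> psi f = 0.
Proof.
move=> rect; apply/eqP; apply: contraT => nz.
pose f0 := [arg max_(f' > f | psi f' != 0) potential f']%O.
have [nz0 max0] : psi f0 != 0 /\ (forall f', psi f' != 0 -> potential f' <= potential f0).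
  by rewrite /f0; case: arg_maxP.
(* For each column, the level [a c] found below is the rank at which the count of lower-ranked
   letters is about to exceed [m]. *)
pose u c r := #|[set x in column c | (lrank (f0 x) < r)%N]|.
have u_mono c r r' : (r <= r')%N -> (u c r <= u c r')%N.
  move=> rr'; apply: subset_leq_card; apply/subsetP => x; rewrite !inE => /andP[-> lt].
  exact: leq_trans lt rr'.
have cross c : exists a, (c <= k)%N -> [/\ (0 < a <= k)%N, (u c a <= m)%N & (m < u c a.+1)%N].
  case: (leqP c k) => [ck|]; last by exists 0%N.
  (* Below rank 1 a column holds only even letters, which are distinct, hence at most [m] of them;
     up to rank [k] it holds all its letters, and the rectangle provides [m + 1] boxes. *)
  have [||a Pa] := @first_crossing (u c) m k; last by exists a.
    pose S := [set x in column c | (lrank (f0 x) < 1)%N].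
    have Sx x : x \in S -> tcol mu x = c /\ ~~ par (f0 x).
      by rewrite !inE /lrank => /andP[/eqP]; case: (par _).
    have fI : {in S &, injective f0}.
      move=> x y xS yS fxy; apply/eqP; apply: contraT => nxy.
      have [cx px] := Sx x xS; have [cy py] := Sx y yS.
      by have := psi_even_column nz0 nxy (etrans cx (esym cy)) px; rewrite fxy eqxx.
    rewrite /u -/S -(card_in_imset fI); apply: subset_leq_card.
    by apply/subsetP => _ /imsetP[x xS ->]; rewrite inE (Sx x xS).2.
  have /fin_all_exists[h hP] : forall i : 'I_m.+1, exists x : 'I_N, trow mu x = i /\ tcol mu x = c.
    by move=> i; apply: tbox_ex => //; apply: leq_trans (rect i (ltn_ord i)).
  rewrite -[X in (X <= _)%N]card_ord -(card_imset (f := h)); last first.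
    by move=> i j /(congr1 (trow mu)); rewrite (hP i).1 (hP j).1 => /val_inj.
  apply: subset_leq_card; apply/subsetP => _ /imsetP[i _ ->].
  by rewrite !inE (hP i).2 eqxx ltnS lrank_le.
have [a aP] : exists a : nat -> nat, forall c, (c <= k)%N ->
    [/\ (0 < a c <= k)%N, (u c (a c) <= m)%N & (m < u c (a c).+1)%N].
  have /fin_all_exists[a aP] : forall c : 'I_k.+1, exists a,
    [/\ (0 < a <= k)%N, (u c a <= m)%N & (m < u c a.+1)%N].
    by move=> c; have [a aP] := cross c; exists a; apply: aP; rewrite -ltnS.
  by exists (fun c => a (inord c)) => c ck; have := aP (inord c); rewrite inordK.
have [c [c' [cc' c'k ac]]] : exists c c', [/\ (c < c')%N, (c' <= k)%N & (a c' <= a c)%N].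
  by apply: not_increasing => c ck; case: (aP c ck).
have [/andP[a0 _] uca _] := aP c (leq_trans (ltnW cc') c'k).
have [_ _ uca'] := aP c' c'k.
(* [E] omits at most [m] boxes of column [c], while [F] has more than [m] boxes because
   [a c' <= a c]. Together they outnumber column [c], as the Garnir relation requires. *)
pose E := [set x in column c | (a c <= lrank (f0 x))%N].
pose F := [set x in column c' | (lrank (f0 x) <= a c)%N].
have Ec : E \subset column c by apply/subsetP => x; rewrite !inE => /andP[].
have Fc : F \subset column c' by apply/subsetP => x; rewrite !inE => /andP[].
have dEF : [disjoint E & F].
  rewrite disjoint_subset; apply/subsetP => x; rewrite !inE => /andP[/eqP -> _].
  by rewrite negb_and (ltn_eqF cc').
have cardZ : (#|column c| < #|E :|: F|)%N.
  rewrite cardsU disjoint_setI0 // cards0 subn0.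
  have -> : #|column c| = (u c (a c) + #|E|)%N.
    rewrite -(cardsID [set x | (lrank (f0 x) < a c)%N]); congr (_ + _)%N.
      by apply: eq_card => x; rewrite !inE.
    by apply: eq_card => x; rewrite !inE -leqNgt andbC.
  rewrite addnC ltn_add2l; apply: leq_ltn_trans uca _; apply: leq_trans uca' _.
  exact: (u_mono c' (a c').+1 (a c).+1).
have Zc : {in E :|: F, forall x, (tcol mu x == c) || (tcol mu x == c')}.
  by move=> x; case/setUP => [/(subsetP Ec)|/(subsetP Fc)]; rewrite inE => ->; rewrite ?orbT.
have := congr1 (fun y => act par y (dform C f0)) (garnir cc' Zc cardZ).
rewrite actM act0l act_suml act_sumr.
(* A term that keeps the potential equals [psi f0]; any other would raise it above the maximum and
   is therefore zero. The identity is of the first kind, so a positive multiple of [psi f0]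
   vanishes. *)
rewrite (eq_bigr (fun t => (if potential f0 == potential (fcomp f0 t) then 1 else 0) *: psi f0));
  last first.
  move=> t tEF; rewrite actZl act_gbase actZr.
  have [le eqa] := potential_garnir (a := a c) cc' Ec Fc tEF
    (fun x xE => proj2 (andP (etrans (esym (in_set _ _)) xE)))
    (fun x xE => proj2 (andP (etrans (esym (in_set _ _)) xE))).
  case: eqP => [/eqa ta|ne].
    by rewrite (garnir_term _ a0 Ec Fc tEF ta) ?scale1r // (ltn_eqF cc').
  rewrite pact_dform actZr -/(psi (fcomp f0 t)) scale0r.
  suff -> : psi (fcomp f0 t) = 0 by rewrite !scaler0.
  apply/eqP; apply: contraT => /max0 ge; case: ne.
  by apply/eqP; rewrite eq_le le ge.
rewrite -scaler_suml => /eqP; rewrite scaler_eq0 (negbTE nz0) orbF -big_mkcondr sumr_const.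
rewrite pnatr_eq0 => /eqP/eqP/pred0P/(_ 1%g); rewrite inE perm_on1 /=.
by rewrite (_ : fcomp f0 1 = f0) ?eqxx // fcomp1.
Qed.

Definition act_kernel (y : CSym C N) : Prop := forall F : form C N X, act par y F = 0.

Lemma act_kernel_dform y : (forall f, act par y (dform C f) = 0) -> act_kernel y.
Proof.
move=> y0 F; rewrite [F]form_sum act_sumr big1 // => f _.
by rewrite actZr y0 scaler0.
Qed.

Lemma ysym_kernel : contains_rect m.+1 k.+1 mu -> act_kernel ysym.
Proof. by move=> rect; apply: act_kernel_dform => f; apply: contains_rect_psi. Qed.

Lemma ysym_kernel_rect : act_kernel ysym -> contains_rect m.+1 k.+1 mu.
Proof.
move=> ker; have lt : (k < nth 0%N mu m)%N.
  rewrite ltnNge; apply/negP => /hook_filling_neq0[f].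
  by rewrite ker ffunE eqxx.
move=> i im.
have geq_tr : transitive geq by move=> a b c ba ac; exact: leq_trans ac ba.
have srt : sorted geq mu by case/and3P: pmu.
have ms : (m < size mu)%N by rewrite ltnNge; apply: contraTN lt => /(nth_default 0%N) ->.
apply: leq_trans lt _; apply: (sorted_leq_nth geq_tr leqnn 0%N srt) => //.
by rewrite inE (leq_ltn_trans _ ms).
Qed.

End HookTheorem.

(** * The kernel as a sum of ideals *)

Section Kernel.
Variables (C : numFieldType) (N : nat) (X : finType) (par : X -> bool).
Notation m := #|[pred x | ~~ par x]|.
Notation k := #|[pred x | par x]|.
Implicit Types (x y : CSym C N).

Lemma act_kernelMl x y : act_kernel par y -> act_kernel par (x * y).
Proof. by move=> ky F; rewrite actM ky act0r. Qed.

Lemma act_kernelMr x y : act_kernel par x -> act_kernel par (x * y).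
Proof. by move=> kx F; rewrite actM kx. Qed.

Lemma young_ideal_kernel mu x : is_partition N mu -> contains_rect m.+1 k.+1 mu ->
  x \in young_ideal C N mu -> act_kernel par x.
Proof.
move=> pmu rect; apply: young_ideal_ind x => [F|a x y kx ky F|g h].
- exact: act0l.
- by rewrite actDl actZl kx ky scaler0 addr0.
- exact/act_kernelMr/act_kernelMl/ysym_kernel.
Qed.

(** With [c] the Young symmetrizer, the unit [e] on both sides provides [g] and [h] with [c g x h c]
    nonzero. This lies in the kernel and is a multiple of [c], so [c] itself kills all forms. *)
Lemma young_ideal_unit mu x e : is_partition N mu -> e \in young_ideal C N mu ->
  e * x = x -> x * e = x -> act_kernel par x -> x != 0 -> contains_rect m.+1 k.+1 mu.
Proof.
move=> pmu eI ex xe kx nz; have /and3P[_ _ /eqP muN] := pmu.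
pose c := young_symmetrizer C N mu.
have [g ng] : exists g, c * gbase C g * x != 0.
  apply/existsP; apply: contraNT nz; rewrite negb_exists => /forallP all0.
  rewrite -ex; apply: (young_ideal_ind (Q := fun e => e * x == 0)) eI => [|a y z y0 z0|g h].
  - by rewrite mul0r.
  - by rewrite mulrDl -scalerAl (eqP y0) (eqP z0) scaler0 addr0.
  - by have /negbNE/eqP := all0 h; rewrite -!mulrA => ->; rewrite mulr0.
have [h nh] : exists h, c * gbase C g * x * gbase C h * c != 0.
  apply/existsP; apply: contraNT ng; rewrite negb_exists => /forallP all0.
  rewrite -xe; apply: (young_ideal_ind (Q := fun e => _ * (x * e) == 0)) eI =>
    [|a y z y0 z0|h g'].
  - by rewrite !mulr0.
  - by rewrite !mulrDr -!scalerAr (eqP y0) (eqP z0) scaler0 addr0.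
  - by have /negbNE/eqP := all0 h; rewrite !mulrA => ->; rewrite mul0r.
have [a ea] := ysym_sandwich (gbase C g * x * gbase C h) muN.
have a0 : a != 0.
  apply: contraNneq nh => a0; move: ea; rewrite a0 scale0r => ea.
  by rewrite -[X in _ == X]ea !mulrA.
have kc : act_kernel par c.
  move=> F; rewrite -[c](scalerK a0) -ea actZl.
  rewrite (_ : act _ _ _ = 0) ?scaler0 //.
  by apply: act_kernelMr; apply: act_kernelMl; apply: act_kernelMr; apply: act_kernelMl.
exact: (ysym_kernel_rect pmu kc).
Qed.

(** The decomposition of 1 splits [y] into the components [y * e mu], which stay in the kernel. By
    orthogonality [e mu] is a unit on its component, so every nonzero component reveals the
    rectangle in [mu]. *)
Theorem act_kernelP (y : CSym C N) : act_kernel par y <->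
  exists2 r : seq (seq nat * CSym C N),
    (forall t, t \in r -> [/\ is_partition N t.1, contains_rect m.+1 k.+1 t.1 &
                            t.2 \in young_ideal C N t.1]) &
    y = \sum_(t <- r) t.2.
Proof.
split=> [ky|[r rP ->] F]; last first.
  rewrite act_suml big_seq big1 // => t /rP[pt rt yt].
  exact: (young_ideal_kernel pt rt yt).
have [P /andP[uP /allP Pp] [e eI one]] := one_in_young_ideals C N.
have ortho mu nu z : mu \in P -> nu \in P -> nu != mu -> e nu * (z * e mu) = 0.
  move=> /Pp pm /Pp pn nmn; apply: (young_ideal_orthogonal pn pm nmn) => //.
  exact: young_idealMl.
have absorb mu z : mu \in P -> e mu * (z * e mu) = z * e mu.
  move=> muP; rewrite -[RHS]mul1r one mulr_suml (bigD1_seq mu) //= big_seq_cond.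
  by rewrite big1 ?addr0 // => nu /andP[nuP nmn]; apply: ortho.
exists [seq (mu, y * e mu) | mu <- P & y * e mu != 0]; last first.
  rewrite big_map big_filter big_mkcond -{1}[y]mulr1 one mulr_sumr; apply: eq_bigr => mu _.
  by case: eqP.
move=> t /mapP[mu]; rewrite mem_filter => /andP[nz muP] -> /=.
split; [exact: Pp | | exact: young_idealMl].
apply: (young_ideal_unit (Pp _ muP) (eI mu) (absorb _ _ muP) _ _ nz).
  by rewrite -mulrA -{2}[e mu]mul1r absorb // mul1r.
exact: act_kernelMr.
Qed.

End Kernel.

(** * The invariant multilinear form of a matching *)

Lemma big_addb_uniq (I : finType) (r : seq I) (F : I -> bool) : uniq r ->
  (forall x, x \notin r -> F x = false) ->
  \big[addb/false]_x F x = \big[addb/false]_(x <- r) F x.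
Proof.
move=> ur F0; rewrite (bigID (mem r)) /= [X in _ (+) X]big1 // addbF.
by rewrite big_uniq.
Qed.

Section MatchingForm.
Variables (C : numFieldType) (N : nat) (X : finType) (par : X -> bool) (G : X -> X -> C).
Hypothesis G_even : forall a b, par a != par b -> G a b = 0.
Hypothesis G_sym : forall a b, G a b = (-1) ^+ (par a && par b) * G b a.

Implicit Types (u : 'I_N -> 'I_N) (p : 'I_N -> bool) (B : {pred 'I_N}) (f : {ffun 'I_N -> X}).

(** The ends of two arcs interlace, and [x], [y] are the left ends in order, so each crossing is
    counted once. *)
Definition crosses u (x y : 'I_N) : bool := [&& x < y, y < u x & u x < u y]%N.

Definition cross u p : bool :=
  \big[addb/false]_(xy : 'I_N * 'I_N) (crosses u xy.1 xy.2 && (p xy.1 && p xy.2)).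

Definition arcs u f : C := \prod_(x : 'I_N | (x < u x)%N) G (f x) (f (u x)).

(** Bringing the two ends of each arc together costs a sign for every crossing of odd arcs. The
    parity is read at left ends, since [G] vanishes on ends of different parity. *)
Definition wform u : form C N X := [ffun f : {ffun 'I_N -> X} => (-1) ^+ cross u (par \o f) * arcs u f].

Lemma wformE u f : wform u f = (-1) ^+ cross u (par \o f) * arcs u f.
Proof. by rewrite ffunE. Qed.

Lemma eq_wform u u' : u =1 u' -> wform u = wform u'.
Proof.
move=> uu'; apply/ffunP => f; rewrite !ffunE; congr (_ ^+ nat_of_bool _ * _).
  by apply: eq_bigr => xy _; rewrite /crosses !uu'.
by apply: eq_big => x; rewrite uu'.
Qed.

Lemma arcs_even u f : involutive u -> arcs u f != 0 ->
  (forall x, u x != x) -> forall x, par (f (u x)) = par (f x).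
Proof.
move=> uK nz ux; suff E (x : 'I_N) : (x < u x)%N -> par (f (u x)) = par (f x).
  move=> x; case: (ltngtP x (u x)) => [/E //|lt|/val_inj e]; last by have := ux x; rewrite -e eqxx.
  by have := E (u x); rewrite uK => ->.
move=> lt; apply/eqP; rewrite eq_sym; apply: contraNT nz => np.
by rewrite /arcs (bigD1 x) //= G_even // mul0r.
Qed.

Lemma val_lt_tperm (i j x y : 'I_N) : j = i.+1 :> nat -> x != y ->
  ~~ ((x == i) && (y == j)) -> ~~ ((x == j) && (y == i)) ->
  (tperm i j x < tperm i j y)%N = (x < y)%N.
Proof.
move=> ij; rewrite !val_tperm_adj // -!val_eqE /= ij.
case: (nat_of_ord x =P i) => ? /=; case: (nat_of_ord y =P i) => ? /=;
  case: (nat_of_ord x =P i.+1) => ? /=; case: (nat_of_ord y =P i.+1) => ? /=; lia.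
Qed.

(** Exchanging neighbouring ends of two different arcs alters the order of no other ends, so only
    these two arcs gain or lose a crossing. *)
Lemma cross_tperm u (i j : 'I_N) p : j = i.+1 :> nat -> involutive u ->
  (forall x, u x != x) -> u i != j -> (forall x, p (u x) = p x) ->
  \big[addb/false]_(xy : 'I_N * 'I_N)
    ([&& tperm i j xy.1 < tperm i j xy.2, tperm i j xy.2 < tperm i j (u xy.1) &
         tperm i j (u xy.1) < tperm i j (u xy.2)]%N && (p xy.1 && p xy.2)) =
  cross u p (+) (p i && p j).
Proof.
move=> ij uK ux uij pu; rewrite -[LHS](addKb (cross u p)); congr (_ (+) _).
rewrite /cross -big_split /=.
set s := tperm i j; set a := u i; set b := u j.
have nij : i != j by rewrite -val_eqE /= ij neq_ltn ltnSn.
have ai : a != i by exact: ux.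
have bj : b != j by exact: ux.
have aj : a != j by [].
have bi : b != i by rewrite -(inj_eq (inv_inj uK)) uK eq_sym.
have ab : a != b by rewrite (inj_eq (inv_inj uK)).
have ua : u a = i by exact: uK.
have ub : u b = j by exact: uK.
(* The eight pairs consist of one end of the arc at [i] and one end of the arc at [j], in either
   order. *)
rewrite (big_addb_uniq (r := [:: (i, j); (i, b); (a, j); (a, b); (j, i); (b, i); (j, a); (b, a)])).
- rewrite !big_cons big_nil /= /crosses -/a -/b ua ub.
  have -> : p a = p i by exact: pu.
  have -> : p b = p j by exact: pu.
  rewrite !val_tperm_adj //; move: ai bj aj bi ab; rewrite -!val_eqE /= !ij eqxx => ai bj aj bi ab.
  rewrite (negbTE ai) (negbTE bj) (negbTE aj) (negbTE bi).
  have -> : (i.+1 == i :> nat) = false by apply/eqP; lia.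
  rewrite eqxx.
  case: (p i); case: (p j); rewrite ?andbF ?andbT //=.
  move: (nat_of_ord i) (nat_of_ord a) (nat_of_ord b) ai bj aj bi ab => I A B ai bj aj bi ab.
  have [Ai|Ai] := ltnP A I; have [Bi|Bi] := ltnP B I; have [AB|AB] := ltnP A B; try lia.
- by rewrite /= !inE !xpair_eqE !(eq_sym j i) !(eq_sym i a) !(eq_sym i b) !(eq_sym j a)
    !(eq_sym j b) !(eq_sym b a) (negbTE nij) (negbTE ai) (negbTE bi) (negbTE aj) (negbTE bj)
    (negbTE ab) !andbF.
move=> [x y]; rewrite !inE !xpair_eqE /= => nin.
case: (p x); case: (p y); rewrite ?andbF //= !andbT /crosses; apply/negbTE.
rewrite negb_add; apply/eqP.
have ux_eq z w : (u z == w) = (z == u w).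
  by apply/eqP/eqP => [<-|->]; rewrite uK.
have [->|nxy] := eqVneq x y; first by rewrite !ltnn.
have [->|nyx] := eqVneq y (u x); first by rewrite uK !ltnn !andbF.
by rewrite !val_lt_tperm ?(inj_eq (inv_inj uK)) ?ux_eq ?uK -/a -/b //;
  apply: contra nin => /andP[/eqP -> /eqP ->]; rewrite !eqxx ?orbT.
Qed.

Lemma tperm_arc u (i j : 'I_N) : involutive u -> u i = j -> forall x,
  tperm i j (u (tperm i j x)) = u x.
Proof.
move=> uK uij x; have uji : u j = i by rewrite -uij uK.
case: (eqVneq x i) => [->|xi]; first by rewrite tpermL uji tpermL uij.
case: (eqVneq x j) => [->|xj]; first by rewrite tpermR uij tpermR uji.
rewrite [tperm i j x]tpermD 1?eq_sym // tpermD // eq_sym.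
  by rewrite -uji (inj_eq (inv_inj uK)).
by rewrite -uij (inj_eq (inv_inj uK)).
Qed.

(** If [i] and [j] are joined, the sign is the supersymmetry of [G]; otherwise it is that of the
    crossing created or removed. *)
Lemma wform_tperm u (i j : 'I_N) : j = i.+1 :> nat -> involutive u ->
  (forall x, u x != x) ->
  wform (fun x => tperm i j (u (tperm i j x))) = pact par (tperm i j) (wform u).
Proof.
move=> ij uK ux; set s := tperm i j; apply/ffunP => f.
rewrite [RHS]ffunE tpermV /psign inv_par_adj //= -/s.
have sK : involutive s by exact: tpermK.
have nij : i != j by rewrite -val_eqE /= ij neq_ltn ltnSn.
case: (eqVneq (u i) j) => [uij|nuij].
  have uji : u j = i by rewrite -uij uK.
  rewrite (eq_wform (u' := u)); last exact: tperm_arc.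
  have arcE g : arcs u g = G (g i) (g j) * \prod_(x : 'I_N | (x < u x)%N && (x != i)) G (g x) (g (u x)).
    by rewrite /arcs (bigD1 i) /= ?uij ?ij.
  have rest : \prod_(x : 'I_N | (x < u x)%N && (x != i)) G (fcomp f s x) (fcomp f s (u x)) =
              \prod_(x : 'I_N | (x < u x)%N && (x != i)) G (f x) (f (u x)).
    apply: eq_bigr => x /andP[lt xi]; rewrite !ffunE.
    have xj : x != j by apply: contraTneq lt => ->; rewrite uji ij -leqNgt leqnSn.
    rewrite !tpermD //; try by rewrite eq_sym.
      by rewrite -(inj_eq (inv_inj uK)) uij uK eq_sym.
    by rewrite -(inj_eq (inv_inj uK)) uji uK eq_sym.
  rewrite !wformE !arcE rest !ffunE tpermL tpermR.
  case: (eqVneq (par (f i)) (par (f j))) => [pij|npij]; last first.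
    by rewrite !G_even ?mul0r ?mulr0 // eq_sym.
  rewrite (_ : cross u (par \o fcomp f s) = cross u (par \o f)); last first.
    apply: eq_bigr => xy _ /=; congr (_ && (_ && _)); rewrite ffunE;
    by case: tpermP => [->|->|].
  by rewrite G_sym !mulrA; congr (_ * _ * _); rewrite mulrC.
rewrite !wformE.
have arcE : arcs (fun x => s (u (s x))) f = arcs u (fcomp f s).
  rewrite /arcs (reindex_inj (@perm_inj _ s)); apply: eq_big => [y|y _]; rewrite ?sK ?ffunE //.
  rewrite val_lt_tperm //; first by rewrite eq_sym.
    by apply: contra nuij => /andP[/eqP -> /eqP ->].
  by apply: contra nuij => /andP[/eqP <- /eqP <-]; rewrite uK.
have [e0|nz] := eqVneq (arcs u (fcomp f s)) 0; first by rewrite arcE e0 !mulr0.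
rewrite arcE mulrA; congr (_ * _).
have pE x : par (fcomp f s (u x)) = par (fcomp f s x) by exact: arcs_even nz _ _.
have := cross_tperm ij uK ux nuij (p := par \o fcomp f s) pE.
rewrite /= !ffunE tpermL tpermR => e.
rewrite -signr_addb addbC [par (f i) && _]andbC -e; congr (_ ^+ nat_of_bool _).
rewrite /cross (reindex_inj (h := fun xy : 'I_N * 'I_N => (s xy.1, s xy.2))) /=; last first.
  by move=> [a b] [c e'] /= [] /perm_inj -> /perm_inj ->.
by apply: eq_bigr => xy _; rewrite /crosses /= !sK !ffunE.
Qed.

Lemma wform_conj (s : 'S_N) u : involutive u -> (forall x, u x != x) ->
  wform (fun x => s^-1%g (u (s x))) = pact par s (wform u).
Proof.
move: s; apply: perm_adj_ind => [|s i j ij IH] uK ux.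
  by rewrite pact1; apply: eq_wform => x; rewrite invg1 !perm1.
rewrite pactM -IH // -wform_tperm //.
- by apply: eq_wform => x; rewrite invMg tpermV !permM.
- by move=> x; rewrite permKV uK permK.
- move=> x; apply: contraNneq (ux (s x)) => e.
  by apply/eqP/(@perm_inj _ s^-1%g); rewrite e permK.
Qed.

Definition wpart (B : {pred 'I_N}) u f : C :=
  (-1) ^+ (\big[addb/false]_(xy : 'I_N * 'I_N | (xy.1 \in B) && (xy.2 \in B))
            (crosses u xy.1 xy.2 && (par (f xy.1) && par (f xy.2)))) *
  \prod_(x : 'I_N | (x \in B) && (x < u x)%N) G (f x) (f (u x)).

Lemma eq_wpart B u u' f f' : {in B, u =1 u'} -> {in B, forall x, u x \in B} ->
  {in B, f =1 f'} -> wpart B u f = wpart B u' f'.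
Proof.
move=> uu' uB ff'; rewrite /wpart; congr (_ ^+ nat_of_bool _ * _).
  by apply: eq_bigr => xy /andP[xB yB]; rewrite /crosses !uu' // !ff'.
apply: eq_big => x; first by case: (boolP (x \in B)) => // xB; rewrite uu'.
by move=> /andP[xB _]; rewrite uu' // !ff' // -uu' // uB.
Qed.

(* Arcs inside an interval of positions do not cross the other arcs. *)
Lemma wform_split B u f : involutive u -> {in B, forall x, u x \in B} ->
  (forall x y z : 'I_N, x \in B -> z \in B -> (x <= y <= z)%N -> y \in B) ->
  wform u f = wpart B u f * wpart [predC B] u f.
Proof.
move=> uK uB Bint; rewrite wformE mulrACA -signr_addb.
have uB' x : (u x \in B) = (x \in B) by apply/idP/idP => /uB //; rewrite uK.
congr (_ ^+ nat_of_bool _ * _); last first.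
  rewrite /arcs (bigID (mem B)) /=; congr (_ * _); apply: eq_bigl => x;
  by rewrite ?inE andbC.
rewrite /cross (bigID (fun xy : 'I_N * 'I_N => (xy.1 \in B) && (xy.2 \in B))) /=.
congr (_ (+) _); rewrite [LHS](bigID (fun xy : 'I_N * 'I_N => (xy.1 \notin B) && (xy.2 \notin B))) /=.
rewrite [X in _ (+) X]big1 ?addbF => [|[x y] /=].
  apply: eq_bigl => xy; rewrite !inE.
  by case: (xy.1 \in B); case: (xy.2 \in B).
rewrite /crosses; case xB: (x \in B); case yB: (y \in B) => //= _;
apply/negbTE; apply/negP => /andP[/and3P[xy yux uxy] _].
  by move: yB; rewrite (Bint x y (u x)) ?uB' ?xB // (ltnW xy) (ltnW yux).
by move: xB; rewrite -uB' (Bint y (u x) (u y)) ?uB' ?yB // (ltnW yux) (ltnW uxy).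
Qed.

End MatchingForm.

(** * The form of D0 generates all forms *)

Section SlotOperators.
Variables (C : numFieldType) (N : nat) (X : finType) (par : X -> bool).
Implicit Types (F : form C N X) (f : {ffun 'I_N -> X}) (i : 'I_N) (a b : X).

Definition upd1 f i a : {ffun 'I_N -> X} := [ffun l => if l == i then a else f l].

(* A matrix unit acting in slot i, with the sign for moving it past the slots
   on its left *)
Definition slot a b i F : form C N X :=
  [ffun f : {ffun 'I_N -> X} =>
    (-1) ^+ ((par a (+) par b) && \big[addb/false]_(l : 'I_N) ((l < i)%N && par (f l))) *
    ((f i == b)%:R * F (upd1 f i a))].

Definition gl_act a b F : form C N X := \sum_i slot a b i F.

(** The letters on the left of the slot change exactly by those that [g] swaps with [i]. The same
    count is the change of the permutation sign when letter [i] changes parity, by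
    [inv_par_flip]. *)
Lemma slot_pact a b i (g : 'S_N) F : pact par g (slot a b (g i) F) = slot a b i (pact par g F).
Proof.
apply/ffunP => f; rewrite !ffunE permK.
case: eqP => [fi|_]; last by rewrite !mul0r !mulr0.
rewrite !mul1r !mulrA.
have -> : upd1 (fcomp f g^-1) (g i) a = fcomp (upd1 f i a) g^-1.
  by apply/ffunP => l; rewrite !ffunE (can2_eq (permKV g) (permK g)).
congr (_ * _); rewrite /psign -!signr_addb; congr (_ ^+ nat_of_bool _).
have -> : inv_par g (par \o upd1 f i a) = inv_par g (par \o f) (+)
   ((par a (+) par b) && \big[addb/false]_l (swaps g l i && par (f l))).
  rewrite -inv_par_flip; apply: eq_inv_par => l; rewrite /= ffunE.
  by case: eqP => [->|_]; rewrite ?andbF ?addbF // fi; case: (par a); case: (par b).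
rewrite [RHS]addbCA; congr (_ (+) _).
case: (par a (+) par b) => //=.
rewrite (reindex_inj (@perm_inj _ g)) /= -big_split /=.
by apply: eq_bigr => l _; rewrite ffunE permK /swaps; do 2 case: (_ < _)%N; case: (par _).
Qed.

Lemma slotZ a b i (c : C) F : slot a b i (c *: F) = c *: slot a b i F.
Proof.
by apply/ffunP => f; rewrite !ffunE /GRing.scale /= [RHS]mulrCA [in RHS](mulrCA c).
Qed.

Lemma slotD a b i F F' : slot a b i (F + F') = slot a b i F + slot a b i F'.
Proof. by apply/ffunP => f; rewrite !ffunE !mulrDr. Qed.

Lemma slot0 a b i : slot a b i 0 = 0.
Proof. by apply/ffunP => f; rewrite !ffunE !mulr0. Qed.

Lemma gl_act_pact a b (g : 'S_N) F : pact par g (gl_act a b F) = gl_act a b (pact par g F).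
Proof.
rewrite pact_sum (reindex_inj (@perm_inj _ g)).
by apply: eq_bigr => i _; rewrite slot_pact.
Qed.

Lemma gl_act_act a b (y : CSym C N) F : act par y (gl_act a b F) = gl_act a b (act par y F).
Proof.
rewrite /act; under eq_bigr => g _ do rewrite gl_act_pact scaler_sumr.
rewrite exchange_big; apply: eq_bigr => i _.
rewrite (big_morph (slot a b i) (slotD a b i) (slot0 a b i)).
by apply: eq_bigr => g _; rewrite slotZ.
Qed.

End SlotOperators.

Section Generation.
Variables (C : numFieldType) (d : nat) (X : finType) (par : X -> bool).
Variables (G Gi : X -> X -> C).
Hypothesis G_even : forall a b, par a != par b -> G a b = 0.
Hypothesis G_sym : forall a b, G a b = (-1) ^+ (par a && par b) * G b a.
Hypothesis GiG : forall a c, \sum_b Gi a b * G b c = (a == c)%:R.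

Notation N := (d + d)%N.
Notation letters := {ffun 'I_N -> X}.
Implicit Types (f : letters) (A : letters -> C) (y : CSym C N).

Definition u0 (x : 'I_N) : 'I_N := Ordinal (D0_nat_lt x).
Arguments u0 : simpl never.

Lemma u0K : involutive u0.
Proof. by move=> x; apply: val_inj; apply: D0_natK. Qed.

Lemma u0_neq x : u0 x != x.
Proof. by rewrite /u0 -val_eqE /= D0_nat_neq. Qed.

Lemma u0_lt (x : 'I_N) : (x < u0 x)%N = ~~ odd x.
Proof. by rewrite /u0 /= /D0_nat; case: odd; case: (nat_of_ord x) => //= l; rewrite ?ltnn; lia. Qed.

Lemma u0_even (x : 'I_N) : ~~ odd x -> u0 x = x.+1 :> nat.
Proof. by rewrite /u0 /= /D0_nat => /negbTE ->. Qed.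

Lemma u0_ge k (x : 'I_N) : (k + k <= u0 x)%N = (k + k <= x)%N.
Proof. by rewrite /u0 /= /D0_nat; case: (boolP (odd x)); case: (nat_of_ord x) => //= l; lia. Qed.

Definition tail k f : C :=
  \prod_(x : 'I_N | (k + k <= x)%N && (x < u0 x)%N) G (f x) (f (u0 x)).

Definition head_fun k A := forall f f', (forall x : 'I_N, (x < k + k)%N -> f x = f' x) -> A f = A f'.

(** Arbitrary in the first [k] pairs and contracting the others: a multiple of the form of [D0] for
    [k = 0], any form for [k = d]. The pairs of [D0] do not cross, so no sign appears. *)
Definition tform k A : form C N X := [ffun f : letters => A f * tail k f].

Lemma tail_even k f : tail k f != 0 -> forall x : 'I_N, (k + k <= x)%N -> par (f (u0 x)) = par (f x).
Proof.
move=> nz; suff E (x : 'I_N) : (x < u0 x)%N -> (k + k <= x)%N -> par (f (u0 x)) = par (f x).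
  move=> x kx; case: (ltngtP x (u0 x)) => [/E|lt|/val_inj e].
  - exact.
  - by have := E (u0 x); rewrite u0K lt u0_ge => ->.
  - by have := u0_neq x; rewrite -e eqxx.
move=> lt kx; apply/eqP; rewrite eq_sym; apply: contraNT nz => np.
by rewrite /tail (bigD1 x) ?kx //= G_even ?mul0r.
Qed.

Lemma head_fun_fcomp k A f (g : 'S_N) : head_fun k A -> (forall x : 'I_N, (x < k + k)%N -> g x = x) ->
  A (fcomp f g^-1) = A f.
Proof.
by move=> hA gx; apply: hA => x xk; rewrite ffunE -{1}(gx x xk) permK.
Qed.

Lemma pact_flip k A (x : 'I_N) : head_fun k A -> (k + k <= x)%N -> ~~ odd x ->
  pact par (tperm x (u0 x)) (tform k A) = tform k A.
Proof.
move=> hA kx ox; have ux := u0_even ox; apply/ffunP => f.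
rewrite !ffunE /psign inv_par_adj // (head_fun_fcomp f hA); last first.
  by move=> z zk; apply: tpermD; apply: contraTneq zk => <-; rewrite -leqNgt ?ux; lia.
rewrite mulrCA; congr (_ * _).
have tE g : tail k g = G (g x) (g (u0 x)) *
    \prod_(z : 'I_N | ((k + k <= z)%N && (z < u0 z)%N) && (z != x)) G (g z) (g (u0 z)).
  by rewrite /tail (bigD1 x) //= kx u0_lt.
rewrite !tE !ffunE tpermV tpermL tpermR [G (f x) _]G_sym mulrA; congr (_ * _ * _).
apply: eq_bigr => z /andP[/andP[kz zu] zx]; rewrite !ffunE.
have zux : z != u0 x by apply: contraTneq zu => ->; rewrite u0K -leqNgt ltnW // u0_lt.
rewrite !tpermD //; try by rewrite eq_sym.
  by rewrite -(inj_eq (inv_inj u0K)) u0K eq_sym.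
by rewrite (inj_eq (inv_inj u0K)) eq_sym.
Qed.

Section BlockSwap.
Variables (x z : 'I_N).
Hypotheses (ox : ~~ odd x) (xz : z = x.+2 :> nat).

Let oz : ~~ odd z. Proof. by rewrite xz /= negbK. Qed.
Let ux : u0 x = x.+1 :> nat. Proof. exact: u0_even. Qed.
Let uz : u0 z = x.+3 :> nat. Proof. by rewrite u0_even // xz. Qed.

Definition block_swap : 'S_N := (tperm x z * tperm (u0 x) (u0 z))%g.

Lemma val_block_swap v : block_swap v =
  (if v == x :> nat then x.+2 else if v == x.+1 :> nat then x.+3
   else if v == x.+2 :> nat then x : nat else if v == x.+3 :> nat then x.+1 else v) :> nat.
Proof.
have nq (i j : 'I_N) : (i : nat) <> j -> (i != j).
  by move=> ne; apply/eqP => e; apply: ne; rewrite e.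
rewrite permM; case: eqP => [/ord_inj ->|n0].
  by rewrite tpermL tpermD ?xz //; apply: nq; rewrite ?ux ?uz xz; lia.
case: eqP => [e|n1].
  have -> : v = u0 x by apply: ord_inj; rewrite e -ux.
  by rewrite [tperm x z _]tpermD; first (by rewrite tpermL); apply: nq; rewrite ux ?xz; lia.
case: eqP => [e|n2].
  have -> : v = z by apply: ord_inj; rewrite e -xz.
  by rewrite tpermR tpermD //; apply: nq; rewrite ?ux ?uz; lia.
case: eqP => [e|n3].
  have -> : v = u0 z by apply: ord_inj; rewrite e -uz.
  by rewrite [tperm x z _]tpermD; first (by rewrite tpermR); apply: nq; rewrite uz ?xz; lia.
by rewrite [tperm x z _]tpermD; first rewrite tpermD //; apply: nq; rewrite ?ux ?uz ?xz; lia.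
Qed.

Lemma block_swap_u0 v : block_swap (u0 v) = u0 (block_swap v).
Proof.
apply: val_inj; rewrite -[LHS]/(nat_of_ord _) -[RHS]/(D0_nat (block_swap v)).
rewrite !val_block_swap -[nat_of_ord (u0 v)]/(D0_nat v) /D0_nat.
have := odd_double_half x; have := odd_double_half v; rewrite (negbTE ox).
by case ov: (odd v) => /= ev ex; repeat (case: eqP => ? //); rewrite /= ?ov ?(negbTE ox) /=; lia.
Qed.

(** Each block is moved as a whole with its total parity. This parity is even wherever [G] does not
    vanish on the pair, so block swaps will fix the tail. *)
Lemma inv_par_block_swap (p : 'I_N -> bool) :
  inv_par block_swap p = (p x (+) p (u0 x)) && (p z (+) p (u0 z)).
Proof.
have key (v w : 'I_N) : (v < w)%N && swaps block_swap v w =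
    ((v == x) || (v == u0 x)) && ((w == z) || (w == u0 z)).
  have eqn (i j : 'I_N) : (i == j) = ((i : nat) == j) by [].
  rewrite /swaps !val_block_swap !eqn ux uz xz.
  by repeat (case: eqP => ? //=); lia.
rewrite /inv_par big_mkcond (eq_bigr (fun vw : 'I_N * 'I_N =>
  (((vw.1 == x) || (vw.1 == u0 x)) && ((vw.2 == z) || (vw.2 == u0 z))) &&
  (p vw.1 && p vw.2))); last first.
  by move=> vw _; rewrite -key; case: (_ < _)%N.
have xux : x != u0 x by rewrite eq_sym u0_neq.
have zuz : z != u0 z by rewrite eq_sym u0_neq.
rewrite (big_addb_uniq (r := [:: (x, z); (x, u0 z); (u0 x, z); (u0 x, u0 z)])).
- rewrite !big_cons big_nil /= !eqxx ?orbT /=.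
  by case: (p x); case: (p (u0 x)); case: (p z); case: (p (u0 z)).
- by rewrite /= !inE !xpair_eqE !eqxx (negbTE xux) (negbTE zuz) !andbF.
move=> [v w]; rewrite !inE !xpair_eqE /=.
by case: (v == x); case: (w == z); case: (v == u0 x); case: (w == u0 z).
Qed.

Lemma pact_block_swap k A : head_fun k A -> (k + k <= x)%N ->
  pact par block_swap (tform k A) = tform k A.
Proof.
move=> hA kx; apply/ffunP => f; rewrite !ffunE (head_fun_fcomp f hA); last first.
  move=> v vk; apply: ord_inj; rewrite val_block_swap.
  by repeat (case: eqP => ? //); lia.
have tE : tail k (fcomp f block_swap^-1) = tail k f.
  rewrite /tail (reindex_inj (@perm_inj _ block_swap)); apply: eq_big => v.
    rewrite -block_swap_u0 !val_block_swap -[nat_of_ord (u0 v)]/(D0_nat v) /D0_nat.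
    have := odd_double_half x; have := odd_double_half v; rewrite (negbTE ox).
    by case ov: (odd v) => /= ev ex; repeat (case: eqP => ? //); rewrite /= ?ov ?(negbTE ox) /=; lia.
  by rewrite !ffunE -block_swap_u0 !permK.
rewrite tE; have [->|nz] := eqVneq (tail k f) 0; first by rewrite !mulr0.
rewrite /psign inv_par_block_swap /= (tail_even nz) // addbb /= mul1r.
by [].
Qed.

End BlockSwap.

Lemma slot_head k A a b (i : 'I_N) : head_fun k A -> (i < k + k)%N ->
  exists2 A', head_fun k A' & slot par a b i (tform k A) = tform k A'.
Proof.
move=> hA ik.
exists (fun f => (-1) ^+ ((par a (+) par b) && \big[addb/false]_(l : 'I_N) ((l < i)%N && par (f l))) *
    ((f i == b)%:R * A (upd1 f i a))).
  move=> f f' ff'; rewrite ff' // (hA (upd1 f i a) (upd1 f' i a)); last first.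
    by move=> l lk; rewrite !ffunE ff'.
  congr ((-1) ^+ nat_of_bool (_ && _) * _); apply: eq_bigr => l _.
  by case: ltnP => //= li; rewrite ff' // (ltn_trans li).
apply/ffunP => f; rewrite !ffunE -!mulrA; congr (_ * (_ * (_ * _))).
apply: eq_bigr => x /andP[kx _]; rewrite !ffunE.
have -> : (x == i) = false by apply/eqP => e; move: ik; rewrite -e; lia.
by have -> : (u0 x == i) = false by apply/eqP => e; move: ik; rewrite -e ltnNge u0_ge kx.
Qed.

(* If y kills the form of D0, it kills the sum over all slots of a matrix unit
   applied to a form in which pairs k, k+1, ... carry G; by induction the slots
   below 2k contribute 0, and by symmetry all others contribute equally. *)
Lemma D0_form_generates y :
  (forall h : 'S_N, (forall x, h (u0 x) = u0 (h x)) -> y * gbase C h = y) ->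
  act par y (wform par G u0) = 0 -> forall F, act par y F = 0.
Proof.
move=> yH y0 F.
suff claim k : (k <= d)%N -> forall A, head_fun k A -> act par y (tform k A) = 0.
  have -> : F = tform d F.
    apply/ffunP => f; rewrite ffunE /tail big1 ?mulr1 // => x /andP[dx _].
    by have := ltn_ord x; rewrite ltnNge dx.
  by apply: claim => // f f' ff'; congr (F _); apply/ffunP => x; apply: ff'.
elim: k => [_|k IH kd] A hA.
  case: (pickP (fun f : letters => true)) => [f0 _|no]; last first.
    by rewrite (_ : tform 0 A = 0) ?act0r //; apply/ffunP => f; have := no f.
  have -> : tform 0 A = A f0 *: wform par G u0.
    apply/ffunP => f; rewrite !ffunE (hA f f0) //; congr (_ * _).
    rewrite [cross _ _](_ : _ = false) ?mul1r.
      by apply: eq_bigl => x.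
    rewrite /cross big1 // => -[x z] _ /=; apply/negbTE/negP => /andP[/and3P[xz zx _] _].
    have ox : ~~ odd x by rewrite -u0_lt (ltn_trans xz zx).
    by move: zx; rewrite (u0_even ox); lia.
  by rewrite actZr y0 scaler0.
have ltk : (k + k < d + d)%N by lia.
pose x : 'I_N := Ordinal ltk.
have ox : ~~ odd x by rewrite /= addnn odd_double.
have ux : u0 x = (k + k).+1 :> nat by exact: u0_even.
suff slot_kill a b B : head_fun k B -> act par y (slot par a b x (tform k B)) = 0.
  (* [Gi] undoes the contraction: summed over [a] against [G] it restores the letter of [f] at
     [u0 x], and the sign cancels the one in [slot]. Both letters of the pair are overwritten, so
     [A1 a b] depends on the first [2k] letters only. *)
  pose A1 a b f := (-1) ^+ ((par a (+) par b) && \big[addb/false]_(l : 'I_N) ((l < x)%N && par (f l)))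
    * \sum_c Gi c a * A (upd1 (upd1 f x b) (u0 x) c).
  have -> : tform k.+1 A = \sum_b \sum_a slot par a b x (tform k (A1 a b)).
    apply/ffunP => f; rewrite sum_ffunE; under eq_bigr => b _ do rewrite sum_ffunE.
    rewrite (bigD1 (f x)) //= [X in _ + X]big1 ?addr0; last first.
      move=> b nb; rewrite big1 // => a _; rewrite !ffunE eq_sym (negbTE nb).
      by rewrite mul0r mulr0.
    have tE a : tail k (upd1 f x a) = G a (f (u0 x)) * tail k.+1 f.
      rewrite /tail (bigD1 x); last by rewrite leqnn u0_lt.
      rewrite !ffunE eqxx (negbTE (u0_neq x)); congr (_ * _).
      apply: eq_big => z.
        rewrite u0_lt -val_eqE /=; have := odd_double_half z.
        by case: (odd z) => /= zE; rewrite ?andbF //; apply/idP/idP; lia.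
      move=> /andP[/andP[kz zu] zx]; rewrite !ffunE (negbTE zx).
      have -> : (u0 z == x) = false; last by [].
      apply: contraTF zu => /eqP zx'; have -> : z = u0 x by rewrite -zx' u0K.
      by rewrite u0K -leqNgt ux leqnSn.
    have A1E a : A1 a (f x) (upd1 f x a) = (-1) ^+ ((par a (+) par (f x)) &&
        \big[addb/false]_(l : 'I_N) ((l < x)%N && par (f l))) *
        \sum_c Gi c a * A (upd1 f (u0 x) c).
      congr ((-1) ^+ nat_of_bool (_ && _) * _).
        apply: eq_bigr => l _; rewrite ffunE; case: eqP => [->|//].
        by rewrite ltnn.
      apply: eq_bigr => c _; congr (_ * A _); apply/ffunP => l; rewrite !ffunE.
      by case: (l =P u0 x) => // _; case: (l =P x) => [->|].
    rewrite ffunE; under eq_bigr => a _.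
      rewrite !ffunE eqxx mul1r A1E tE !mulrA -signr_addb addbb mul1r -mulrA mulrC -mulrA.
      over.
    under eq_bigr => a _ do rewrite mulrCA mulr_sumr.
    rewrite -mulr_sumr exchange_big /= mulrC; congr (_ * _).
    rewrite (eq_bigr (fun c => (c == f (u0 x))%:R * A (upd1 f (u0 x) c))); last first.
      move=> c _; rewrite -GiG mulr_suml; apply: eq_bigr => a _.
      by rewrite mulrCA mulrA.
    rewrite sum_delta; congr A; apply/ffunP => l; rewrite ffunE.
    by case: eqP => [->|].
  rewrite act_sumr big1 // => b _; rewrite act_sumr big1 // => a _; apply: slot_kill => f f' ff'.
  congr ((-1) ^+ nat_of_bool (_ && _) * _).
    apply: eq_bigr => l _; case: ltnP => //= lx; rewrite ff' //.
  apply: eq_bigr => c _; congr (_ * _); apply: hA => l lk; rewrite !ffunE.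
  case: (l =P u0 x) => // nlu; case: (l =P x) => // nlx; apply: ff'.
  have : (l : nat) <> x by move=> e; apply: nlx; apply: ord_inj.
  have : (l : nat) <> u0 x by move=> e; apply: nlu; apply: ord_inj.
  by rewrite ux /=; lia.
move=> hB; set T := tform k B.
have yh (h : 'S_N) F' : (forall v, h (u0 v) = u0 (h v)) -> act par y (pact par h F') = act par y F'.
  by move=> hu; rewrite -act_gbase -actM yH.
(* A block swap carries a slot to the next pair and fixes the form [T]; the flip inside a pair will
   carry even slots to odd ones. *)
have even_slot n (z : 'I_N) : z = (k + k + n.*2)%N :> nat ->
    act par y (slot par a b z T) = act par y (slot par a b x T).
  elim: n z => [|n IHn] z zE; first by congr (act _ _ (slot _ _ _ _ _)); apply: ord_inj; rewrite zE /= addn0.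
  have ltw : (k + k + n.*2 < d + d)%N by have := ltn_ord z; rewrite zE; lia.
  pose w : 'I_N := Ordinal ltw.
  have ow : ~~ odd w by rewrite /= addnn -doubleD odd_double.
  have zw : z = w.+2 :> nat by rewrite zE /=; lia.
  rewrite -(IHn w) // -(yh (block_swap w z) (slot par a b z T)); last exact: block_swap_u0.
  have bw : block_swap w z w = z by apply: ord_inj; rewrite val_block_swap // eqxx.
  by rewrite -[X in slot par a b X T]bw slot_pact pact_block_swap //= leq_addr.
have odd_slot (z : 'I_N) : ~~ odd z -> (k + k <= z)%N ->
    act par y (slot par a b (u0 z) T) = act par y (slot par a b z T).
  move=> oz kz; rewrite -(yh (tperm z (u0 z)) (slot par a b (u0 z) T)); last first.
    move=> v; have := tperm_arc u0K (erefl (u0 z)) (tperm z (u0 z) v).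
    by rewrite tpermK.
  by rewrite -[X in slot par a b X T](tpermL z) slot_pact pact_flip.
have all_slot (z : 'I_N) : (k + k <= z)%N ->
    act par y (slot par a b z T) = act par y (slot par a b x T).
  move=> kz.
  have ev (v : 'I_N) : ~~ odd v -> (k + k <= v)%N ->
      act par y (slot par a b v T) = act par y (slot par a b x T).
    move=> ov kv; apply: (even_slot (v./2 - k)%N).
    by have := odd_double_half v; rewrite (negbTE ov); lia.
  case: (boolP (odd z)) => oz; last exact: ev.
  have ou : ~~ odd (u0 z).
    by rewrite -u0_lt u0K ltn_neqAle (leqNgt (u0 z)) u0_lt oz andbT; apply: u0_neq.
  by rewrite -(u0K z) odd_slot ?u0_ge // ev ?u0_ge.
have := congr1 (gl_act par a b) (IH (ltnW kd) B hB).
rewrite -gl_act_act /gl_act [RHS]big1 => [|i _]; last exact: slot0.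
rewrite act_sumr (bigID (fun i : 'I_N => (k + k <= i)%N)) /= [X in _ + X]big1 => [|i].
  rewrite addr0 (eq_bigr _ all_slot) sumr_const -scaler_nat => /eqP.
  rewrite scaler_eq0 pnatr_eq0 => /orP[/eqP e|/eqP //].
  by move/negbT/negP: (card0_eq e x); case; apply: leqnn.
rewrite -ltnNge => ik; have [B' hB' ->] := slot_head a b hB ik.
by apply: IH => //; apply: ltnW.
Qed.

End Generation.

(** * Composites of Brauer diagrams *)

Section Composite.
Variables (p q r : nat).

Lemma stack_edge_sym (D1 : diagram q r) (D2 : diagram p q) : symmetric (stack_edge D1 D2).
Proof.
suff sub z z' : stack_edge D1 D2 z z' -> stack_edge D1 D2 z' z.
  by move=> z z'; apply/idP/idP; apply: sub.
by case/orP=> /existsP[x /andP[/eqP <- /eqP <-]]; apply/orP; [left|right];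
  apply/existsP; [exists (D2 x)|exists (D1 x)]; rewrite mate_involutive !eqxx.
Qed.

Lemma stack_edge_lower (D1 : diagram q r) (D2 : diagram p q) x :
  connect (stack_edge D1 D2) (lower_pt r x) (lower_pt r (D2 x)).
Proof. by apply/connect1/orP; left; apply/existsP; exists x; rewrite !eqxx. Qed.

Lemma stack_edge_upper (D1 : diagram q r) (D2 : diagram p q) x :
  connect (stack_edge D1 D2) (upper_pt p x) (upper_pt p (D1 x)).
Proof. by apply/connect1/orP; right; apply/existsP; exists x; rewrite !eqxx. Qed.

(* A retraction of the stacked picture onto the outer points, constant along
   edges up to the matching D, shows that D is the only composite. *)
Section Retraction.
Variables (D1 : diagram q r) (D2 : diagram p q) (D : diagram p r).
Variable ret : (bpts p q + 'I_r)%type -> bpts p r.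
Hypothesis ret_outer : forall x, ret (outer_pt q x) = x.
Hypothesis ret_lower : forall x,
  ret (lower_pt r (D2 x)) \in [:: ret (lower_pt r x); D (ret (lower_pt r x))].
Hypothesis ret_upper : forall x,
  ret (upper_pt p (D1 x)) \in [:: ret (upper_pt p x); D (ret (upper_pt p x))].
Hypothesis ret_connect : forall z, connect (stack_edge D1 D2) z (outer_pt q (ret z)).
Hypothesis mate_connect : forall x,
  connect (stack_edge D1 D2) (outer_pt q x) (outer_pt q (D x)).

Lemma ret_path z z' : connect (stack_edge D1 D2) z z' -> ret z' \in [:: ret z; D (ret z)].
Proof.
have edge y y' : stack_edge D1 D2 y y' -> ret y' \in [:: ret y; D (ret y)].
  by case/orP=> /existsP[x /andP[/eqP <- /eqP <-]].
case/connectP=> s; elim: s z => [|y s IH] z /=; first by move=> _ ->; rewrite inE eqxx.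
case/andP=> /edge zy ys e; have := IH y ys e; move: zy.
rewrite !inE => /orP[] /eqP -> //; rewrite mate_involutive orbC.
by [].
Qed.

Lemma is_composite_ret D' : is_composite D1 D2 D' = (D' == D).
Proof.
apply/forallP/eqP => [comp|-> x]; last exact: mate_connect.
apply/val_inj/ffunP => x; have := ret_path (comp x).
rewrite !ret_outer !inE => /orP[] /eqP // e; have := mate_neq D' x.
by rewrite e eqxx.
Qed.

Lemma nloops_ret : nloops D1 D2 = 0%N.
Proof.
apply: eq_card0 => z; rewrite !inE; apply/negP => /andP[_ /forallP/(_ (ret z))].
by rewrite ret_connect.
Qed.

Lemma brauer_mul_ret (C : fieldType) (delta : C) :
  brauer_mul delta (dg C D1) (dg C D2) = dg C D.
Proof.
apply/ffunP => D'; rewrite !ffunE (bigD1 D1) //= [X in _ + X]big1 ?addr0; last first.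
  move=> E1 n1; rewrite big1 // => E2 _.
  by rewrite !ffunE (negbTE n1) mul0r mulr0.
rewrite big_mkcond (bigD1 D2) //= [X in _ + X]big1 ?addr0; last first.
  by move=> E2 n2; case: ifP => // _; rewrite !ffunE (negbTE n2) !mulr0.
rewrite is_composite_ret; case: eqP => // _.
by rewrite !ffunE !eqxx nloops_ret expr0 scale1r !mulr1.
Qed.

End Retraction.
End Composite.

Section PointPermutations.
Variables (p q : nat).

Definition top_map (s : 'S_q) (x : bpts p q) : bpts p q :=
  match x with inl i => inl i | inr j => inr (s j) end.
Definition bot_map (s : 'S_p) (x : bpts p q) : bpts p q :=
  match x with inl i => inl (s i) | inr j => inr j end.

Lemma top_mapK s : cancel (top_map s) (top_map s^-1).
Proof. by case=> //= a; rewrite permK. Qed.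
Lemma top_mapVK s : cancel (top_map s^-1) (top_map s).
Proof. by case=> //= a; rewrite permKV. Qed.
Lemma bot_mapK s : cancel (bot_map s) (bot_map s^-1).
Proof. by case=> //= a; rewrite permK. Qed.
Lemma bot_mapVK s : cancel (bot_map s^-1) (bot_map s).
Proof. by case=> //= a; rewrite permKV. Qed.

Definition top_perm s (D : diagram p q) : diagram p q := relabel (top_mapK s) (top_mapVK s) D.
Definition bot_perm s (D : diagram p q) : diagram p q := relabel (bot_mapK s) (bot_mapVK s) D.

Lemma top_permE s D x : top_perm s D (top_map s x) = top_map s (D x).
Proof. by rewrite /= ffunE /= top_mapK. Qed.
Lemma bot_permE s D x : bot_perm s D (bot_map s x) = bot_map s (D x).
Proof. by rewrite /= ffunE /= bot_mapK. Qed.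

End PointPermutations.

Lemma diagram_eqP (p q : nat) (D D' : diagram p q) : D =1 D' -> D = D'.
Proof. by move=> e; apply/val_inj/ffunP. Qed.

Section SpecialComposites.
Variables (C : fieldType) (delta : C) (d : nat).
Implicit Types (D : diagram d d) (i j : 'I_d).

Lemma brauer_mul_s_top i j D :
  brauer_mul delta (dg C (s_diagram i j)) (dg C D) = dg C (top_perm (tperm i j) D).
Proof.
pose ret (z : (bpts d d + 'I_d)%type) : bpts d d :=
  match z with inl x => top_map (tperm i j) x | inr k => inr k end.
have sE x : s_diagram i j x = s_mate i j x by rewrite /= ffunE.
have con z : connect (stack_edge (s_diagram i j) D) z (outer_pt d (ret z)).
  case: z => [[a|a]|a] /=; try exact: connect0.
  by have := stack_edge_upper (s_diagram i j) D (inl a); rewrite sE.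
apply: (brauer_mul_ret (ret := ret)) => //.
- by case.
- by move=> x; rewrite /= top_permE !inE eqxx orbT.
- by case=> a; rewrite sE /= ?tpermK !inE eqxx.
move=> x; rewrite -(top_mapVK (tperm i j) x) top_permE.
move: (top_map _ x) => {}x; have := con (lower_pt d x); have := con (lower_pt d (D x)).
rewrite /= => c1 c2; apply: connect_trans c1.
rewrite (sym_connect_sym (stack_edge_sym _ _)); apply: connect_trans c2.
rewrite (sym_connect_sym (stack_edge_sym _ _)); exact: stack_edge_lower.
Qed.

Lemma brauer_mul_s_bot i j D :
  brauer_mul delta (dg C D) (dg C (s_diagram i j)) = dg C (bot_perm (tperm i j) D).
Proof.
pose ret (z : (bpts d d + 'I_d)%type) : bpts d d :=
  match z with inl (inl a) => inl a | inl (inr a) => inl (tperm i j a) | inr k => inr k end.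
have sE x : s_diagram i j x = s_mate i j x by rewrite /= ffunE.
have retU x : ret (upper_pt d x) = bot_map (tperm i j) x by case: x.
have con z : connect (stack_edge D (s_diagram i j)) z (outer_pt d (ret z)).
  case: z => [[a|a]|a] /=; try exact: connect0.
  by have := stack_edge_lower D (s_diagram i j) (inr a); rewrite sE.
apply: (brauer_mul_ret (ret := ret)) => //.
- by case.
- by case=> a; rewrite sE /= ?tpermK !inE eqxx.
- by move=> x; rewrite !retU bot_permE !inE eqxx orbT.
move=> x; rewrite -(bot_mapVK (tperm i j) x) bot_permE.
move: (bot_map _ x) => {}x; have := con (upper_pt d x); have := con (upper_pt d (D x)).
rewrite !retU => c1 c2; apply: connect_trans c1.
rewrite (sym_connect_sym (stack_edge_sym _ _)); apply: connect_trans c2.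
rewrite (sym_connect_sym (stack_edge_sym _ _)); exact: stack_edge_upper.
Qed.

Variables (i j : 'I_d) (ij : i != j) (D D' : diagram d d).
Hypotheses (D'i : D' (inr i) = inl i) (D'j : D' (inr j) = inl j).
Hypotheses (Dij_top : D (inr i) = inr j) (Dij_bot : D (inl i) = inl j).

Definition in_block (x : bpts d d) : bool := 
  match x with inl a => a \in [:: i; j] | inr a => a \in [:: i; j] end.

Hypothesis DD' : forall x, ~~ in_block x -> D' x = D x.

(** [D'] has vertical strands at [i] and [j]. Stacking the cup-cap on it joins their lower ends into
    one arc and adds the arc on top, without closing a loop. *)
Lemma brauer_mul_e_top : brauer_mul delta (dg C (e_diagram ij)) (dg C D') = dg C D.
Proof.
(* A middle point at [i] or [j] is followed down the strand of [D'], any other one up through the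
   vertical strands of the cup-cap. *)
pose ret (z : (bpts d d + 'I_d)%type) : bpts d d :=
  match z with inl (inl a) => inl a
  | inl (inr a) => if a \in [:: i; j] then inl a else inr a | inr k => inr k end.
have eE x : e_diagram ij x = e_mate i j x by rewrite /= ffunE.
have Dji_top : D (inr j) = inr i by rewrite -Dij_top mate_involutive.
have Dji_bot : D (inl j) = inl i by rewrite -Dij_bot mate_involutive.
have D'bl a : a \in [:: i; j] -> D' (inr a) = inl a by rewrite !inE => /orP[] /eqP ->.
have D'bl' a : a \in [:: i; j] -> D' (inl a) = inr a by move/D'bl => <-; rewrite mate_involutive.
have Dtop a : a \in [:: i; j] -> D (inr a) = inr (tperm i j a).
  by rewrite !inE => /orP[] /eqP ->; rewrite ?tpermL ?tpermR.
have Dbot a : a \in [:: i; j] -> D (inl a) = inl (tperm i j a).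
  by rewrite !inE => /orP[] /eqP ->; rewrite ?tpermL ?tpermR.
have ta a : (tperm i j a \in [:: i; j]) = (a \in [:: i; j]).
  by rewrite !inE; case: tpermP => [->|->|//]; rewrite !eqxx ?orbT.
have bl x : in_block (D x) = in_block x.
  suff sub y : in_block y -> in_block (D y).
    by apply/idP/idP => /sub //; rewrite mate_involutive.
  by case: y => a /= ab; rewrite ?Dtop ?Dbot //= ta.
have retl x : ~~ in_block x -> ret (lower_pt d x) = x by case: x => a //= /negbTE ->.
have con z : connect (stack_edge (e_diagram ij) D') z (outer_pt d (ret z)).
  case: z => [[a|a]|a] /=; try exact: connect0.
  case: ifP => ab /=.
    by have := stack_edge_lower (e_diagram ij) D' (inr a); rewrite D'bl.
  by have := stack_edge_upper (e_diagram ij) D' (inl a); rewrite eE /= ab.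
have csym := sym_connect_sym (stack_edge_sym (e_diagram ij) D').
apply: (brauer_mul_ret (ret := ret)) => //.
- by case.
- move=> x; case: (boolP (in_block x)) => xb; last first.
    by rewrite DD' // !retl ?bl // !inE eqxx orbT.
  by case: x xb => a /= ab; rewrite ?D'bl ?D'bl' //= ?ab !inE eqxx.
- case=> a; rewrite eE /e_mate; case: ifP => ab; rewrite /ret /upper_pt ?ta ?ab.
  + by rewrite Dbot // !inE eqxx orbT.
  + by rewrite !inE eqxx.
  + by rewrite Dtop // !inE eqxx orbT.
  + by rewrite !inE eqxx.
move=> x; case: (boolP (in_block x)) => xb; last first.
  have := con (lower_pt d (D x)); have := con (lower_pt d x).
  rewrite !retl ?bl // => c1 c2; apply: connect_trans c2.
  rewrite csym; apply: connect_trans c1; rewrite csym -DD' //; exact: stack_edge_lower.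
case: x xb => a /= ab; rewrite ?Dtop ?Dbot //=; last first.
  by have := stack_edge_upper (e_diagram ij) D' (inr a); rewrite eE /= ab.
have := stack_edge_upper (e_diagram ij) D' (inl a); rewrite eE /= ab /= => c1.
have := stack_edge_lower (e_diagram ij) D' (inl a); rewrite D'bl' //= => c0.
have := stack_edge_lower (e_diagram ij) D' (inr (tperm i j a)); rewrite D'bl ?ta //= => c2.
exact: connect_trans c0 (connect_trans c1 c2).
Qed.

End SpecialComposites.

(** * Generation of Brauer diagrams by crossings and one cup-cap *)

Section DiagramInduction.
Variable d : nat.
Implicit Types (D : diagram d d) (s t : 'S_d).

Lemma top_permM s t D : top_perm (s * t) D = top_perm t (top_perm s D).
Proof.
have mapM x : top_map (q := d) (s * t) x = top_map t (top_map s x).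
  by case: x => a //=; rewrite permM.
apply: diagram_eqP => x; rewrite -(top_mapVK (s * t) x) top_permE.
by rewrite [in RHS]mapM !top_permE mapM.
Qed.

Lemma bot_permM s t D : bot_perm (s * t) D = bot_perm t (bot_perm s D).
Proof.
have mapM x : bot_map (p := d) (s * t) x = bot_map t (bot_map s x).
  by case: x => a //=; rewrite permM.
apply: diagram_eqP => x; rewrite -(bot_mapVK (s * t) x) bot_permE.
by rewrite [in RHS]mapM !bot_permE mapM.
Qed.

Lemma top_perm1 D : top_perm 1 D = D.
Proof.
have map1 x : top_map (p := d) (1 : 'S_d) x = x by case: x => a //=; rewrite perm1.
by apply: diagram_eqP => x; rewrite -{1}(map1 x) top_permE map1.
Qed.

Lemma bot_perm1 D : bot_perm 1 D = D.
Proof.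
have map1 x : bot_map (q := d) (1 : 'S_d) x = x by case: x => a //=; rewrite perm1.
by apply: diagram_eqP => x; rewrite -{1}(map1 x) bot_permE map1.
Qed.

Definition top_arcs D : {set 'I_d} := [set a | if D (inr a) is inr _ then true else false].

Lemma card_top_arcs s t D : #|top_arcs (top_perm s (bot_perm t D))| = #|top_arcs D|.
Proof.
rewrite -[RHS](card_imset _ (@perm_inj _ s)); congr #|pred_of_set _|; apply/setP => a.
have E : top_perm s (bot_perm t D) (inr a) = top_map s (bot_map t (D (inr (s^-1%g a)))).
  by rewrite -bot_permE -top_permE /= permKV.
rewrite in_set E; apply/idP/imsetP => [H|[b + ->]].
  exists (s^-1%g a); rewrite ?permKV // inE.
  by case: (D (inr (s^-1%g a))) H.
by rewrite inE permK; case: (D (inr b)).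
Qed.

Lemma perm2_ex (a b i j : 'I_d) : a != b -> i != j -> exists s, s a = i /\ s b = j.
Proof.
move=> ab ij; pose x := tperm a i b.
have xi : x != i by rewrite /x -{2}(tpermL a i) (inj_eq perm_inj) eq_sym.
exists (tperm a i * tperm x j)%g; rewrite !permM tpermL -/x tpermL; split=> //.
by rewrite tpermD // eq_sym.
Qed.

Section Rewire.
Variables (i j : 'I_d) (D : diagram d d).
Hypotheses (Dij_top : D (inr i) = inr j) (Dij_bot : D (inl i) = inl j).

(** The arcs joining [i] and [j] on top and at the bottom are cut and reglued into two vertical
    strands. *)
Definition rewire_mate (x : bpts d d) : bpts d d :=
  if in_block i j x then match x with inl a => inr a | inr a => inl a end else D x.

Lemma in_block_mate x : in_block i j (D x) = in_block i j x.
Proof.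
suff sub y : in_block i j y -> in_block i j (D y).
  by apply/idP/idP => /sub //; rewrite mate_involutive.
have Dj_top : D (inr j) = inr i by rewrite -Dij_top mate_involutive.
have Dj_bot : D (inl j) = inl i by rewrite -Dij_bot mate_involutive.
by case: y => a; rewrite /= !inE => /orP[] /eqP ->;
  rewrite ?Dij_top ?Dij_bot ?Dj_top ?Dj_bot /= !inE eqxx ?orbT.
Qed.

Lemma rewire_mateK : involutive rewire_mate.
Proof.
move=> x; rewrite /rewire_mate; case: (boolP (in_block i j x)) => xb; last first.
  by rewrite in_block_mate (negbTE xb) mate_involutive.
by case: x xb => a /= ->.
Qed.

Lemma rewire_mate_neq x : rewire_mate x != x.
Proof.
by rewrite /rewire_mate; case: ifP => _; [case: x | apply: mate_neq].
Qed.

Definition rewire : diagram d d := mk_diagram rewire_mateK rewire_mate_neq.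

Lemma rewireE x : rewire x = rewire_mate x. Proof. by rewrite /= ffunE. Qed.

Lemma card_top_arcs_rewire : (#|top_arcs rewire| < #|top_arcs D|)%N.
Proof.
apply: proper_card; apply/properP; split; last first.
  by exists i; rewrite !inE ?Dij_top // rewireE /rewire_mate /= !inE eqxx.
apply/subsetP => a; rewrite !inE rewireE /rewire_mate.
by case: ifP.
Qed.

End Rewire.

(** A diagram with a top arc has a bottom arc; permutations bring both to the first two positions,
    where rewiring lowers the number of top points on arcs. Without top arcs the diagram is a
    permutation. Positions 0 and 1 are chosen because their four points are consecutive in the
    linear order of [lin_pos]. *)
Lemma diagram_ind (P : diagram d d -> Prop) :
  P (id_diagram d) ->
  (forall (i j : 'I_d) D, j = i.+1 :> nat -> P D -> P (top_perm (tperm i j) D)) ->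
  (forall (i j : 'I_d) D, j = i.+1 :> nat -> P D -> P (bot_perm (tperm i j) D)) ->
  (forall (i j : 'I_d) D D', i = 0%N :> nat -> j = 1%N :> nat ->
     D' (inr i) = inl i -> D' (inr j) = inl j -> D (inr i) = inr j -> D (inl i) = inl j ->
     (forall x, ~~ in_block i j x -> D' x = D x) -> P D' -> P D) ->
  forall D, P D.
Proof.
move=> P1 Ptop Pbot Pe.
have {}Ptop s : forall D, P D -> P (top_perm s D).
  move: s; apply: perm_adj_ind => [D|s i j ij IH D PD]; first by rewrite top_perm1.
  by rewrite top_permM; apply: IH; apply: Ptop.
have {}Pbot s : forall D, P D -> P (bot_perm s D).
  move: s; apply: perm_adj_ind => [D|s i j ij IH D PD]; first by rewrite bot_perm1.
  by rewrite bot_permM; apply: IH; apply: Pbot.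
move=> D; have [n] := ubnP #|top_arcs D|; elim: n D => // n IH D len.
case: (set_0Vmem (top_arcs D)) => [no|[a]]; last first.
  rewrite inE; case Da: (D (inr a)) => [//|b] _.
  have ab : a != b by apply/eqP => e; have := mate_neq D (inr a); rewrite Da e eqxx.
  have [c [c' Dc]] : exists c c', D (inl c) = inl c'.
    (* Without a bottom arc, the bottom points would be matched injectively, hence surjectively,
       with the top points, including [a]. *)
    case: (boolP [exists c, exists c', D (inl c) == inl c']).
      by move=> /existsP[c /existsP[c' /eqP Dc]]; exists c, c'.
    rewrite negb_exists => /forallP nex.
    have /fin_all_exists[h hP] : forall c, exists e, D (inl c) = inr e.
      move=> c; case Dc: (D (inl c)) => [c'|e]; last by exists e.
      by have := nex c; rewrite negb_exists => /forallP/(_ c'); rewrite Dc eqxx.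
    have hI : injective h.
      by move=> c e ce; have := congr1 D (hP c); rewrite ce -hP !mate_involutive => -[].
    have := hP (invF hI a); rewrite f_invF => /(congr1 D).
    by rewrite mate_involutive Da.
  have cc' : c != c' by apply/eqP => e; have := mate_neq D (inl c); rewrite Dc e eqxx.
  have d2 : (1 < d)%N.
    by have := ltn_ord a; have := ltn_ord b; move: ab; rewrite -val_eqE /=; lia.
  pose i : 'I_d := Ordinal (ltnW d2); pose j : 'I_d := Ordinal d2.
  have ij : i != j by [].
  have [s [sa sb]] := perm2_ex ab ij; have [t [tc tc']] := perm2_ex cc' ij.
  pose E := top_perm s (bot_perm t D).
  have Etop : E (inr i) = inr j.
    rewrite /E -sa -[inr (s a)]/(top_map s (inr a)) top_permE.
    by rewrite -[inr a]/(bot_map t (inr a)) bot_permE Da /= sb.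
  have Ebot : E (inl i) = inl j.
    rewrite /E -[inl i]/(top_map s (inl i)) top_permE -tc.
    by rewrite -[inl (t c)]/(bot_map t (inl c)) bot_permE Dc /= tc'.
  have -> : D = bot_perm t^-1 (top_perm s^-1 E).
    by rewrite /E -top_permM mulgV top_perm1 -bot_permM mulgV bot_perm1.
  apply/Pbot/Ptop/(Pe i j E (rewire Etop Ebot)) => //.
  - by rewrite rewireE.
  - by rewrite rewireE.
  - by move=> x xb; rewrite rewireE /rewire_mate (negbTE xb).
  apply: IH; apply: leq_trans (card_top_arcs_rewire Etop Ebot) _.
  by rewrite card_top_arcs -ltnS.
have /fin_all_exists[h hP] : forall a, exists c, D (inr a) = inl c.
  move=> a; case Da: (D (inr a)) => [c|b]; first by exists c.
  by have := in_set0 a; rewrite -no inE Da.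
have hI : injective h.
  by move=> c e ce; have := congr1 D (hP c); rewrite ce -hP !mate_involutive => -[].
have -> : D = bot_perm (perm hI) (id_diagram d).
  apply: diagram_eqP => x; rewrite -(bot_mapVK (perm hI) x) bot_permE.
  move: (bot_map _ x) => {}x; rewrite [id_diagram d x]ffunE.
  case: x => a /=; rewrite permE; last exact: hP.
  by rewrite -hP mate_involutive.
exact: Pbot.
Qed.

End DiagramInduction.

(** * Matrix elements of Brauer diagrams *)

Section LinearPositions.
Variables (p q : nat).

(* Top points from right to left, followed by the bottom points from left to
   right: this order is preserved by bending. *)
Definition lin_pos (x : bpts p q) : 'I_(q + p) :=
  match x with inl i => rshift q i | inr j => lshift p (rev_ord j) end.

Definition lin_pt (z : 'I_(q + p)) : bpts p q :=
  match split z with inl a => inr (rev_ord a) | inr b => inl b end.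

Lemma lin_posK : cancel lin_pos lin_pt.
Proof.
by case=> a; rewrite /lin_pt /lin_pos; rewrite ?(unsplitK (inr a)) ?(unsplitK (inl (rev_ord a)))
  ?rev_ordK.
Qed.

Lemma lin_ptK : cancel lin_pt lin_pos.
Proof.
move=> z; rewrite /lin_pt -{2}(splitK z); case: (split z) => a //=.
by rewrite rev_ordK.
Qed.

Definition lin_mate (D : diagram p q) (z : 'I_(q + p)) : 'I_(q + p) := lin_pos (D (lin_pt z)).

Lemma lin_mateK D : involutive (lin_mate D).
Proof. by move=> z; rewrite /lin_mate lin_posK mate_involutive lin_ptK. Qed.

Lemma lin_mate_neq D z : lin_mate D z != z.
Proof. by rewrite (can2_eq lin_posK lin_ptK) mate_neq. Qed.

End LinearPositions.

Section MatrixElements.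
Variables (C : numFieldType) (d : nat) (X : finType) (par : X -> bool).
Variables (G Gi : X -> X -> C).
Hypothesis G_even : forall a b, par a != par b -> G a b = 0.
Hypothesis G_sym : forall a b, G a b = (-1) ^+ (par a && par b) * G b a.
Hypothesis GGi : forall a c, \sum_b G a b * Gi b c = (a == c)%:R.
Hypothesis GiG : forall a c, \sum_b Gi a b * G b c = (a == c)%:R.

Implicit Types (w g f v : {ffun 'I_d -> X}) (D : diagram d d) (i j : 'I_d).

(** The part of row [a] of [Gi] that changes parity is still annihilated by the even matrix [G],
    which is invertible. *)
Lemma Gi_even a b : par a != par b -> Gi a b = 0.
Proof.
move=> nab; pose u b := (par a != par b)%:R * Gi a b.
have uG c : \sum_b u b * G b c = 0.
  have [pac|pac] := eqVneq (par a) (par c).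
    rewrite big1 // => e _; rewrite /u; case: (eqVneq (par a) (par e)) => /= pae.
      by rewrite !mul0r.
    by rewrite G_even ?mulr0 // -pac eq_sym.
  have e0 : \sum_b Gi a b * G b c = 0.
    by rewrite GiG; case: eqP => // e; rewrite e eqxx in pac.
  rewrite -[RHS]e0; apply: eq_bigr => e _; rewrite /u.
  case: (eqVneq (par a) (par e)) => /= pae; last by rewrite mul1r.
  by rewrite G_even ?mulr0 // -pae.
have : \sum_c (\sum_b u b * G b c) * Gi c b = 0 by rewrite big1 // => c _; rewrite uG mul0r.
under eq_bigr => c _ do rewrite mulr_suml.
rewrite exchange_big /= (eq_bigr (fun e => (e == b)%:R * u e)) => [|e _].
  by rewrite sum_delta /u nab mul1r.
by rewrite -GGi mulrC mulr_sumr; apply: eq_bigr => c _; rewrite mulrA.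
Qed.

Definition joint w g : {ffun 'I_(d + d) -> X} :=
  [ffun z => match lin_pt z with inl i => g i | inr j => w j end].

(** The matrix element with its output letters lowered by [G]; [melt] raises them again with
    [Gi]. *)
Definition omega D w g : C := wform par G (lin_mate D) (joint w g).

Definition melt D f g : C := \sum_(w : {ffun 'I_d -> X}) (\prod_k Gi (f k) (w k)) * omega D w g.

(** In the linear order the identity pairs each position with its mirror image: the arcs are nested
    and do not cross. *)
Lemma melt_id f g : melt (id_diagram d) f g = (f == g)%:R.
Proof.
have idE x : id_diagram d x = id_mate x by rewrite ffunE.
have uE z : lin_mate (id_diagram d) z = rev_ord z :> nat.
  rewrite /lin_mate idE -[RHS]/(d + d - z.+1)%N -{2}(lin_ptK z).
  by case: (lin_pt z) => a /=; have := ltn_ord a; lia.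
have om w : omega (id_diagram d) w g = \prod_k G (w k) (g k).
  rewrite /omega wformE [cross _ _](_ : _ = false); last first.
    rewrite /cross big1 // => -[x y] _; rewrite /crosses !uE /=.
    apply/negbTE/negP => /andP[/and3P[]]; have := ltn_ord x; have := ltn_ord y; lia.
  rewrite mul1r /arcs big_mkcond big_split_ord /= [X in _ * X]big1 ?mulr1 => [|k _].
    rewrite [RHS](reindex_inj rev_ord_inj); apply: eq_bigr => k _.
    rewrite uE /= ifT; last by have := ltn_ord k; lia.
    rewrite !ffunE /lin_mate -[lshift d k]/(lshift d k).
    have -> : lin_pt (lshift d k) = inr (rev_ord k) :> bpts d d.
      by rewrite -{1}(rev_ordK k) -[lshift d _]/(lin_pos (inr (rev_ord k) : bpts d d)) lin_posK.
    by rewrite idE /= -[rshift d _]/(lin_pos (inl (rev_ord k) : bpts d d)) lin_posK.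
  by rewrite uE /= ifF //; apply/negbTE; have := ltn_ord k; lia.
rewrite /melt; under eq_bigr => w _ do rewrite om -big_split.
rewrite -(bigA_distr_bigA (fun k x => Gi (f k) x * G x (g k))) /=.
under eq_bigr => k _ do rewrite GiG.
case: eqP => [->|ne]; first by rewrite big1 // => k _; rewrite eqxx.
case: (pickP (fun k => f k != g k)) => [k nk|all]; first by rewrite (bigD1 k) //= (negbTE nk) mul0r.
by case: ne; apply/ffunP => k; have /negbFE/eqP := all k.
Qed.

Lemma omega_top i j D w g : j = i.+1 :> nat ->
  omega (top_perm (tperm i j) D) w g =
  (-1) ^+ (par (w i) && par (w j)) * omega D (fcomp w (tperm i j)) g.
Proof.
move=> ij; rewrite /omega.
pose zi := lin_pos (inr i : bpts d d); pose zj := lin_pos (inr j : bpts d d).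
have zij : zi = zj.+1 :> nat by rewrite /= ij; have := ltn_ord j; rewrite ij; lia.
have sp x : tperm zj zi (lin_pos x) = lin_pos (top_map (tperm i j) x).
  rewrite /zi /zj -inj_tperm; last exact: can_inj (@lin_posK d d).
  congr lin_pos; case: x => a /=; first by rewrite tpermD.
  by rewrite -(inj_tperm j i a) 1?tpermC // => b c [].
have lp z : lin_pt (tperm zj zi z) = top_map (tperm i j) (lin_pt z).
  by rewrite -{1}(lin_ptK z) sp lin_posK.
rewrite (eq_wform par G (u' := fun z => tperm zj zi (lin_mate D (tperm zj zi z)))); last first.
  move=> z; rewrite /lin_mate lp sp -top_permE; congr (lin_pos (_ _)).
  by rewrite -{2}(tpermV i j) top_mapVK.
rewrite wform_tperm //; [|exact: lin_mateK|exact: lin_mate_neq].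
have fE : fcomp (joint w g) (tperm zj zi) = joint (fcomp w (tperm i j)) g.
  by apply/ffunP => z; rewrite !ffunE lp; case: (lin_pt z) => //= a; rewrite ffunE.
rewrite ffunE /psign inv_par_adj // tpermV fE; congr (_ * _).
by rewrite /= !ffunE /zi /zj !lin_posK andbC.
Qed.

Lemma omega_bot i j D w g : j = i.+1 :> nat ->
  omega (bot_perm (tperm i j) D) w g =
  (-1) ^+ (par (g i) && par (g j)) * omega D w (fcomp g (tperm i j)).
Proof.
move=> ij; rewrite /omega.
pose zi := lin_pos (inl i : bpts d d); pose zj := lin_pos (inl j : bpts d d).
have zij : zj = zi.+1 :> nat by rewrite /= ij addnS.
have sp x : tperm zi zj (lin_pos x) = lin_pos (bot_map (tperm i j) x).
  rewrite /zi /zj -inj_tperm; last exact: can_inj (@lin_posK d d).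
  congr lin_pos; case: x => a /=; last by rewrite tpermD.
  by rewrite -(inj_tperm i j a) // => b c [].
have lp z : lin_pt (tperm zi zj z) = bot_map (tperm i j) (lin_pt z).
  by rewrite -{1}(lin_ptK z) sp lin_posK.
rewrite (eq_wform par G (u' := fun z => tperm zi zj (lin_mate D (tperm zi zj z)))); last first.
  move=> z; rewrite /lin_mate lp sp -bot_permE; congr (lin_pos (_ _)).
  by rewrite -{2}(tpermV i j) bot_mapVK.
rewrite wform_tperm //; [|exact: lin_mateK|exact: lin_mate_neq].
have fE : fcomp (joint w g) (tperm zi zj) = joint w (fcomp g (tperm i j)).
  by apply/ffunP => z; rewrite !ffunE lp; case: (lin_pt z) => //= a; rewrite ffunE.
rewrite ffunE /psign inv_par_adj // tpermV fE; congr (_ * _).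
by rewrite /= !ffunE /zi /zj !lin_posK.
Qed.

(** Where the product of [Gi] is nonzero, lowered and raised letters have equal parities, so the
    sign found for [omega] can be read on [f]. *)
Lemma melt_top i j D f g : j = i.+1 :> nat ->
  melt (top_perm (tperm i j) D) f g =
  (-1) ^+ (par (f i) && par (f j)) * melt D (fcomp f (tperm i j)) g.
Proof.
move=> ij; have nij : i != j by rewrite -val_eqE /= ij neq_ltn ltnSn.
rewrite /melt mulr_sumr (reindex_inj (h := fun w => fcomp w (tperm i j))); last first.
  by move=> w w' /(congr1 (fun u => fcomp u (tperm i j)^-1)); rewrite !fcompK.
apply: eq_bigr => w _; rewrite omega_top // fcompM tperm2 fcomp1 !ffunE tpermL tpermR.
rewrite [X in X * _](_ : _ = \prod_k Gi (fcomp f (tperm i j) k) (w k)); last first.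
  rewrite (reindex_inj (@perm_inj _ (tperm i j))); apply: eq_bigr => k _.
  by rewrite !ffunE tpermK.
rewrite mulrCA; set P := \prod_k _; have [->|nz] := eqVneq P 0; first by rewrite !mul0r !mulr0.
congr ((-1) ^+ nat_of_bool _ * _).
have ev k : par (w k) = par (fcomp f (tperm i j) k).
  apply/eqP; apply: contraNT nz; rewrite eq_sym => /Gi_even e0.
  by rewrite /P (bigD1 k) //= e0 mul0r.
by rewrite !ev !ffunE tpermL tpermR andbC.
Qed.

Lemma melt_bot i j D f g : j = i.+1 :> nat ->
  melt (bot_perm (tperm i j) D) f g =
  (-1) ^+ (par (g i) && par (g j)) * melt D f (fcomp g (tperm i j)).
Proof.
move=> ij; rewrite /melt mulr_sumr; apply: eq_bigr => w _.
by rewrite omega_bot // mulrCA.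
Qed.

Lemma big_pred2 (I : finType) (P : pred I) (x y : I) (F : I -> C) : x != y ->
  (forall z, P z = (z == x) || (z == y)) -> \prod_(z | P z) F z = F x * F y.
Proof.
move=> xy PE; rewrite (bigD1 x) ?PE ?eqxx //=; congr (_ * _); apply: big_pred1 => z.
by rewrite PE /=; case: (eqVneq z x) => [->|_]; rewrite ?andbT //= (negbTE xy).
Qed.

Lemma prod_ij i j (F : 'I_d -> C) : i != j ->
  \prod_k F k = F i * (F j * \prod_(k | (k != i) && (k != j)) F k).
Proof. by move=> ij; rewrite (bigD1 i) //= (bigD1 j) //= eq_sym ij. Qed.

Section CupCap.
Variables (i j : 'I_d) (D D' : diagram d d).
Hypotheses (i0 : i = 0%N :> nat) (j1 : j = 1%N :> nat).
Hypotheses (D'i : D' (inr i) = inl i) (D'j : D' (inr j) = inl j).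
Hypotheses (Dij_top : D (inr i) = inr j) (Dij_bot : D (inl i) = inl j).
Hypothesis DD' : forall x, ~~ in_block i j x -> D' x = D x.

Let ij : i != j. Proof. by rewrite -val_eqE /= i0 j1. Qed.

Let Dji_top : D (inr j) = inr i. Proof. by rewrite -Dij_top mate_involutive. Qed.
Let Dji_bot : D (inl j) = inl i. Proof. by rewrite -Dij_bot mate_involutive. Qed.
Let D'i_bot : D' (inl i) = inr i. Proof. by rewrite -D'i mate_involutive. Qed.
Let D'j_bot : D' (inl j) = inr j. Proof. by rewrite -D'j mate_involutive. Qed.

(** The four points at positions 0 and 1 fill the places [d - 2] to [d + 1], an interval stable
    under both matchings. *)
Let B : {pred 'I_(d + d)} := [pred z | in_block i j (lin_pt z)].

Let pos_ri : lin_pos (inr i : bpts d d) = (d - 1)%N :> nat. Proof. by rewrite /= i0. Qed.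
Let pos_rj : lin_pos (inr j : bpts d d) = (d - 2)%N :> nat. Proof. by rewrite /= j1. Qed.
Let pos_li : lin_pos (inl i : bpts d d) = d :> nat. Proof. by rewrite /= i0 addn0. Qed.
Let pos_lj : lin_pos (inl j : bpts d d) = d.+1 :> nat. Proof. by rewrite /= j1 addn1. Qed.
Let d2 : (1 < d)%N. Proof. by rewrite -j1 ltn_ord. Qed.

Let BP z : z \in B -> [\/ z = lin_pos (inr j : bpts d d), z = lin_pos (inr i : bpts d d),
  z = lin_pos (inl i : bpts d d) | z = lin_pos (inl j : bpts d d)].
Proof.
rewrite inE -{2 3 4 5}(lin_ptK z); case: (lin_pt z) => a /=; rewrite !inE => /orP[] /eqP ->;
by [constructor 1 | constructor 2 | constructor 3 | constructor 4].
Qed.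

Let B_val z : (z \in B) = (d <= z.+2)%N && (z <= d.+1)%N.
Proof.
apply/idP/idP => [/BP[] ->|]; rewrite ?pos_ri ?pos_rj ?pos_li ?pos_lj; try lia.
move=> /andP[lo hi]; rewrite inE -(lin_ptK z) lin_posK; move: lo hi; rewrite -{1 2}(lin_ptK z).
by case: (lin_pt z) => a /=; rewrite !inE -!val_eqE /= i0 j1; have := ltn_ord a; lia.
Qed.

Let B_interval (x y z : 'I_(d + d)) : x \in B -> z \in B -> (x <= y <= z)%N -> y \in B.
Proof. by rewrite !B_val => /andP[? _] /andP[_ ?] /andP[? ?]; lia. Qed.

(** Both forms split along the interval [B] with the same outer part. Inside, the two arcs of [D]
    lie side by side and those of [D'] are nested, so neither has a crossing. *)
Lemma omega_cup_cap g : exists2 R : {ffun 'I_d -> X} -> C,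
  (forall w w', (forall k, k != i -> k != j -> w k = w' k) -> R w = R w') &
  forall w, omega D w g = G (w j) (w i) * G (g i) (g j) * R w /\
            omega D' w g = G (w i) (g i) * G (w j) (g j) * R w.
Proof.
pose R w := wpart par G [predC B] (lin_mate D) (joint w g).
have uDB : {in B, forall z, lin_mate D z \in B}.
  by move=> z /BP[] ->; rewrite /lin_mate inE !lin_posK ?Dij_top ?Dij_bot ?Dji_top ?Dji_bot
    /= !inE eqxx ?orbT.
have uD'B : {in B, forall z, lin_mate D' z \in B}.
  by move=> z /BP[] ->; rewrite /lin_mate inE !lin_posK ?D'i ?D'j ?D'i_bot ?D'j_bot
    /= !inE eqxx ?orbT.
have uDBc : {in [predC B], forall z, lin_mate D z \in [predC B]}.
  move=> z; rewrite !inE; apply: contra => /= zB.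
  by have := uDB (lin_mate D z); rewrite lin_mateK; apply.
have eqDD' : {in [predC B], lin_mate D' =1 lin_mate D}.
  by move=> z; rewrite !inE /= => zB; rewrite /lin_mate DD'.
have jE w x : joint w g (lin_pos x) = match x with inl a => g a | inr a => w a end.
  by rewrite ffunE lin_posK.
exists R => [w w' ww'|w].
  apply: eq_wpart => // z; rewrite !inE /= => zB; rewrite !ffunE.
  by case: (lin_pt z) zB => //= a; rewrite !inE negb_or => /andP[ai aj]; apply: ww'.
split.
  rewrite /omega (wform_split _ _ _ (B := B)) //; last exact: lin_mateK.
  congr (_ * _); rewrite /wpart big1 => [|[x y] /= /andP[/BP xB /BP yB]].
    rewrite expr0 mul1r.
    rewrite (big_pred2 (x := lin_pos (inr j : bpts d d)) (y := lin_pos (inl i : bpts d d))).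
    - by rewrite /lin_mate !lin_posK Dji_top Dij_bot !jE.
    - by rewrite (can_eq (@lin_posK d d)).
    move=> z; apply/andP/orP => [[/BP[] ->]|[] /eqP ->].
    - by left.
    - by rewrite /lin_mate lin_posK Dij_top pos_ri pos_rj; lia.
    - by right.
    - by rewrite /lin_mate lin_posK Dji_bot pos_li pos_lj; lia.
    - by split; rewrite ?B_val /lin_mate ?lin_posK ?Dji_top ?pos_ri ?pos_rj; lia.
    - by split; rewrite ?B_val /lin_mate ?lin_posK ?Dij_bot ?pos_li ?pos_lj; lia.
  apply/negbTE/negP => /andP[/and3P[]].
  by case: xB => ->; case: yB => ->; rewrite /lin_mate !lin_posK ?Dij_top ?Dij_bot ?Dji_top ?Dji_bot
     ?pos_ri ?pos_rj ?pos_li ?pos_lj; lia.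
rewrite /omega (wform_split _ _ _ (B := B)) //; last exact: lin_mateK.
congr (_ * _); last first.
  by apply: eq_wpart => // z zB; rewrite eqDD' // uDBc.
rewrite /wpart big1 => [|[x y] /= /andP[/BP xB /BP yB]].
  rewrite expr0 mul1r.
  rewrite (big_pred2 (x := lin_pos (inr i : bpts d d)) (y := lin_pos (inr j : bpts d d))).
  - by rewrite /lin_mate !lin_posK D'i D'j !jE.
  - by rewrite (can_eq (@lin_posK d d)); apply: contra_neq ij => -[].
  move=> z; apply/andP/orP => [[/BP[] ->]|[] /eqP ->].
  - by right.
  - by left.
  - by rewrite /lin_mate lin_posK D'i_bot pos_ri pos_li; lia.
  - by rewrite /lin_mate lin_posK D'j_bot pos_rj pos_lj; lia.
  - by split; rewrite ?B_val /lin_mate ?lin_posK ?D'i ?pos_ri ?pos_li; lia.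
  - by split; rewrite ?B_val /lin_mate ?lin_posK ?D'j ?pos_rj ?pos_lj; lia.
apply/negbTE/negP => /andP[/and3P[]].
by case: xB => ->; case: yB => ->; rewrite /lin_mate !lin_posK ?D'i ?D'j ?D'i_bot ?D'j_bot
  ?pos_ri ?pos_rj ?pos_li ?pos_lj; lia.
Qed.

Definition fset2 f a b : {ffun 'I_d -> X} :=
  [ffun k => if k == i then a else if k == j then b else f k].

(** Coordinates of the cup-cap stacked on [D']: the outputs [i], [j] of [D'] are contracted by [G],
    and a new pair is created by [Gi]. *)
Lemma melt_cup_cap f g :
  melt D f g = Gi (f i) (f j) * \sum_a \sum_b G a b * melt D' (fset2 f a b) g.
Proof.
have [R Rdep omR] := omega_cup_cap g.
(* Since [R] ignores the letters at [i] and [j], it is expanded over words [v] pinned to [g] there.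
   Each term is a product of one factor per slot, so the sum over [w] distributes. *)
pose dk k (x y : X) : C := if (k == i) || (k == j) then (y == g k)%:R else (x == y)%:R.
have RE w : R w = \sum_v R v * \prod_k dk k (w k) (v k).
  pose w0 := fset2 w (g i) (g j).
  rewrite (bigD1 w0) //= [X in _ + X]big1 ?addr0 => [|v vw].
    rewrite big1 ?mulr1 => [|k _].
      by apply: Rdep => k ki kj; rewrite ffunE (negbTE ki) (negbTE kj).
    rewrite /dk ffunE; case: (eqVneq k i) => [->|ki] /=; first by rewrite eqxx.
    by case: (eqVneq k j) => [->|kj] /=; rewrite eqxx.
  case: (pickP (fun k => v k != w0 k)) => [k nk|all]; last first.
    by case/eqP: vw; apply/ffunP => k; have /negbFE/eqP := all k.
  rewrite (bigD1 k) //= /dk; move: nk; rewrite ffunE.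
  case: (eqVneq k i) => [->|ki] /=; first by move/negbTE ->; rewrite mul0r mulr0.
  case: (eqVneq k j) => [->|kj] /=; first by move/negbTE ->; rewrite mul0r mulr0.
  by rewrite eq_sym => /negbTE ->; rewrite mul0r mulr0.
pose rest f' v := \prod_(k | (k != i) && (k != j)) Gi (f' k) (v k).
have restE f' v : \prod_(k | (k != i) && (k != j)) (\sum_x Gi (f' k) x * dk k x (v k)) = rest f' v.
  apply: eq_bigr => k /andP[ki kj]; rewrite /dk (negbTE ki) (negbTE kj) /=.
  under eq_bigr => x _ do rewrite mulrC.
  by rewrite sum_delta.
pose S0 f' := \sum_v R v * ((v i == g i)%:R * (v j == g j)%:R * rest f' v).
have gen f' (ei ej : X -> C) :
    \sum_(w : {ffun 'I_d -> X}) (\prod_k Gi (f' k) (w k)) * (ei (w i) * ej (w j) * R w) =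
    (\sum_x Gi (f' i) x * ei x) * (\sum_x Gi (f' j) x * ej x) * S0 f'.
  pose e k x := if k == i then ei x else if k == j then ej x else 1.
  have eE w : \prod_k e k (w k) = ei (w i) * ej (w j).
    rewrite (prod_ij _ ij) /e eqxx (eq_sym j) (negbTE ij) eqxx big1 ?mulr1 // => k /andP[ki kj].
    by rewrite (negbTE ki) (negbTE kj).
  under eq_bigr => w _ do rewrite RE -eE mulr_sumr mulr_sumr.
  rewrite exchange_big /S0 mulr_sumr; apply: eq_bigr => v _.
  rewrite (eq_bigr (fun w : {ffun 'I_d -> X} =>
    R v * \prod_k (Gi (f' k) (w k) * (e k (w k) * dk k (w k) (v k))))); last first.
    by move=> w _; rewrite !big_split /=; ring.
  rewrite -mulr_sumr -(bigA_distr_bigA (fun k x => Gi (f' k) x * (e k x * dk k x (v k)))) /=.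
  rewrite (prod_ij _ ij) [X in _ * (_ * (_ * X))](_ : _ = rest f' v); last first.
    rewrite -restE; apply: eq_bigr => k /andP[ki kj]; apply: eq_bigr => x _.
    by rewrite /e (negbTE ki) (negbTE kj) mul1r.
  rewrite /e /dk !eqxx (eq_sym j) (negbTE ij) /=.
  have pull (a : X -> C) (y : C) u : \sum_x Gi u x * (a x * y) = (\sum_x Gi u x * a x) * y.
    by rewrite mulr_suml; apply: eq_bigr => x _; rewrite mulrA.
  by rewrite !pull; ring.
have lhs : melt D f g = Gi (f i) (f j) * G (g i) (g j) * S0 f.
  (* The factor [G (w j) (w i)] couples two slots; summing over the letter [x] of slot [j] separates
     them. *)
  rewrite /melt (eq_bigr (fun w : {ffun 'I_d -> X} => \sum_x G (g i) (g j) *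
    ((\prod_k Gi (f k) (w k)) * (G x (w i) * (w j == x)%:R * R w)))); last first.
    move=> w _; rewrite (omR w).1 (bigD1 (w j)) //= [X in _ = _ + X]big1 ?addr0 => [|x xj].
      by rewrite eqxx mulr1; ring.
    by rewrite eq_sym (negbTE xj) mulr0 mul0r !mulr0.
  rewrite exchange_big /=; under eq_bigr => x _ do rewrite -mulr_sumr (gen f (G x) (fun y => (y == x)%:R)).
  rewrite [LHS](eq_bigr (fun x => G (g i) (g j) * S0 f * (Gi (f j) x * \sum_y Gi (f i) y * G x y)));
    last first.
    move=> x _; rewrite [\sum_y Gi (f j) y * _](eq_bigr (fun y => (y == x)%:R * Gi (f j) y)) ?sum_delta; first by ring.
    by move=> y _; rewrite mulrC.
  rewrite -mulr_sumr (_ : \sum_x _ = Gi (f i) (f j)); first by ring.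
  under eq_bigr => x _ do rewrite mulr_sumr.
  rewrite exchange_big /= (eq_bigr (fun y => (y == f j)%:R * Gi (f i) y)) ?sum_delta //.
  move=> y _; rewrite eq_sym -GiG mulr_suml; apply: eq_bigr => x _; ring.
have rhs f' : melt D' f' g = (f' i == g i)%:R * (f' j == g j)%:R * S0 f'.
  rewrite -!GiG -gen; apply: eq_bigr => w _; by rewrite (omR w).2.
rewrite lhs -mulrA; congr (_ * _).
have S0E a b : S0 (fset2 f a b) = S0 f.
  apply: eq_bigr => v _; congr (_ * (_ * _)); apply: eq_bigr => k /andP[ki kj].
  by rewrite ffunE (negbTE ki) (negbTE kj).
rewrite (bigD1 (g i)) //= [X in _ = _ + X]big1 ?addr0 => [|a na]; last first.
  rewrite big1 // => b _; rewrite rhs !ffunE eqxx (negbTE na) !mul0r mulr0.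
  by [].
rewrite (bigD1 (g j)) //= [X in _ = _ + X]big1 ?addr0 => [|b nb]; last first.
  by rewrite rhs !ffunE !eqxx (eq_sym j) (negbTE ij) (negbTE nb) mulr0 mul0r mulr0.
by rewrite rhs !ffunE (eq_sym j) (negbTE ij) !eqxx !mul1r S0E.
Qed.

End CupCap.

End MatrixElements.

(** * The operators eta(D) in coordinates *)

Section GrassmannScalars.
Variable C : fieldType.
Implicit Types (x y : grassmann C) (a b : C) (S : {fset nat}).

Lemma grassmann1E S : (1 : grassmann C)@_S = (S == fset0)%:R.
Proof. by rewrite -[1]/(gone C) /gone mcoeffU eq_sym; case: eqP. Qed.

Lemma gtwistE p x S : (gtwist p x)@_S = (if p then (-1) ^+ #|` S| else 1) * x@_S.
Proof.
case: p; rewrite /gtwist ?mul1r // raddf_sum /=.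
have [Sx|Sx] := boolP (S \in msupp x).
  rewrite (bigD1_seq S) //= ?fset_uniq // mcoeffUU big1 ?addr0 // => T TS.
  by rewrite mcoeffU (negbTE TS).
rewrite (mcoeff_outdom Sx) mulr0 big_seq big1 // => T Tx.
rewrite mcoeffU; case: eqP => // TS; by rewrite -TS Tx in Sx.
Qed.

Lemma gtwist_scalar p a : gtwist p a%:A = a%:A :> grassmann C.
Proof.
apply/malgP => S; rewrite gtwistE mcoeffZ grassmann1E.
by case: eqP => [->|]; rewrite ?mulr0 //; case: p; rewrite ?cardfs0 !mul1r.
Qed.

Lemma mcoeffM_scalar x a S : (x * a%:A)@_S = x@_S * a.
Proof. by rewrite -scalerAr mulr1 mcoeffZ mulrC. Qed.

Lemma scalarM a b : a%:A * b%:A = (a * b)%:A :> grassmann C.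
Proof. by rewrite -scalerAl mul1r scalerA. Qed.

Lemma scalar_prod (I : Type) (r : seq I) (P : pred I) (F : I -> C) :
  \prod_(i <- r | P i) (F i)%:A = (\prod_(i <- r | P i) F i)%:A :> grassmann C.
Proof. by elim/big_rec2: _ => [|i y1 y2 _ ->]; rewrite ?scale1r ?scalarM. Qed.

Lemma scalar_nat (b : bool) : b%:R = (b%:R : C)%:A :> grassmann C.
Proof. by case: b; rewrite ?scale1r ?scale0r. Qed.

End GrassmannScalars.

Section SuperModule.
Variables (C : fieldType) (Y : finType).
Implicit Types (x : fsm C Y) (l : grassmann C).

Lemma fsm_sum x : x = \sum_i Defs.ract (ebasis C i) (x i).
Proof.
apply/ffunP => j; rewrite sum_ffunE (bigD1 j) //= big1 => [|i ij].
  by rewrite addr0 !ffunE eqxx mul1r.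
by rewrite !ffunE eq_sym (negbTE ij) mul0r.
Qed.

Lemma Lambda_linear_sum (phi : fsm C Y -> fsm C Y) x : Lambda_linear phi ->
  forall j, phi x j = \sum_i phi (ebasis C i) j * x i.
Proof.
move=> [phiD phiZ] j; have phi0 : phi 0 = 0.
  by apply: (addrI (phi 0)); rewrite -phiD !addr0.
rewrite {1}[x]fsm_sum (big_morph phi phiD phi0) sum_ffunE; apply: eq_bigr => i _.
by rewrite phiZ ffunE.
Qed.

Lemma homog_ebasis (par : Y -> bool) i : homog par (par i) (ebasis C i).
Proof.
move=> j S; rewrite ffunE; case: eqP => [->|_]; last by rewrite msupp0 in_fset0.
by rewrite addbb -mcoeff_neq0 grassmann1E; case: (S =P fset0) => [->|]; rewrite ?eqxx.
Qed.

End SuperModule.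

Section EtaMatrix.
Variables (C : numFieldType) (W : osp_space C) (d : nat).
Notation X := 'I_(hdim W).
Notation letters := {ffun 'I_d -> X}.
Implicit Types (f g : letters) (v : 'I_d -> superV W).

Definition gram (a b : X) : C := osp_form (tnth (hbasis W) a) (tnth (hbasis W) b).

Lemma tens_scalar v (c : 'I_d -> X -> C) f :
  (forall k i, v k i = (c k i)%:A) -> tens v f = (\prod_k c k (f k))%:A.
Proof.
move=> vc; rewrite ffunE -scalar_prod; apply: eq_bigr => k _.
by rewrite vc gtwist_scalar.
Qed.

Lemma prod_delta f g : \prod_k (f k == g k)%:R = (f == g)%:R :> C.
Proof.
case: eqP => [->|ne]; first by rewrite big1 // => k _; rewrite eqxx.
case: (pickP (fun k => f k != g k)) => [k nk|all]; first by rewrite (bigD1 k) //= (negbTE nk) mul0r.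
by case: ne; apply/ffunP => k; have /negbFE/eqP := all k.
Qed.

Lemma tens_ebasis g : tens (fun k => ebasis C (g k) : superV W) = ebasis C g :> tpow W d.
Proof.
apply/ffunP => f; rewrite (tens_scalar (c := fun k i => (i == g k)%:R)); last first.
  by move=> k i; rewrite ffunE scalar_nat.
by rewrite prod_delta ffunE -scalar_nat.
Qed.

Lemma eq_tens v v' : (forall k, v k = v' k) -> tens v = tens v'.
Proof. by move=> vv'; apply/ffunP => f; rewrite !ffunE; apply: eq_bigr => k _; rewrite vv'. Qed.

Lemma vform_ebasis (a b : X) : vform (ebasis C a : superV W) (ebasis C b) = (gram a b)%:A.
Proof.
rewrite /vform (bigD1 a) //= [X in _ + X]big1 ?addr0 => [|i ia].
  rewrite (bigD1 b) //= [X in _ + X]big1 ?addr0 => [|i ib].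
    by rewrite !ffunE !eqxx scalar_nat gtwist_scalar scale1r mulr1.
  by rewrite !ffunE (negbTE ib) mulr0 scaler0.
rewrite big1 // => j _; rewrite !ffunE (negbTE ia) scalar_nat gtwist_scalar scale0r mul0r scaler0.
by [].
Qed.

Lemma tau_ebasis (i j : 'I_d) (phi : tpow W d -> tpow W d) g : i != j -> acts_as_tau i j phi ->
  phi (ebasis C g) = Defs.ract (ebasis C (fcomp g (tperm i j))) ((-1) ^+ (hpar (g i) && hpar (g j))).
Proof.
move=> ij /(_ (fun k => ebasis C (g k)) (fun k => hpar (g k))) tau.
rewrite -tens_ebasis tau; last by move=> k; apply: homog_ebasis.
congr Defs.ract; rewrite -tens_ebasis; apply: eq_tens => k; rewrite /tupd2 ffunE.
case: (eqVneq k i) => [->|ki]; first by rewrite tpermL.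
case: (eqVneq k j) => [->|kj]; first by rewrite tpermR.
by rewrite tpermD // eq_sym.
Qed.

Section DualBases.
Variables (N : nat) (b b' : N.-tuple W).

(** The coefficients of [c_0] in the homogeneous basis; they will turn out to be the inverse Gram
    matrix. *)
Definition casimir (x y : X) : C :=
  \sum_(a < N) coord (hbasis W) x (tnth b a) * coord (hbasis W) y (tnth b' a).

Lemma gamma_ebasis (i j : 'I_d) (phi : tpow W d -> tpow W d) f g : i != j ->
  acts_as_gamma b b' i j phi ->
  phi (ebasis C g) f = (gram (g i) (g j) * casimir (f i) (f j) *
    \prod_(k | (k != i) && (k != j)) (f k == g k)%:R)%:A.
Proof.
move=> ij gam; rewrite -tens_ebasis gam sum_ffunE /casimir mulr_sumr mulr_suml scaler_suml.
apply: eq_bigr => a _.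
pose c k x : C := if k == i then gram (g i) (g j) * coord (hbasis W) x (tnth b a)
  else if k == j then coord (hbasis W) x (tnth b' a) else (x == g k)%:R.
rewrite (tens_scalar (c := c)) => [|k x]; last first.
  rewrite /tupd2 /c; case: (k == i); first by rewrite !ffunE vform_ebasis gtwist_scalar scalarM.
  by case: (k == j); rewrite !ffunE // scalar_nat.
congr (_ *: _); rewrite (prod_ij _ ij) /c eqxx (eq_sym j) (negbTE ij) eqxx !mulrA; congr (_ * _).
by apply: eq_bigr => k /andP[ki kj]; rewrite (negbTE ki) (negbTE kj).
Qed.

End DualBases.
End EtaMatrix.

(** * The Gram matrix and its inverse *)

Section GramMatrix.
Variables (C : numFieldType) (W : osp_space C).
Notation X := 'I_(hdim W).

Lemma hbasis_basis : basis_of fullv (hbasis W).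
Proof.
rewrite basisEdim -(osp_fullv W) /hbasis span_cat !(span_basis (vbasisP _)) subvv /=.
by rewrite dimv_disjoint_sum ?osp_capv // size_tuple.
Qed.

Lemma hbasis_grade (a : X) : tnth (hbasis W) a \in osp_grade W (hpar a).
Proof.
rewrite (tnth_nth 0) /= nth_cat size_tuple /hpar.
case: (ltnP a (\dim (osp_grade W false))) => [lt|le] /=.
  by apply: vbasis_mem; apply: mem_nth; rewrite size_tuple.
apply: vbasis_mem; apply: mem_nth; rewrite size_tuple.
have : (a < \dim (osp_grade W false) + \dim (osp_grade W true))%N := ltn_ord a.
by move: le; lia.
Qed.

Lemma gram_even (a b : X) : hpar a != hpar b -> gram a b = 0.
Proof. by move=> nab; apply: (osp_even nab); apply: hbasis_grade. Qed.

Lemma gram_sym (a b : X) : gram a b = (-1) ^+ (hpar a && hpar b) * gram b a.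
Proof. by apply: osp_supersym; apply: hbasis_grade. Qed.

Lemma osp_form_coord (u w : W) : osp_form u w =
  \sum_x \sum_y coord (hbasis W) x u * coord (hbasis W) y w * gram x y.
Proof.
have form0r (v : W) : osp_form v (0 : W) = 0.
  by have := osp_linearr v 1 0 (0 : W); rewrite scaler0 addr0 mul1r => /eqP;
    rewrite -{1}[osp_form v 0]addr0 (inj_eq (addrI _)) eq_sym => /eqP.
have form0l (v : W) : osp_form (0 : W) v = 0.
  by have := osp_linearl v 1 0 (0 : W); rewrite scaler0 addr0 mul1r => /eqP;
    rewrite -{1}[osp_form 0 v]addr0 (inj_eq (addrI _)) eq_sym => /eqP.
have formZr (v z : W) a : osp_form v (a *: z) = a * osp_form v z :> C.
  by rewrite -[a *: z]addr0 osp_linearr form0r addr0.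
have formZl (v z : W) a : osp_form (a *: z) v = a * osp_form z v :> C.
  by rewrite -[a *: z]addr0 osp_linearl form0l addr0.
have formDr (v y z : W) : osp_form v (y + z) = osp_form v y + osp_form v z.
  by rewrite -{1}[y]scale1r osp_linearr mul1r.
have formDl (v y z : W) : osp_form (y + z) v = osp_form y v + osp_form z v.
  by rewrite -{1}[y]scale1r osp_linearl mul1r.
have decomp (v : W) : v = \sum_x coord (hbasis W) x v *: tnth (hbasis W) x.
  rewrite {1}(coord_span (X := hbasis W) (v := v)); last by rewrite (span_basis hbasis_basis) memvf.
  by apply: eq_bigr => x _; rewrite (tnth_nth 0).
rewrite {1}(decomp u) {1}(decomp w).
rewrite (big_morph (fun v => osp_form v _) (fun y z => formDl _ y z) (form0l _)).
apply: eq_bigr => x _; rewrite formZl.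
rewrite (big_morph (osp_form _) (formDr _) (form0r _)) mulr_sumr.
by apply: eq_bigr => y _; rewrite formZr mulrA.
Qed.

Variables (N : nat) (b b' : N.-tuple W).
Hypothesis hb : dual_bases b b'.

(** With [B] and [B'] the coordinate matrices of the two bases, duality reads [B' *m Gm *m B^T = 1].
    One-sided inverses of square matrices are two-sided, so [B^T *m B'] inverts [Gm]. *)
Lemma casimir_gram_inv :
  (forall a c : X, \sum_x gram a x * casimir b b' x c = (a == c)%:R) /\
  (forall a c : X, \sum_x casimir b b' a x * gram x c = (a == c)%:R).
Proof.
have [bb _ dual] := hb.
have NE : N = hdim W.
  by rewrite -(size_basis bb) -(size_basis hbasis_basis).
clear bb; subst N.
pose B : 'M[C]_(hdim W) := \matrix_(a, x) coord (hbasis W) x (tnth b a).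
pose B' : 'M[C]_(hdim W) := \matrix_(a, x) coord (hbasis W) x (tnth b' a).
pose Gm : 'M[C]_(hdim W) := \matrix_(x, y) gram x y.
pose Km : 'M[C]_(hdim W) := B^T *m B'.
have KmE x y : Km x y = casimir b b' x y.
  by rewrite mxE; apply: eq_bigr => a _; rewrite !mxE.
have e1 : B' *m (Gm *m B^T) = 1%:M.
  apply/matrixP => a c; rewrite !mxE -dual osp_form_coord; apply: eq_bigr => x _.
  rewrite !mxE mulr_sumr; apply: eq_bigr => y _; rewrite !mxE; ring.
have e2 : Gm *m Km = 1%:M by rewrite /Km mulmxA; apply: mulmx1C.
have e3 : Km *m Gm = 1%:M by apply: mulmx1C.
split=> a c.
  have /matrixP/(_ a c) := e2; rewrite !mxE => <-; apply: eq_bigr => x _.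
  by rewrite [Gm _ _]mxE KmE.
have /matrixP/(_ a c) := e3; rewrite !mxE => <-; apply: eq_bigr => x _.
by rewrite [Gm _ _]mxE KmE.
Qed.

End GramMatrix.

Section EtaMatrixElements.
Variables (C : numFieldType) (W : osp_space C) (d N : nat) (b b' : N.-tuple W).
Hypothesis hb : dual_bases b b'.
Variables (delta : C) (eta : brauer C d d -> EndG W d).
Hypothesis heta : is_eta delta b b' eta.
Notation X := 'I_(hdim W).
Notation letters := {ffun 'I_d -> X}.
Notation par := (@hpar C W).
Notation G := (@gram C W).
Notation Gi := (casimir b b').
Notation elt := (melt par G Gi).

Let G_even := @gram_even C W.
Let G_sym := @gram_sym C W.
Let GGi := (casimir_gram_inv hb).1.
Let GiG := (casimir_gram_inv hb).2.

Lemma eta_apply x t f : eta x t f = \sum_g eta x (ebasis C g) f * t g.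
Proof. by apply: Lambda_linear_sum; apply: endG_linear. Qed.

(** Each case of [diagram_ind] is a product with a generator, on which [eta] is prescribed, and the
    matrix elements satisfy the same recursion. *)
Lemma eta_dg (D : diagram d d) (f g : letters) :
  eta (dg C D) (ebasis C g) f = (elt D f g)%:A.
Proof.
move: D f g; apply: diagram_ind => [|i j D ij PD|i j D ij PD|i j D D' i0 j1 D'i D'j Dt Db DD' PD'] f g.
- by rewrite (eta_one heta) melt_id // ffunE scalar_nat.
- have nij : i != j by exact: ord_succ_neq ij.
  rewrite -(brauer_mul_s_top delta) (eta_mul heta) eta_apply.
  rewrite (bigD1 (fcomp f (tperm i j))) //= big1 ?addr0 => [|h hf].
    rewrite PD (tau_ebasis _ nij (eta_s heta ij)) !ffunE fcompM tperm2 fcomp1 eqxx mul1r.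
    by rewrite tpermL tpermR melt_top // andbC -signr_odd; case: (_ && _);
      rewrite ?expr0 ?expr1 ?mul1r ?mulN1r ?scaleNr.
  rewrite (tau_ebasis _ nij (eta_s heta ij)) !ffunE.
  have -> : (f == fcomp h (tperm i j)) = false; last by rewrite !mul0r.
  by apply: contraNF hf => /eqP ->; rewrite fcompM tperm2 fcomp1.
- have nij : i != j by exact: ord_succ_neq ij.
  rewrite -(brauer_mul_s_bot delta) (eta_mul heta) (tau_ebasis _ nij (eta_s heta ij)).
  rewrite (endG_linear (eta (dg C D))).2 ffunE PD melt_bot //.
  by case: (_ && _); rewrite ?expr0 ?expr1 ?mulr1 ?mul1r ?mulrN1 ?mulN1r ?scaleNr.
have ji : j = i.+1 :> nat by rewrite i0 j1.
have nij : i != j := ord_succ_neq ji.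
rewrite -(brauer_mul_e_top delta nij D'i D'j Dt Db DD') (eta_mul heta) eta_apply.
rewrite (melt_cup_cap par GiG i0 j1 D'i D'j Dt Db DD').
pose T (h : letters) : C := G (h i) (h j) * casimir b b' (f i) (f j) *
    (\prod_(k | (k != i) && (k != j)) (f k == h k)%:R) * elt D' h g.
rewrite (eq_bigr (fun h => (T h)%:A)) => [|h _]; last first.
  rewrite PD' -scalarM; congr (_ * _).
  exact: (gamma_ebasis f h nij (eta_e heta ji)).
rewrite -scaler_suml; congr (_ *: _).
have fi a c : fset2 i j f a c i = a by rewrite ffunE eqxx.
have fj a c : fset2 i j f a c j = c by rewrite ffunE eq_sym (negbTE nij) eqxx.
(* The cup-cap changes letters only in slots [i] and [j], so the intermediate word runs over the
   changes of [f] there. *)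
pose agree (h : letters) := [forall k, (k != i) ==> (k != j) ==> (f k == h k)].
rewrite (bigID agree) /= [X in _ + X]big1 ?addr0 => [|h]; last first.
  rewrite negb_forall => /existsP[k]; rewrite !negb_imply => /and3P[ki kj /negbTE fh].
  by rewrite /T (bigD1 k) ?ki //= fh mul0r mulr0 mul0r.
rewrite (reindex_onto (fun ac : X * X => fset2 i j f ac.1 ac.2) (fun h => (h i, h j))) /=; last first.
  move=> h /forallP ag; apply/ffunP => k; rewrite ffunE.
  case: eqP => [->//|/eqP ki]; case: eqP => [->//|/eqP kj].
  by have := ag k; rewrite ki kj => /eqP.
rewrite (eq_bigl xpredT) => [|[a c]]; last first.
  rewrite /= fi fj eqxx andbT; apply/forallP => k; apply/implyP => ki; apply/implyP => kj.
  by rewrite ffunE (negbTE ki) (negbTE kj).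
rewrite mulr_sumr; under [RHS]eq_bigr => a _ do rewrite mulr_sumr.
rewrite pair_bigA; apply: eq_bigr => -[a c] _ /=; rewrite /T fi fj big1 ?mulr1 => [|k /andP[ki kj]].
  by rewrite mulrAC mulrC mulrA mulrAC.
by rewrite ffunE (negbTE ki) (negbTE kj) eqxx.
Qed.

Lemma eta_sum (x : brauer C d d) f g :
  eta x (ebasis C g) f = \sum_D gtwist (tpar f) (x D) * (elt D f g)%:A.
Proof.
have eta0 t : eta 0 t = 0.
  by apply: (addrI (eta 0 t)); rewrite -(eta_add heta) !addr0.
have etaS (r : seq (diagram d d)) (F : diagram d d -> brauer C d d) t :
    eta (\sum_(D <- r) F D) t = \sum_(D <- r) eta (F D) t.
  by elim: r => [|D r IH]; rewrite ?big_nil ?eta0 // !big_cons (eta_add heta) IH.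
have {1}-> : x = \sum_D x D *: dg C D.
  apply/ffunP => D; rewrite sum_ffunE (bigD1 D) //= big1 ?addr0 => [|E ED].
    by rewrite !ffunE eqxx [_ *: _]mulr1.
  by rewrite !ffunE eq_sym (negbTE ED) scaler0.
rewrite etaS sum_ffunE; apply: eq_bigr => D _.
by rewrite (eta_scale heta) ffunE eta_dg.
Qed.

(** On a monomial of Lambda the twist is a mere sign, so vanishing can be tested on each
    coefficient. Lowering the output letters loses nothing because [G] and [Gi] are inverse. *)
Lemma eta_kernel (x : brauer C d d) : (forall t, eta x t = 0) <->
  (forall (S : {fset nat}) w g, \sum_D (x D)@_S * omega par G D w g = 0).
Proof.
have coef S f g : (eta x (ebasis C g) f)@_S =
    (if tpar f then (-1) ^+ #|` S| else 1) * \sum_D (x D)@_S * elt D f g.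
  rewrite eta_sum raddf_sum mulr_sumr; apply: eq_bigr => D _ /=.
  by rewrite mcoeffM_scalar gtwistE mulrA.
have sgn0 (p : bool) n (c : C) : (if p then (-1) ^+ n else 1) * c = 0 -> c = 0.
  by move/eqP; rewrite mulf_eq0; case: p; rewrite ?signr_eq0 ?oner_eq0 => /eqP.
split=> [e0 S w g|om0 t].
  have m0 f : \sum_D (x D)@_S * elt D f g = 0.
    by apply: (sgn0 (tpar f) #|` S|); rewrite -coef e0 ffunE mcoeff0.
  have low D : omega par G D w g = \sum_(f : letters) (\prod_k G (w k) (f k)) * elt D f g.
    rewrite /melt; under eq_bigr => f _ do rewrite mulr_sumr.
    rewrite exchange_big /= (bigD1 w) //= [X in _ + X]big1 ?addr0 => [|w' w'w].
      under eq_bigr => f _ do rewrite mulrA -big_split.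
      rewrite -mulr_suml -(bigA_distr_bigA (fun k y => G (w k) y * Gi y (w k))) /= big1 ?mul1r //.
      by move=> k _; rewrite GGi eqxx.
    under eq_bigr => f _ do rewrite mulrA -big_split.
    rewrite -mulr_suml -(bigA_distr_bigA (fun k y => G (w k) y * Gi y (w' k))) /=.
    under eq_bigr => k _ do rewrite GGi.
    by rewrite prod_delta eq_sym (negbTE w'w) mul0r.
  under eq_bigr => D _ do rewrite low mulr_sumr.
  rewrite exchange_big big1 // => f _.
  under eq_bigr => D _ do rewrite mulrCA.
  by rewrite -mulr_sumr m0 mulr0.
apply/ffunP => f; rewrite eta_apply [RHS]ffunE big1 // => g _.
suff -> : eta x (ebasis C g) f = 0 by rewrite mul0r.
apply/malgP => S; rewrite coef mcoeff0 /melt.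
under eq_bigr => D _ do rewrite mulr_sumr.
rewrite exchange_big big1 ?mulr0 // => w _.
under eq_bigr => D _ do rewrite mulrCA.
by rewrite -mulr_sumr om0 mulr0.
Qed.

End EtaMatrixElements.

(** * Bending diagrams *)

(** The leftmost bottom point stands just after the [q] top points; once bent it is the last of
    [q + 1] top points read from right to left, in the same place. *)
Lemma lin_pos_bend (p q : nat) (x : bpts p.+1 q) : lin_pos (bend x) = lin_pos x :> nat.
Proof.
case: x => a /=; last by rewrite /bump /= add1n.
by case: unliftP => [c ->|->] /=; rewrite ?/bump /=; lia.
Qed.

Lemma relabelE (p q p' q' : nat) (h : bpts p q -> bpts p' q') (k : bpts p' q' -> bpts p q)
    (hK : cancel h k) (kK : cancel k h) (D : diagram p q) x : relabel hK kK D (h x) = h (D x).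
Proof. by rewrite /= ffunE /= hK. Qed.

Lemma relabelK (p q p' q' : nat) (h : bpts p q -> bpts p' q') (k : bpts p' q' -> bpts p q)
    (hK : cancel h k) (kK : cancel k h) : cancel (relabel hK kK) (relabel kK hK).
Proof. by move=> D; apply: diagram_eqP => x; rewrite -{1}(hK x) !relabelE hK. Qed.

Section BendRelation.

Definition same_shape (p q p' q' : nat) (D : diagram p q) (D' : diagram p' q') : Prop :=
  forall x x', lin_pos x = lin_pos x' :> nat -> lin_pos (D x) = lin_pos (D' x') :> nat.

(** The casts in [Uiter] hide an explicit formula. What is kept is bijectivity and the preservation
    of positions, compared as natural numbers because the ordinal types differ. *)
Definition bends_to (p q p' q' : nat) (f : diagram p q -> diagram p' q') : Prop :=
  bijective f /\ forall D, same_shape D (f D).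

Variable C : fieldType.

Lemma brauer_lin_comp (p q p' q' p'' q'' : nat) (f : diagram p q -> diagram p' q')
    (h : diagram p' q' -> diagram p'' q'') (x : brauer C p q) :
  brauer_lin h (brauer_lin f x) = brauer_lin (h \o f) x.
Proof.
apply/ffunP => D; rewrite !sum_ffunE.
under eq_bigr => E _ do rewrite !ffunE sum_ffunE [_ *: _]mulr_suml.
rewrite exchange_big; apply: eq_bigr => E _; rewrite (bigD1 (f E)) //= big1 ?addr0 => [|E' ne].
  by rewrite !ffunE eqxx [_ *: _]mulr1.
by rewrite !ffunE (negbTE ne) [_ *: _]mulr0 mul0r.
Qed.

Lemma brauer_linE (p q p' q' : nat) (f : diagram p q -> diagram p' q') (h : diagram p' q' -> diagram p q)
    (x : brauer C p q) D : cancel f h -> cancel h f -> brauer_lin f x D = x (h D).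
Proof.
move=> fK hK; rewrite sum_ffunE (bigD1 (h D)) //= big1 ?addr0 => [|E ne].
  by rewrite !ffunE hK eqxx [_ *: _]mulr1.
rewrite !ffunE; case: eqP => [e|_]; last by rewrite [_ *: _]mulr0.
by rewrite e fK eqxx in ne.
Qed.

Lemma brauer_lin_id (p q : nat) (x : brauer C p q) : brauer_lin id x = x.
Proof. by apply/ffunP => D; rewrite (brauer_linE (h := id)). Qed.

Lemma cast_top_lin (p q p' q' q'' : nat) (e : q' = q'') (f : diagram p q -> diagram p' q') :
  bends_to f -> exists2 h : diagram p q -> diagram p' q'', bends_to h &
    forall x : brauer C p q, cast_top e (brauer_lin f x) = brauer_lin h x.
Proof. by case: q'' / e => fb; exists f. Qed.

Lemma same_shape_trans (p q p' q' p'' q'' : nat) (D : diagram p q) (E : diagram p' q')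
    (F : diagram p'' q'') : (q + p = q' + p')%N -> same_shape D E -> same_shape E F -> same_shape D F.
Proof.
move=> pq DE EF x x'' xx''.
have ltx : (lin_pos x < q' + p')%N by rewrite -pq ltn_ord.
have := DE x (lin_pt (Ordinal ltx)); rewrite lin_ptK => /(_ erefl) ->.
by apply: EF; rewrite lin_ptK.
Qed.

Lemma Uiter_lin (k p q : nat) : exists2 f : diagram (k + p) q -> diagram p (k + q),
  bends_to f & forall x : brauer C (k + p) q, Uiter x = brauer_lin f x.
Proof.
elim: k q => [|k IH] q.
  exists id => [|x]; last by rewrite brauer_lin_id.
  split; first by exists id.
  move=> D x x' /val_inj xx'; congr (nat_of_ord (lin_pos (D _))).
  exact: can_inj (@lin_posK p q) _ _ xx'.
have [f [[g fK gK] fb] fE] := IH q.+1.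
pose h := relabel (@bendK (k + p) q) (@unbendK (k + p) q).
have hb : bends_to (f \o h).
  split.
    by apply: bij_comp; [exists g | exists (relabel (@unbendK (k + p) q) (@bendK (k + p) q));
      apply: relabelK].
  move=> D; apply: same_shape_trans (fb (h D)); first by rewrite addnS.
  move=> x x'; rewrite -lin_pos_bend => /val_inj/(can_inj (@lin_posK _ _)) <-.
  by rewrite relabelE lin_pos_bend.
have [h' h'b h'E] := cast_top_lin (addnS k q) hb.
by exists h' => // x; rewrite /= fE /U brauer_lin_comp h'E.
Qed.

End BendRelation.

Lemma Ud_lin (C : fieldType) (d : nat) : exists2 f : diagram (d + d) 0 -> diagram d d,
  bends_to f & forall x : brauer C (d + d) 0, Ud x = brauer_lin f x.
Proof.
have [f fb fE] := Uiter_lin C d d 0.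
have [h hb hE] := cast_top_lin C (addn0 d) fb.
by exists h => // x; rewrite /Ud fE hE.
Qed.

(** * The orbit of D0 and the kernel of eta *)

Section D0Orbit.
Variable N : nat.
Implicit Types (E : diagram N 0) (s : 'S_N) (z : 'I_N).

(** The default never occurs, as there are no top points. *)
Definition bot_mate E z : 'I_N := if E (inl z) is inl z' then z' else z.

Lemma bot_mateE E z : E (inl z) = inl (bot_mate E z).
Proof. by rewrite /bot_mate; case: (E (inl z)) => // -[]. Qed.

Lemma bot_mateK E : involutive (bot_mate E).
Proof.
by move=> z; have := mate_involutive E (inl z); rewrite !bot_mateE => -[].
Qed.

Lemma bot_mate_neq E z : bot_mate E z != z.
Proof. by have := mate_neq E (inl z); rewrite bot_mateE; apply: contra => /eqP ->. Qed.

Lemma bot_mate_inj E E' : bot_mate E =1 bot_mate E' -> E = E'.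
Proof. by move=> e; apply: diagram_eqP => -[z|[]//]; rewrite !bot_mateE e. Qed.

Lemma bot_mate_perm E s z : bot_mate (diag_perm E s) z = s^-1%g (bot_mate E (s z)).
Proof.
have := bot_mateE (diag_perm E s) z; rewrite /= ffunE /= bot_mateE /= => -[<-].
by [].
Qed.

Lemma fpf_involution_cycles (u : 'S_N) : involutive u -> (forall z, u z != z) ->
  cycle_type u = nseq N./2 2%N.
Proof.
move=> uK uz.
have card2 x : #|porbit u x| = 2%N.
  rewrite (_ : porbit u x = [set x; u x]); first by rewrite cards2 eq_sym uz.
  apply/setP => y; rewrite !inE; apply/porbitP/orP => [[i ->]|[]/eqP ->].
  - elim: i => [|i [/eqP e|/eqP e]]; first by left; rewrite perm1.
      by right; rewrite expgSr permM e.
    by left; rewrite expgSr permM e uK.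
  - by exists 0%N; rewrite perm1.
  - by exists 1%N; rewrite expg1.
have all2 : all (pred1 2%N) (cycle_type u).
  apply/allP => c /mapP[A]; rewrite mem_cycles => /imsetP[x _ ->] ->.
  by rewrite /= card2.
have /and3P[_ _ /eqP sumN] := cycle_type_partition u.
move/all_pred1P: all2 => ct2; move: sumN; rewrite {1}ct2 sumn_nseq => e.
by have := congr1 half e; rewrite mul2n doubleK => <-.
Qed.

End D0Orbit.

Section Final.
Variables (C : numFieldType) (d : nat).
Implicit Types (E : diagram (d + d) 0) (s : 'S_(d + d)).

Lemma bot_mate_D0 z : bot_mate (D0 d) z = u0 z.
Proof. by rewrite /bot_mate ffunE; apply: val_inj. Qed.

(** Matchings are fixed-point-free involutions; these share a cycle type and are therefore
    conjugate. *)
Lemma D0_transitive E : exists s, diag_perm (D0 d) s = E.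
Proof.
pose uE := perm (inv_inj (bot_mateK E)); pose u := perm (inv_inj (@u0K d)).
have [g eg] : exists g, uE = (g^-1 * u * g)%g.
  apply: cycle_type_conj; rewrite !fpf_involution_cycles //.
  - by move=> z; rewrite !permE bot_mateK.
  - by move=> z; rewrite permE bot_mate_neq.
  - by move=> z; rewrite !permE u0K.
  - by move=> z; rewrite permE u0_neq.
exists g^-1%g; apply: bot_mate_inj => z.
have uEz : uE z = g (u (g^-1%g z)) by rewrite eg !permM.
by rewrite bot_mate_perm bot_mate_D0 invgK -[RHS](permE (inv_inj (bot_mateK E)) z) uEz [u _]permE.
Qed.

Definition lcoef (S : {fset nat}) (y : LSym C (d + d)) : CSym C (d + d) :=
  [ffun s => (y s : grassmann C)@_S].

Lemma diag_actE (y : LSym C (d + d)) E :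
  diag_act (D0 d) y E = \sum_(s | diag_perm (D0 d) s == E) y s.
Proof.
rewrite sum_ffunE [RHS]big_mkcond; apply: eq_bigr => s _; rewrite !ffunE eq_sym.
by case: eqP => _; [exact: mulr1 | exact: mulr0].
Qed.

Section InvariantForms.
Variables (X : finType) (par : X -> bool) (G Gi : X -> X -> C).
Hypothesis G_even : forall a b, par a != par b -> G a b = 0.
Hypothesis G_sym : forall a b, G a b = (-1) ^+ (par a && par b) * G b a.
Hypothesis GiG : forall a c, \sum_b Gi a b * G b c = (a == c)%:R.

Lemma wform_diag_perm s : wform par G (bot_mate (diag_perm (D0 d) s)) = pact par s (wform par G (@u0 d)).
Proof.
rewrite -wform_conj //; [|exact: u0K|exact: u0_neq].
by apply: eq_wform => z; rewrite bot_mate_perm bot_mate_D0.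
Qed.

(** This links the right action on diagrams with the signed action on forms: [D0 y] kills the
    pairing with forms exactly when [y] kills the form of [D0]. *)
Lemma diag_act_form S (y : LSym C (d + d)) :
  \sum_E (diag_act (D0 d) y E : grassmann C)@_S *: wform par G (bot_mate E) =
  act par (lcoef S y) (wform par G (@u0 d)).
Proof.
under eq_bigr => E _ do rewrite diag_actE raddf_sum scaler_suml.
rewrite (exchange_big_dep predT) //=; apply: eq_bigr => s _.
rewrite (big_pred1 (diag_perm (D0 d) s)) => [|E]; last by rewrite eq_sym.
by rewrite wform_diag_perm ffunE.
Qed.

End InvariantForms.
End Final.

(** * Comparison of complex and Grassmann coefficients in the ideal *)

Section KernelIdeal.
Variables (C : numFieldType) (m n N : nat).
Implicit Types (y : LSym C N) (z : CSym C N).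

Lemma in_I_sum (I : eqType) (r : seq I) (F : I -> LSym C N) :
  (forall i, i \in r -> in_I m n (F i)) -> in_I m n (\sum_(i <- r) F i).
Proof.
elim: r => [|i r IH] rI; first by exists [::]; rewrite ?big_nil.
have [r1 r1I r1E] := rI i (mem_head _ _).
have [r2 r2I r2E] : in_I m n (\sum_(i <- r) F i).
  by apply: IH => j jr; apply: rI; rewrite inE jr orbT.
exists (r1 ++ r2); last by rewrite big_cons big_cat r1E r2E.
by move=> t; rewrite mem_cat => /orP[/r1I|/r2I].
Qed.

Lemma LSym_sum y : exists r : seq {fset nat},
  y = \sum_(S <- r) ltensor << 1 *g S >> [ffun s => (y s : grassmann C)@_S].
Proof.
pose D : {fset {fset nat}} := \big[@fsetU _/fset0%fset]_(s <- enum 'S_N) msupp (y s : grassmann C).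
exists (enum_fset D); apply/ffunP => s; rewrite sum_ffunE.
have le : (msupp (y s : grassmann C) `<=` D)%fset by apply: (bigfcup_sup (P := xpredT)); rewrite ?mem_enum.
rewrite [LHS](monalgEw le); apply: eq_bigr => S _.
by rewrite !ffunE gscaleUE mulr1.
Qed.

Variables (X : finType) (par : X -> bool).
Hypotheses (Xm : #|[pred x | ~~ par x]| = m) (Xn : #|[pred x | par x]| = (2 * n)%N).

Lemma in_I_ltensor l z : act_kernel par z -> in_I m n (ltensor l z).
Proof.
move/act_kernelP => [r rI ->].
have -> : ltensor l (\sum_(t <- r) t.2) = \sum_(t <- r) ltensor l t.2.
  by apply/ffunP => s; rewrite ffunE !sum_ffunE scaler_suml; apply: eq_bigr => t _; rewrite ffunE.
exists [seq (t.1, ltensor l t.2) | t <- r]; last by rewrite big_map.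
move=> t /mapP[t0 /rI[p0 c0 i0] ->]; split => //=; first by rewrite -Xm -Xn.
exists [:: (l, t0.2)]; last by rewrite big_seq1.
by move=> t'; rewrite inE => /eqP ->.
Qed.

Lemma in_I_kernel S y : in_I m n y -> act_kernel par ([ffun s => (y s : grassmann C)@_S] : CSym C N).
Proof.
move=> [r rI ->].
rewrite (_ : [ffun s => _] = \sum_(t <- r) ([ffun s => (t.2 s : grassmann C)@_S] : CSym C N)).
  move=> F; rewrite act_suml big_seq big1 // => t /rI[pt ct [r' r'I ->]].
  rewrite (_ : [ffun s => _] = \sum_(t' <- r') (t'.1)@_S *: t'.2).
    rewrite act_suml big_seq big1 // => t' /r'I t'I; rewrite actZl.
    by rewrite (young_ideal_kernel pt _ t'I) ?scaler0 // Xm Xn.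
  apply/ffunP => s; rewrite ffunE !sum_ffunE raddf_sum; apply: eq_bigr => t' _ /=.
  by rewrite !ffunE mcoeffZ mulrC.
apply/ffunP => s; rewrite ffunE !sum_ffunE raddf_sum; apply: eq_bigr => t _.
by rewrite ffunE.
Qed.

End KernelIdeal.

Lemma card_hpar (C : numFieldType) (W : osp_space C) :
  #|[pred a : 'I_(hdim W) | ~~ hpar a]| = \dim (osp_grade W false) /\
  #|[pred a : 'I_(hdim W) | hpar a]| = \dim (osp_grade W true).
Proof.
have odd_card : #|[pred a : 'I_(hdim W) | hpar a]| = \dim (osp_grade W true).
  rewrite -sum1_card big_mkcond big_split_ord /= big1 ?add0n => [|i _].
    rewrite -[RHS]card_ord -sum1_card; apply: eq_bigr => i _.
    by rewrite inE /hpar /= leq_addr.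
  by rewrite inE /hpar /= leqNgt ltn_ord.
split=> //; have := cardC [pred a : 'I_(hdim W) | hpar a]; rewrite odd_card card_ord.
by rewrite [X in _ = X -> _]addnC => /addnI <-; apply: eq_card => a; rewrite !inE.
Qed.

Theorem eta_kernel_bend (C : numFieldType) (m n d : nat) (W : osp_space C)
    (hm : \dim (osp_grade W false) = m) (hn : \dim (osp_grade W true) = (2 * n)%N)
    (N : nat) (b b' : N.-tuple W) (hb : dual_bases b b') (delta : C)
    (eta : brauer C d d -> EndG W d) (heta : is_eta delta b b' eta) (x : brauer C d d) :
  (forall t, eta x t = 0) <->
  (exists2 y : LSym C (d + d), in_I m n y & x = Ud (diag_act (D0 d) y)).
Proof.
have [Xm Xn] := card_hpar W; rewrite hm in Xm; rewrite hn in Xn.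
have [f [[h fK hK] fshape] UdE] := Ud_lin C d.
pose par := @hpar C W; pose G := @gram C W.
(* Bending preserves positions, so the lowered matrix element of the bent diagram is the form of the
   original matching. *)
have omE E w g : omega par G (f E) w g = wform par G (bot_mate E) (joint w g).
  rewrite /omega (eq_wform par G (u' := bot_mate E)) // => z; apply: val_inj.
  rewrite /= /lin_mate -(fshape E (inl z)) ?bot_mateE //.
  by rewrite lin_ptK.
have forms (x' : brauer C (d + d) 0) : x = Ud x' ->
    (forall t, eta x t = 0) <->
    (forall S, \sum_E (x' E : grassmann C)@_S *: wform par G (bot_mate E) = 0).
  move=> xx'; have xE E : x (f E) = x' E by rewrite xx' UdE (brauer_linE _ _ fK hK) fK.
  have sumE S w g : \sum_D (x D : grassmann C)@_S * omega par G D w g =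
      (\sum_E (x' E : grassmann C)@_S *: wform par G (bot_mate E)) (joint w g).
    rewrite (reindex f) /=; last by exists h => E _; rewrite ?fK ?hK.
    rewrite sum_ffunE; apply: eq_bigr => E _.
    by rewrite xE omE [in RHS]ffunE.
  rewrite (eta_kernel hb heta); split=> [k0 S|k0 S w g]; last by rewrite sumE k0 ffunE.
  apply/ffunP => l.
  have -> : l = joint [ffun j => l (lin_pos (inr j : bpts d d))] [ffun i => l (lin_pos (inl i : bpts d d))].
    apply/ffunP => z; rewrite !ffunE -{1}(lin_ptK z).
    by case: (lin_pt z) => a; rewrite !ffunE.
  by rewrite -sumE k0 ffunE.
have G_even := @gram_even C W; have G_sym := @gram_sym C W.
have GiG := (casimir_gram_inv hb).2.
split=> [x0|[y yI xy]]; last first.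
  apply/(forms _ xy) => S; rewrite diag_act_form //.
  exact: (in_I_kernel Xm Xn S yI).
pose x' : brauer C (d + d) 0 := [ffun E => x (f E)].
have xx' : x = Ud x'.
  by apply/ffunP => D; rewrite UdE (brauer_linE _ _ fK hK) ffunE hK.
pose cnt E := #|[pred s : 'S_(d + d) | diag_perm (D0 d) s == E]|.
have cnt0 E : (cnt E)%:R != 0 :> C.
  rewrite pnatr_eq0 -lt0n; have [s sE] := D0_transitive E.
  by apply/card_gt0P; exists s; rewrite inE sE.
(* The coefficient of each diagram is spread evenly over the permutations carrying [D0] to it. So
   [D0 y] is [x'], and [y] depends only on the coset of the stabilizer, which gives the invariance
   needed below. *)
pose y : LSym C (d + d) :=
  [ffun s => ((cnt (diag_perm (D0 d) s))%:R^-1 : C) *: (x' (diag_perm (D0 d) s) : grassmann C)].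
have yx' : diag_act (D0 d) y = x'.
  apply/ffunP => E; rewrite diag_actE.
  rewrite (eq_bigr (fun=> ((cnt E)%:R^-1 : C) *: (x' E : grassmann C))) => [|s /eqP sE].
    rewrite sumr_const -/(cnt E).
    have cntK (v : grassmann C) : ((cnt E)%:R^-1 *: v) *+ cnt E = v.
      by rewrite -scaler_nat scalerA mulfV // scale1r.
    exact: cntK.
  by rewrite ffunE sE.
exists y; last by rewrite yx'.
have [r ->] := LSym_sum y; apply: in_I_sum => S _; apply: (in_I_ltensor Xm Xn).
(* The coefficient of each monomial inherits the invariance of [y]: a permutation commuting with
   [u0] does not change the diagram obtained from [D0]. *)
move=> F; apply: (D0_form_generates G_even G_sym GiG).
  move=> g gu; apply/ffunP => s; rewrite gbaseMr !ffunE.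
  suff -> : diag_perm (D0 d) (s * g^-1)%g = diag_perm (D0 d) s by [].
  apply: bot_mate_inj => z; rewrite !bot_mate_perm !bot_mate_D0 invMg invgK !permM.
  by rewrite gu permKV.
rewrite -[X in act _ X _]/(lcoef S y) -diag_act_form // yx'.
by have /forms := xx'; case=> + _; apply.
Qed.

Theorem corollary5p8 (R : realType) (m n d : nat) (hd : (1 <= d)%N)
    (W : osp_space R[i])
    (hm : \dim (osp_grade W false) = m) (hn : \dim (osp_grade W true) = (2 * n)%N)
    (N : nat) (b b' : N.-tuple W) (hb : dual_bases b b')
    (eta : brauer R[i] d d -> EndG W d)
    (heta : is_eta (m%:R - (2 * n)%:R) b b' eta)
    (x : brauer R[i] d d) :
  (forall t, eta x t = 0) <->
  (exists2 y : LSym R[i] (d + d), in_I m n y & x = Ud (diag_act (D0 d) y)).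
Proof.
exact: (@eta_kernel_bend R[i] m n d W hm hn N b b' hb _ eta heta x).
Qed.
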